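(* Let $\Gamma$ be one of the groups $\mathbb{Z}_2^{(2)},\mathbb{Z}_2^{(3)},D_4^{(1)},D_4^{(2)},D_6^{(1)},D_6^{(2)},D_8,D_{12}\subset GL(2,\mathbb{Z})$, with fundamental generators $\rho_1,\rho_2$. The joint spectral measure $\widetilde\nu$ (over $\mathfrak{D}=\Psi(\mathbb{T}^2)$, where $\Psi(\omega_1,\omega_2)=(x,y)=(\chi_{\rho_1}(\omega_1,\omega_2),\chi_{\rho_2}(\omega_1,\omega_2))$) for the pair of graphs $(\mathcal{H}^\Gamma_{\rho_1},\mathcal{H}^\Gamma_{\rho_2})$ is $$\mathrm{d}\widetilde\nu(x,y)=\frac{|\Gamma|}{|J_\Gamma(x,y)|}\,\mathrm{d}x\,\mathrm{d}y,$$ where $J_\Gamma=\det(\partial(x,y)/\partial(\theta_1,\theta_2))$.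
   Context: Groups. Let $T_2=\begin{pmatrix}1&0\\0&-1\end{pmatrix}$, $T_2'=\begin{pmatrix}0&1\\1&0\end{pmatrix}$, $T_3=\begin{pmatrix}0&-1\\1&-1\end{pmatrix}$, $T_4=\begin{pmatrix}0&-1\\1&0\end{pmatrix}$, $T_6=\begin{pmatrix}0&1\\-1&1\end{pmatrix}$. The groups are generated as follows: $\mathbb{Z}_2^{(2)}=\langle T_2\rangle$, $\mathbb{Z}_2^{(3)}=\langle T_2'\rangle$, $D_4^{(1)}=\langle -I,T_2\rangle$, $D_4^{(2)}=\langle -I,T_2'\rangle$, $D_6^{(1)}=\langle T_3,T_2'\rangle$, $D_6^{(2)}=\langle T_3,-T_2'\rangle$, $D_8=\langle T_4,T_2'\rangle$, $D_{12}=\langle T_6,T_2'\rangle$. $\Gamma$ acts on $\theta=(\theta_1,\theta_2)\in\mathbb{R}^2/\mathbb{Z}^2\cong\mathbb{T}^2$ by matrix multiplication and on weights $\lambda\in\mathbb{Z}^2$ by the dual action, $\langle\gamma\cdot\lambda,\theta\rangle=\langle\lambda,\gamma\theta\rangle$. Characters. For $\lambda\in\mathbb{Z}^2$ put $S_\lambda(\theta)=\sum_{\gamma\in\Gamma}\det(\gamma)e^{2\pi i\langle\lambda,\gamma\theta\rangle}$. $P_+$ is the (closed) fundamental domain for $\Gamma$ acting on $\mathbb{Z}^2$ that contains all $(\lambda_1,\lambda_2)$ with $0\le\lambda_2\le\lambda_1$ (the integer points of a closed Weyl chamber), and $P_{++}\subset P_+$ is the set of points not fixed by any non-identity element of $\Gamma$.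 $\varrho$ is the point of $P_{++}$ of smallest Euclidean norm, except that for $\mathbb{Z}_2^{(3)}$ one takes $\varrho=(1,0)$. For $\lambda\in P_+$, with $\omega_j=e^{2\pi i\theta_j}$, $\chi_\lambda(\omega_1,\omega_2)=S_{\lambda+\varrho}(\theta)/S_\varrho(\theta)$, a Laurent polynomial $\chi_\lambda=\sum_\nu p^\lambda_\nu\,\sigma_\nu$ with non-negative integer coefficients, where $\sigma_\nu(\omega_1,\omega_2)=\omega_1^{\nu_1}\omega_2^{\nu_2}$, $\nu\in\mathbb{Z}^2$. Fundamental generators: $\rho_1=(1,0),\rho_2=(0,1)$ for $\mathbb{Z}_2^{(2)},D_4^{(1)},D_6^{(2)}$; $\rho_1=(1,0),\rho_2=(1,1)$ for $\mathbb{Z}_2^{(3)},D_4^{(2)},D_6^{(1)},D_8,D_{12}$. Graphs and measure. $\mathcal{H}^\Gamma_{\lambda}$ is the graph with vertex set $\mathbb{Z}^2$ and $n^\lambda_{\mu\nu}$ edges from $\mu$ to $\nu$, where $\chi_\lambda\sigma_\mu=\sum_\nu n^\lambda_{\mu\nu}\sigma_\nu$. Its adjacency operator is the normal operator $A_\lambda=\sum_\nu p^\lambda_\nu\, s^{\nu_1}\otimes s^{\nu_2}$ on $\ell^2(\mathbb{Z})\otimes\ell^2(\mathbb{Z})$, with $s$ the bilateral shift. Let $\varphi$ be the vector state of the basis vector at the vertex $(0,0)$. The joint spectral measure $\widetilde\nu$ of $(\mathcal{H}^\Gamma_{\rho_1},\mathcal{H}^\Gamma_{\rho_2})$ is the unique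 probability measure on the joint spectrum $\mathfrak{D}\subset\mathbb{C}^2$ of the commuting normal operators $A_{\rho_1},A_{\rho_2}$ with $\varphi(A_{\rho_1}^{m_1}(A_{\rho_1}^* )^{n_1}A_{\rho_2}^{m_2}(A_{\rho_2}^* )^{n_2})=\int_{\mathfrak{D}}x^{m_1}\overline{x}^{n_1}y^{m_2}\overline{y}^{n_2}\,\mathrm{d}\widetilde\nu(x,y)$ for all integers $m_i,n_i\ge0$. Jacobian and area element. $J_\Gamma$ is the (possibly complex-valued) Jacobian determinant of $\theta\mapsto(x,y)$; $|J_\Gamma|$ is $\Gamma$-invariant and is regarded as a function of the point $(x,y)\in\mathfrak{D}$. $\mathrm{d}x\,\mathrm{d}y$ denotes the area element on the surface $\mathfrak{D}$ given by the modulus of the 2-form $\mathrm{d}x\wedge\mathrm{d}y$, i.e. $\int_{\mathfrak{D}}f(x,y)\,\mathrm{d}x\,\mathrm{d}y=\int_C f(\Psi(\theta))\,|J_\Gamma(\theta)|\,\mathrm{d}\theta_1\mathrm{d}\theta_2$ for a fundamental domain $C$ of $\mathbb{T}^2/\Gamma$; when $x,y$ are real-valued it is Lebesgue measure on $\mathfrak{D}\subset\mathbb{R}^2$. *)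

(* Defs.v *)
From HB Require Import structures.
From mathcomp Require Export all_boot all_order all_algebra.
From mathcomp Require Export finmap.
From mathcomp Require Export all_classical all_reals all_analysis.
From mathcomp Require Export complex.

Set Implicit Arguments.
Unset Strict Implicit.
Unset Printing Implicit Defensive.

Import Order.TTheory GRing.Theory Num.Theory.
Import numFieldNormedType.Exports.

Local Open Scope classical_set_scope.
Local Open Scope ring_scope.
Local Open Scope complex_scope.

(** * The groups *)

Inductive group_name :=
  Z2_2 | Z2_3 | D4_1 | D4_2 | D6_1 | D6_2 | D8 | D12.

Definition mx2 (a b c d : int) : 'M[int]_2 :=
  \matrix_(i, j) (if i == 0 then (if j == 0 then a else b)
                  else (if j == 0 then c else d)).

Definition T2  : 'M[int]_2 := mx2 1 0 0 (-1).
Definition T2' : 'M[int]_2 := mx2 0 1 1 0.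
Definition T3  : 'M[int]_2 := mx2 0 (-1) 1 (-1).
Definition T4  : 'M[int]_2 := mx2 0 (-1) 1 0.
Definition T6  : 'M[int]_2 := mx2 0 1 (-1) 1.

Definition generators (G : group_name) : set 'M[int]_2 :=
  match G with
  | Z2_2 => [set T2]
  | Z2_3 => [set T2']
  | D4_1 => [set - 1%:M; T2]
  | D4_2 => [set - 1%:M; T2']
  | D6_1 => [set T3; T2']
  | D6_2 => [set T3; - T2']
  | D8   => [set T4; T2']
  | D12  => [set T6; T2']
  end.

Inductive generated (S : set 'M[int]_2) : set 'M[int]_2 :=
| generated_base g : S g -> generated S g
| generated_one : generated S 1%:M
| generated_mul g h : generated S g -> generated S h -> generated S (g *m h)
| generated_inv g : generated S g -> generated S (invmx g).

Definition Gamma (G : group_name) : set 'M[int]_2 := generated (generators G).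

Definition order (G : group_name) : nat := #|` fset_set (Gamma G)|.

(** * Weights *)

Definition weight : Type := (int * int)%type.

(* The dual action, <dual_act g v, theta> = <v, g theta>: the matrix of
   [dual_act g] is the transpose of [g]. *)
Definition dual_act (g : 'M[int]_2) (v : weight) : weight :=
  (g 0 0 * v.1 + g 1 0 * v.2, g 0 1 * v.1 + g 1 1 * v.2).

Definition dotz (v w : weight) : int := v.1 * w.1 + v.2 * w.2.

(* Integer points of the closed Weyl chamber containing every (w1, w2) with
   0 <= w2 <= w1.  The elements of determinant -1 are the reflections; for such
   a [g] the vectors v - g.v and w - g.w lie on one line, and their dot product
   is non-negative iff no mirror of [g] strictly separates v from w. *)
Definition Pplus (G : group_name) : set weight :=
  [set v | forall g, Gamma G g -> \det g = -1 ->
     forall w : weight, 0 <= w.2 -> w.2 <= w.1 ->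
     0 <= dotz (v - dual_act g v) (w - dual_act g w)].

Definition Pplusplus (G : group_name) : set weight :=
  [set v | Pplus G v /\ forall g, Gamma G g -> g <> 1%:M -> dual_act g v <> v].

Definition varrho (G : group_name) : weight :=
  match G with
  | Z2_3 => (1, 0)
  | _ => xget 0 [set v | Pplusplus G v /\
                         forall w, Pplusplus G w -> dotz v v <= dotz w w]
  end.

Definition rho1 (G : group_name) : weight := (1, 0).

Definition rho2 (G : group_name) : weight :=
  match G with
  | Z2_2 | D4_1 | D6_2 => (0, 1)
  | Z2_3 | D4_2 | D6_1 | D8 | D12 => (1, 1)
  end.

Section Defs.
Variable R : realType.

(* R^2, with the Borel sigma-algebra. *)
Definition plane : measurableType _ :=
  (measurableTypeR R * measurableTypeR R)%type.

(* C^2, a complex number being the pair of its real and imaginary parts; the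
   product sigma-algebra is the Borel one. *)
Definition C2 : measurableType _ := (plane * plane)%type.

Definition xcoord (z : C2) : R[i] := (z.1.1 : R) +i* (z.1.2 : R).
Definition ycoord (z : C2) : R[i] := (z.2.1 : R) +i* (z.2.2 : R).

Definition normc (z : R[i]) : R := ComplexField.Normc.normc z.

(** * Characters *)

Definition act (g : 'M[int]_2) (t : plane) : plane :=
  ((g 0 0)%:~R * (t.1 : R) + (g 0 1)%:~R * (t.2 : R),
   (g 1 0)%:~R * (t.1 : R) + (g 1 1)%:~R * (t.2 : R)).

(* exp (2 pi i t) *)
Definition expi (t : R) : R[i] := cos (2 * pi * t) +i* sin (2 * pi * t).

(* sigma_v (omega1, omega2), with omega_j = exp (2 pi i theta_j) *)
Definition sigma (v : weight) (t : plane) : R[i] :=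
  expi (v.1%:~R * (t.1 : R) + v.2%:~R * (t.2 : R)).

Definition Ssum (G : group_name) (v : weight) (t : plane) : R[i] :=
  \sum_(g \in Gamma G) (\det g)%:~R * sigma v (act g t).

(* The value at exp (2 pi i theta) of the Laurent polynomial with coefficients
   [p]; only used for [p] of finite support. *)
Definition laurent (p : weight -> nat) (t : plane) : R[i] :=
  \sum_(v \in [set: weight]) (p v)%:R * sigma v t.

(* The identity S_(v + varrho) / S_varrho = sum_w p_w sigma_w, multiplied out
   because S_varrho has zeros; it determines [p], since S_varrho is a nonzero
   Laurent polynomial. *)
Definition is_chi (G : group_name) (v : weight) (p : weight -> nat) : Prop :=
  finite_set [set w | p w != 0%N] /\
  forall t : plane,
    Ssum G (varrho G) t * laurent p t = Ssum G (v + varrho G) t.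

Definition chi_coef (G : group_name) (v : weight) : weight -> nat :=
  xget (fun=> 0%N) (is_chi G v).

Definition chi (G : group_name) (v : weight) (t : plane) : R[i] :=
  laurent (chi_coef G v) t.

(* [Psi] is a function on R^2, periodic with respect to Z^2, so that its range
   is Psi (T^2). *)
Definition Psi (G : group_name) (t : plane) : C2 :=
  let x := chi G (rho1 G) t in let y := chi G (rho2 G) t in
  ((complex.Re x, complex.Im x), (complex.Re y, complex.Im y)).

(** * The Hilbert space l^2(Z^2) and its operators *)

Definition vec := weight -> R[i].

(* Operators are total functions on [vec], but only their restriction to l^2
   matters. *)
Definition op := vec -> vec.

Definition sqnorm (f : vec) : \bar R :=
  \esum_(v in [set: weight]) (normc (f v) ^+ 2)%:E.

Definition is_l2 (f : vec) : Prop := (sqnorm f < +oo)%E.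

(* Absolutely convergent sums over Z^2. *)
Definition rsum (u : weight -> R) : R :=
  fine (\esum_(v in [set: weight]) (u^\+ v)%:E) -
  fine (\esum_(v in [set: weight]) (u^\- v)%:E).

Definition csum (f : vec) : R[i] :=
  rsum (fun v => complex.Re (f v)) +i* rsum (fun v => complex.Im (f v)).

Definition inner (f g : vec) : R[i] := csum (fun v => f v * (g v)^*).

Definition basis (v : weight) : vec := fun w => (w == v)%:R.

(* (T^* g)(v) = <T^* g, e_v> = <g, T e_v>. *)
Definition adjoint (T : op) : op := fun g v => inner g (T (basis v)).

Definition op_norm_le (T : op) (K : R) : Prop :=
  forall f, is_l2 f -> (sqnorm (T f) <= (K ^+ 2)%:E * sqnorm f)%E.

(* The unital C*-algebra generated by [A] and [B]: the norm closure of the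
   algebra generated by A, A^*, B, B^*. *)
Inductive Cstar (A B : op) : set op :=
| Cstar_A : Cstar A B A
| Cstar_A' : Cstar A B (adjoint A)
| Cstar_B : Cstar A B B
| Cstar_B' : Cstar A B (adjoint B)
| Cstar_one : Cstar A B id
| Cstar_lin (c : R[i]) T U : Cstar A B T -> Cstar A B U ->
    Cstar A B (fun f v => c * T f v + U f v)
| Cstar_mul T U : Cstar A B T -> Cstar A B U -> Cstar A B (T \o U)
| Cstar_lim (T_ : nat -> op) T : (forall n, Cstar A B (T_ n)) ->
    (forall e : R, 0 < e -> exists N : nat, forall n, (N <= n)%N ->
       op_norm_le (fun f v => T_ n f v - T f v) e) ->
    Cstar A B T.

(* Continuous unital algebra homomorphisms to the complex numbers. *)
Definition is_gelfand_character (alg : set op) (psi : op -> R[i]) : Prop :=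
  [/\ psi id = 1,
      forall (c : R[i]) T U, alg T -> alg U ->
        psi (fun f v => c * T f v + U f v) = c * psi T + psi U,
      forall T U, alg T -> alg U -> psi (T \o U) = psi T * psi U &
      exists M : R, forall T K, alg T -> 0 <= K -> op_norm_le T K ->
        normc (psi T) <= M * K].

(* Joint spectrum of a commuting pair of normal operators, through the Gelfand
   spectrum of the C*-algebra that they generate. *)
Definition joint_spectrum (A B : op) : set C2 :=
  [set z | exists psi : op -> R[i],
     [/\ is_gelfand_character (Cstar A B) psi,
         psi A = xcoord z & psi B = ycoord z]].

(** * Graphs and joint spectral measure *)

(* Number of edges from [m] to [n]: the coefficient of sigma_n in the product
   of chi_v and sigma_m. *)
Definition edges (G : group_name) (v m n : weight) : nat :=
  chi_coef G v (n - m).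

(* The sum of p_w s^w1 (x) s^w2, where s is the shift e_k |-> e_(k+1): it sends
   e_m to the sum of the [edges G v m n] e_n. *)
Definition adjacency (G : group_name) (v : weight) : op :=
  fun f n => \sum_(m \in [set: weight]) (edges G v m n)%:R * f m.

(* phi (A^m1 (A^* )^n1 B^m2 (B^* )^n2) *)
Definition moment (A B : op) (m1 n1 m2 n2 : nat) : R[i] :=
  inner (iter m1 A (iter n1 (adjoint A)
          (iter m2 B (iter n2 (adjoint B) (basis 0))))) (basis 0).

Definition cintegral (nu : probability C2 R) (D : set C2) (f : C2 -> R[i]) :
    R[i] :=
  Rintegral nu D (fun z => complex.Re (f z)) +i*
  Rintegral nu D (fun z => complex.Im (f z)).

Definition is_joint_spectral_measure (A B : op) (nu : probability C2 R) : Prop :=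
  nu.-negligible (~` joint_spectrum A B) /\
  forall m1 n1 m2 n2 : nat,
    moment A B m1 n1 m2 n2 =
    cintegral nu (joint_spectrum A B)
      (fun z => xcoord z ^+ m1 * (xcoord z)^* ^+ n1 *
                ycoord z ^+ m2 * (ycoord z)^* ^+ n2).

(** * Jacobian and area element *)

Definition cderive (f : R -> R[i]) (s : R) : R[i] :=
  derive1 (fun r => complex.Re (f r)) s +i*
  derive1 (fun r => complex.Im (f r)) s.

Definition partial1 (f : plane -> R[i]) (t : plane) : R[i] :=
  cderive (fun s => f (s, t.2)) t.1.
Definition partial2 (f : plane -> R[i]) (t : plane) : R[i] :=
  cderive (fun s => f (t.1, s)) t.2.

Definition jacobian (G : group_name) (t : plane) : R[i] :=
  let x := chi G (rho1 G) in let y := chi G (rho2 G) in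
  partial1 x t * partial2 y t - partial2 x t * partial1 y t.

Definition leb2 : set plane -> \bar R :=
  (@lebesgue_measure R \x @lebesgue_measure R)%E.
HB.instance Definition _ := Measure.on leb2.

Definition affine_act (g : 'M[int]_2) (n : weight) (t : plane) : plane :=
  (((act g t).1 : R) + n.1%:~R, ((act g t).2 : R) + n.2%:~R).

(* A fundamental domain of T^2 / Gamma is one of R^2 modulo Z^2 and Gamma, up to
   null sets. *)
Definition is_fundamental_domain (G : group_name) (C : set plane) : Prop :=
  [/\ measurable C,
      leb2.-negligible (~` [set t | exists g n, Gamma G g /\ C (affine_act g n t)]) &
      forall g n, Gamma G g -> (g, n) <> (1%:M, 0) ->
        leb2.-negligible (C `&` [set t | C (affine_act g n t)])].

(* The integral of [f] over Psi (T^2) against the modulus of the 2-form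
   dx /\ dy, computed in the parametrisation of the surface by [C]. *)
Definition area_integral (G : group_name) (C : set plane) (f : C2 -> R) :
    \bar R :=
  (\int[leb2]_(t in C) (f (Psi G t) * normc (jacobian G t))%:E)%E.

End Defs.

Arguments leb2 R : clear implicits.

(* Main.v *)
(* Write x = chi_rho1 and y = chi_rho2.  The Fourier transform turns the
   adjacency operators into the multiplications by x and y on the torus, so the
   image under Psi = (x, y) of the Haar measure has the right moments; by the
   Stone-Weierstrass theorem it is the only measure that does.  The spectrum is
   the range of Psi: truncations of the characters of Z^2 to large boxes are
   approximate eigenvectors, whence "contains"; conversely, if (x0, y0) is not
   in the range, then D = |x - x0|^2 + |y - y0|^2 is bounded below, a Gelfand
   character with values x0, y0 would send 1 - D / K to 1, and the powers of
   1 - D / K tend to 0 in norm.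
   For the density, Psi is invariant under Gamma and Z^2, so that the Haar
   measure of Psi^-1 B is |Gamma| times the area of its part in a fundamental
   domain.  The Jacobian vanishes only on a null set, being essentially a product
   of factors 1 - sigma_v, and its modulus is a function of Psi because its
   square is a polynomial in x, y and their conjugates. *)

Require Import Defs.
From HB Require Import structures.
From mathcomp Require Import measurable_realfun.
From mathcomp Require Import ring lra zify.

Set Implicit Arguments.
Unset Strict Implicit.
Unset Printing Implicit Defensive.

Import Order.TTheory GRing.Theory Num.Theory.
Import numFieldNormedType.Exports.
Local Open Scope classical_set_scope.
Local Open Scope ring_scope.
Local Open Scope complex_scope.

(** * Laurent polynomials on the torus and convolution operators *)

(** Everything that depends on the group is finite: its elements, the distinguished weights, and
    identities between Laurent polynomials with integer coefficients, which [vm_compute] settles in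
    all eight cases. The analysis is done for arbitrary trigonometric polynomials. The link between
    the two is not automatic: [chi_coef] is only characterised through a division by S_varrho, which
    has zeros; these form a null set, and Fourier coefficients do not see it. Elements of the
    C*-algebra are bare functions reached by norm limits, so that evaluation at a point of the torus
    cannot be read off a symbol. It is defined as the limiting eigenvalue along large boxes, which
    survives sums, products and norm limits. Squared norms in the extended reals replace norms, at
    the price of factors 2. For determinacy, explicit polynomials stay bounded on the spectrum and
    converge pointwise to indicators of orthants; dominated convergence and uniqueness on an
    intersection-stable generating family finish. This needs the spectrum to be a Borel set, which
    is seen by testing the distance to it at rational parameters only. *)

Section Characters.
Variable R : realType.
Implicit Types (t : plane R) (v w : weight) (z : R[i]).

Lemma sqr_normc z : (normc z ^+ 2)%:C = z * z^*.
Proof.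
case: z => a b; rewrite /normc /ComplexField.Normc.normc sqr_sqrtr ?addr_ge0 ?sqr_ge0 //.
by simpc; congr (_ +i* _); ring.
Qed.

Lemma sqr_normcE z : normc z ^+ 2 = complex.Re z ^+ 2 + complex.Im z ^+ 2.
Proof. by case: z => a b; rewrite /normc /= sqr_sqrtr ?addr_ge0 ?sqr_ge0. Qed.

Lemma normc_ge0 z : 0 <= normc z.
Proof. by case: z => a b; apply: sqrtr_ge0. Qed.

Lemma normcM z (w : R[i]) : normc (z * w) = normc z * normc w.
Proof. exact: ComplexField.Normc.normcM. Qed.

Lemma normcC z : normc z^* = normc z.
Proof. by case: z => a b; rewrite /normc /= sqrrN. Qed.

Lemma normcD z (w : R[i]) : normc (z + w) <= normc z + normc w.
Proof. by rewrite -lecR rmorphD /=; exact: (ler_normD z w). Qed.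

Lemma normc_sum I (s : seq I) (f : I -> R[i]) :
  normc (\sum_(i <- s) f i) <= \sum_(i <- s) normc (f i).
Proof.
elim: s => [|i s IH]; first by rewrite !big_nil /normc ComplexField.Normc.normc0.
rewrite !big_cons (le_trans (normcD _ _)) //.
by rewrite lerD2l.
Qed.

Lemma expiD (a b : R) : expi (a + b) = expi a * expi b.
Proof.
rewrite /expi mulrDr cosD sinD; simpc.
by congr (_ +i* _); rewrite // addrC (mulrC (sin _)).
Qed.

Lemma expi0 : expi (0 : R) = 1.
Proof. by rewrite /expi mulr0 cos0 sin0. Qed.

Lemma expiN (a : R) : expi (- a) = (expi a)^*.
Proof. by rewrite /expi mulrN cosN sinN. Qed.

Lemma normc_expi (a : R) : normc (expi a) = 1.
Proof. by rewrite /normc /= cos2Dsin2 sqrtr1. Qed.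

Lemma expi_int (k : int) : expi (k%:~R : R) = 1.
Proof.
have expi_nat (n : nat) : expi (n%:R : R) = 1.
  elim: n => [|n IH]; first exact: expi0.
  by rewrite mulrSr expiD IH mul1r /expi mulr1 mulr_natl cos2pi sin2pi.
case: k => n; first by rewrite -pmulrn expi_nat.
by rewrite NegzE mulrNz expiN -pmulrn expi_nat conjc1.
Qed.

Lemma sigmaD v w t : sigma (v + w) t = sigma v t * sigma w t.
Proof. by rewrite /sigma -expiD; congr expi; rewrite /= !intrD; ring. Qed.

Lemma sigma0 t : sigma 0 t = 1.
Proof. by rewrite /sigma /= !mul0r addr0 expi0. Qed.

Lemma sigmaN v t : sigma (- v) t = (sigma v t)^*.
Proof. by rewrite /sigma -expiN /= !mulrNz; congr expi; ring. Qed.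

Lemma normc_sigma v t : normc (sigma v t) = 1.
Proof. exact: normc_expi. Qed.

Lemma sigma_act v g t : sigma v (act g t) = sigma (dual_act g v) t.
Proof. by rewrite /sigma; congr expi; rewrite /= !intrD !intrM; ring. Qed.

Lemma sigma_affine v g n t :
  sigma v (affine_act g n t) = sigma (dual_act g v) t.
Proof.
rewrite -sigma_act /sigma /= !mulrDr addrACA expiD.
by rewrite -!intrM -intrD expi_int mulr1.
Qed.

(** A list of coefficients and exponents, repetitions allowed, is the symbol both of a function on
    the torus ([trig]) and of an operator on Z^2 ([convol]). The operations below respect both
    readings; [tconj] is the conjugate on one side and the adjoint on the other. *)
Definition trig (s : seq (R[i] * weight)) t : R[i] :=
  \sum_(e <- s) e.1 * sigma e.2 t.

Definition convol (s : seq (R[i] * weight)) (f : vec R) : vec R :=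
  fun n => \sum_(e <- s) e.1 * f (n - e.2).

Definition tmul (s r : seq (R[i] * weight)) : seq (R[i] * weight) :=
  [seq (e.1 * d.1, e.2 + d.2) | e <- s, d <- r].

Definition tconj (s : seq (R[i] * weight)) : seq (R[i] * weight) :=
  [seq (e.1^*, - e.2) | e <- s].

Definition tscale (c : R[i]) (s : seq (R[i] * weight)) : seq (R[i] * weight) :=
  [seq (c * e.1, e.2) | e <- s].

Definition tone : seq (R[i] * weight) := [:: (1, 0)].

Lemma trig_cat s r t : trig (s ++ r) t = trig s t + trig r t.
Proof. exact: big_cat. Qed.

Lemma trig_mul s r t : trig (tmul s r) t = trig s t * trig r t.
Proof.
rewrite /trig big_allpairs_dep mulr_suml; apply: eq_bigr => e _.
by rewrite mulr_sumr; apply: eq_bigr => d _; rewrite sigmaD /=; ring.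
Qed.

Lemma trig_conj s t : trig (tconj s) t = (trig s t)^*.
Proof.
rewrite /trig big_map rmorph_sum; apply: eq_bigr => e _.
by rewrite rmorphM /= sigmaN.
Qed.

Lemma trig_scale c s t : trig (tscale c s) t = c * trig s t.
Proof.
by rewrite /trig big_map mulr_sumr; apply: eq_bigr => e _; rewrite mulrA.
Qed.

Lemma trig_one t : trig tone t = 1.
Proof. by rewrite /trig big_seq1 sigma0 mulr1. Qed.

Lemma convol_cat s r f n : convol (s ++ r) f n = convol s f n + convol r f n.
Proof. exact: big_cat. Qed.

Lemma convol_mul s r f : convol (tmul s r) f = convol s (convol r f).
Proof.
apply/funext => n; rewrite /convol big_allpairs_dep; apply: eq_bigr => e _.
rewrite mulr_sumr; apply: eq_bigr => d _ /=.
by rewrite mulrA opprD addrA.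
Qed.

Lemma convol_scale c s f n : convol (tscale c s) f n = c * convol s f n.
Proof.
by rewrite /convol big_map mulr_sumr; apply: eq_bigr => e _; rewrite mulrA.
Qed.

Lemma convol_one f : convol tone f = f.
Proof. by apply/funext => n; rewrite /convol big_seq1 mul1r subr0. Qed.

Lemma convol_lin s c f g n :
  convol s (fun v => c * f v + g v) n = c * convol s f n + convol s g n.
Proof.
rewrite /convol mulr_sumr -big_split; apply: eq_bigr => e _ /=; ring.
Qed.

Lemma trig_affine s g n t :
  trig s (affine_act g n t) = \sum_(e <- s) e.1 * sigma (dual_act g e.2) t.
Proof. by apply: eq_bigr => e _; rewrite sigma_affine. Qed.

Lemma trig_periodic s n t : trig s (affine_act 1%:M n t) = trig s t.
Proof.
rewrite trig_affine; apply: eq_bigr => -[c [a b]] _; congr (_ * sigma _ _).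
by rewrite /dual_act !mxE /= mul1r mul0r addr0 mul0r mul1r add0r.
Qed.

End Characters.

(** * Formal Laurent polynomials *)

(** Complex coefficients do not compute. The identities that depend on the group are therefore
    stated over the integers, tested there by [fzero], and transported to the torus by [feval]. *)
Definition flaurent : Type := seq (int * weight).

Fixpoint fins (e : int * weight) (s : flaurent) : flaurent :=
  if s is d :: s' then
    if e.2 == d.2 then (e.1 + d.1, d.2) :: s' else d :: fins e s'
  else [:: e].

Definition fnorm (s : flaurent) : flaurent := foldr fins [::] s.
Definition fadd (s r : flaurent) : flaurent := fnorm (s ++ r).
Definition fmul (s r : flaurent) : flaurent :=
  fnorm [seq (e.1 * d.1, e.2 + d.2) | e <- s, d <- r].
Definition fscale (c : int) (s : flaurent) : flaurent :=
  [seq (c * e.1, e.2) | e <- s].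
Definition fconj (s : flaurent) : flaurent := [seq (e.1, - e.2) | e <- s].
Definition fsub (s r : flaurent) : flaurent := fadd s (fscale (-1) r).
Definition fzero (s : flaurent) : bool := all (fun e => e.1 == 0) (fnorm s).
Definition fone : flaurent := [:: (1, 0)].
Definition fsum (l : seq weight) : flaurent := [seq (1, v) | v <- l].
Definition fprod1 (l : seq weight) : flaurent :=
  foldr (fun v s => fmul [:: (1, 0); (-1, v)] s) fone l.

(** Reified polynomials in x, y and their conjugates. The same expression is expanded into a formal
    Laurent polynomial, where an identity can be checked, and evaluated at two complex numbers,
    which shows that the value depends on x and y only. *)
Inductive pexp :=
  | PX | PY | PXc | PYc | PC of int | PA of pexp & pexp | PM of pexp & pexp.

Fixpoint pformal (X Y : flaurent) (p : pexp) : flaurent :=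
  match p with
  | PX => X | PY => Y | PXc => fconj X | PYc => fconj Y
  | PC c => [:: (c, 0)]
  | PA p q => fadd (pformal X Y p) (pformal X Y q)
  | PM p q => fmul (pformal X Y p) (pformal X Y q)
  end.

Section Evaluation.
Variable R : realType.
Implicit Types (s r : flaurent) (t : plane R).

Fixpoint peval (x y : R[i]) (p : pexp) : R[i] :=
  match p with
  | PX => x | PY => y | PXc => x^* | PYc => y^*
  | PC c => c%:~R
  | PA p q => peval x y p + peval x y q
  | PM p q => peval x y p * peval x y q
  end.

Definition feval s t : R[i] := \sum_(e <- s) e.1%:~R * sigma e.2 t.

Lemma feval_cat s r t : feval (s ++ r) t = feval s t + feval r t.
Proof. exact: big_cat. Qed.

Lemma feval_ins e s t : feval (fins e s) t = e.1%:~R * sigma e.2 t + feval s t.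
Proof.
elim: s => [|d s IH] /=; first by rewrite /feval big_seq1 big_nil addr0.
case: eqP => [->|_]; rewrite /feval !big_cons /=.
  by rewrite intrD mulrDl addrA.
by rewrite -/(feval (fins e s) t) IH addrCA.
Qed.

Lemma feval_norm s t : feval (fnorm s) t = feval s t.
Proof.
elim: s => [|e s IH] //=; by rewrite feval_ins IH /feval big_cons.
Qed.

Lemma feval_add s r t : feval (fadd s r) t = feval s t + feval r t.
Proof. by rewrite feval_norm feval_cat. Qed.

Lemma feval_mul s r t : feval (fmul s r) t = feval s t * feval r t.
Proof.
rewrite feval_norm /feval big_allpairs_dep mulr_suml; apply: eq_bigr => e _.
by rewrite mulr_sumr; apply: eq_bigr => d _; rewrite sigmaD intrM /=; ring.
Qed.

Lemma feval_scale c s t : feval (fscale c s) t = c%:~R * feval s t.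
Proof.
rewrite /feval big_map mulr_sumr; apply: eq_bigr => e _.
by rewrite intrM mulrA.
Qed.

Lemma feval_sub s r t : feval (fsub s r) t = feval s t - feval r t.
Proof. by rewrite feval_add feval_scale mulN1r. Qed.

Lemma conjc_int (c : int) : ((c%:~R : R[i])^*) = c%:~R.
Proof. exact: (rmorph_int (@conjc R)). Qed.

Lemma feval_conj s t : feval (fconj s) t = (feval s t)^*.
Proof.
rewrite /feval big_map rmorph_sum; apply: eq_bigr => e _.
by rewrite rmorphM /= sigmaN conjc_int.
Qed.

Lemma feval_one t : feval fone t = 1.
Proof. by rewrite /feval big_seq1 sigma0 mulr1. Qed.

Lemma feval_mon c v t : feval [:: (c, v)] t = c%:~R * sigma v t.
Proof. by rewrite /feval big_seq1. Qed.

Lemma feval_sum l t : feval (fsum l) t = \sum_(v <- l) sigma v t.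
Proof. by rewrite /feval big_map; apply: eq_bigr => v _; rewrite mul1r. Qed.

Lemma feval_prod1 l t : feval (fprod1 l) t = \prod_(v <- l) (1 - sigma v t).
Proof.
elim: l => [|v l IH]; first by rewrite big_nil feval_one.
rewrite big_cons /= feval_mul IH /feval !big_cons big_nil /= sigma0.
by rewrite mulN1r mulr1 addr0.
Qed.

Lemma fzeroP s t : fzero s -> feval s t = 0.
Proof.
move=> /allP s0; rewrite -feval_norm /feval big_seq.
by apply: big1 => e /s0/eqP ->; rewrite mul0r.
Qed.

Lemma feval_pformal X Y p t :
  feval (pformal X Y p) t = peval (feval X t) (feval Y t) p.
Proof.
elim: p => [||||c|p IHp q IHq|p IHp q IHq] //=; rewrite ?feval_conj //.
- by rewrite feval_mon sigma0 mulr1.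
- by rewrite feval_add IHp IHq.
- by rewrite feval_mul IHp IHq.
Qed.

End Evaluation.

(** * Enumeration of the groups *)

(* (a, b, c, d) stands for [mx2 a b c d]. *)
Definition mx2t : Type := (int * int * int * int)%type.
Definition mx_of (x : mx2t) : 'M[int]_2 := mx2 x.1.1.1 x.1.1.2 x.1.2 x.2.
Definition tmulmx (x y : mx2t) : mx2t :=
  let: (a, b, c, d) := x in let: (a', b', c', d') := y in
  (a * a' + b * c', a * b' + b * d', c * a' + d * c', c * b' + d * d').
Definition tid : mx2t := (1, 0, 0, 1).
Definition tdet (x : mx2t) : int := let: (a, b, c, d) := x in a * d - b * c.
Definition tdual (x : mx2t) (v : weight) : weight :=
  let: (a, b, c, d) := x in (a * v.1 + c * v.2, b * v.1 + d * v.2).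

Definition gens (G : group_name) : seq mx2t :=
  match G with
  | Z2_2 => [:: (1, 0, 0, -1)]
  | Z2_3 => [:: (0, 1, 1, 0)]
  | D4_1 => [:: (-1, 0, 0, -1); (1, 0, 0, -1)]
  | D4_2 => [:: (-1, 0, 0, -1); (0, 1, 1, 0)]
  | D6_1 => [:: (0, -1, 1, -1); (0, 1, 1, 0)]
  | D6_2 => [:: (0, -1, 1, -1); (0, -1, -1, 0)]
  | D8   => [:: (0, -1, 1, 0); (0, 1, 1, 0)]
  | D12  => [:: (0, 1, -1, 1); (0, 1, 1, 0)]
  end.

(** Words of length at most 7 in the generators, without inverses, exhaust each of the eight groups;
    the bound is generous, and that the list is closed is checked in [GammaE]. *)
Definition glist (G : group_name) : seq mx2t :=
  iter 7 (fun l => undup (l ++ [seq tmulmx x y | x <- l, y <- gens G])) [:: tid].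

Arguments glist G : simpl never.

Lemma mx_of_inj : injective mx_of.
Proof.
move=> [[[a b] c] d] [[[a' b'] c'] d'] /matrixP e.
have := (e 0 0, e 0 1, e 1 0, e 1 1); rewrite !mxE /=.
by move=> [[[-> ->] ->] ->].
Qed.

Lemma mx_ofM x y : mx_of (tmulmx x y) = mx_of x *m mx_of y.
Proof.
case: x y => [[[a b] c] d] [[[a' b'] c'] d'].
apply/matrixP => i j; rewrite !mxE !big_ord_recl big_ord0 addr0 !mxE /=.
by case: i j => [[|[|//]] ?] [[|[|//]] ?].
Qed.

Lemma mx_of1 : mx_of tid = 1%:M.
Proof.
apply/matrixP => i j; rewrite !mxE.
by case: i j => [[|[|//]] ?] [[|[|//]] ?].
Qed.

Lemma det_mx_of x : \det (mx_of x) = tdet x.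
Proof.
case: x => [[[a b] c] d].
rewrite (expand_det_row _ ord0) !big_ord_recl big_ord0 /cofactor !det_mx11 !mxE /=.
by rewrite addr0 expr0 expr1 !mul1r mulN1r mulrN.
Qed.

Lemma dual_act_mx_of x v : dual_act (mx_of x) v = tdual x v.
Proof. by case: x => [[[a b] c] d]; rewrite /dual_act !mxE. Qed.

Lemma gensE G : generators G = [set g | exists2 x, x \in gens G & g = mx_of x].
Proof.
have n1 : - 1%:M = mx_of (-1, 0, 0, -1).
  apply/matrixP => i j; rewrite !mxE.
  by case: i j => [[|[|//]] ?] [[|[|//]] ?].
have nT2' : - T2' = mx_of (0, -1, -1, 0).
  apply/matrixP => i j; rewrite !mxE.
  by case: i j => [[|[|//]] ?] [[|[|//]] ?].
apply/seteqP; split => g; case: G => /=; rewrite ?n1 ?nT2'.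
1,2: by move=> ->; eexists; [exact: mem_head|].
1-6: move=> [] ->; match goal with |- exists2 x, is_true (x \in ?a :: ?b :: _) & _ =>
  first [by exists a; rewrite ?inE ?eqxx | by exists b; rewrite ?inE ?eqxx ?orbT] end.
1,2: by move=> [x]; rewrite !inE => /eqP -> ->.
all: by move=> [x]; rewrite !inE => /orP[] /eqP -> ->; [left|right].
Qed.

Lemma glist_uniq G : uniq (glist G). Proof. by case: G; vm_compute. Qed.

Lemma tid_glist G : tid \in glist G. Proof. by case: G; vm_compute. Qed.

(** Closure of the list under products and the presence of inverses are finite checks, which give
    one inclusion by induction on [generated]. For the other, each round of [glist] only appends
    products with generators. *)
Lemma GammaE G : Gamma G = [set g | exists2 x, x \in glist G & g = mx_of x].
Proof.
have cl : let l := glist G in all (fun x => all (fun y => tmulmx x y \in l) l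
    && has (fun y => tmulmx x y == tid) l) l.
  by case: (G); vm_compute.
have genl : all (fun x => x \in glist G) (gens G) by case: (G); vm_compute.
apply/seteqP; split => g /=.
- elim => {g} [g|||].
  + by rewrite gensE => -[x xG ->]; exists x => //; apply: (allP genl).
  + by by exists tid; [exact: tid_glist|rewrite mx_of1].
  + move=> _ _ _ [x xG ->] _ [y yG ->]; exists (tmulmx x y); last by rewrite mx_ofM.
    by have /andP[/allP mG _] := allP cl _ xG; exact: mG.
  + move=> _ _ [x xG ->].
    have /andP[_ /hasP[y yG /eqP xy]] := allP cl _ xG.
    exists y => //.
    have xy1 : mx_of x *m mx_of y = 1%:M by rewrite -mx_ofM xy mx_of1.
    have [xu _] := mulmx1_unit xy1.
    by rewrite -[LHS]mulmx1 -xy1 mulKmx.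
- case=> x + ->; rewrite /glist; elim: (X in iter X) x => [|k IH] x.
    by rewrite inE => /eqP ->; rewrite mx_of1; exact: generated_one.
  rewrite iterS mem_undup mem_cat => /orP[/IH //|].
  move=> /allpairsP[[y z] [yG zG ->]] /=; rewrite mx_ofM.
  apply: generated_mul; first exact: IH.
  by apply: generated_base; rewrite gensE; exists z.
Qed.

Lemma mem_Gamma G x : x \in glist G -> Gamma G (mx_of x).
Proof. by move=> xG; rewrite GammaE; exists x. Qed.

Lemma Gamma_mxof G : Gamma G = [set` map mx_of (glist G)].
Proof.
rewrite GammaE; move: (glist G) => l; apply/seteqP; split => g /=.
  by case=> x xG ->; apply: map_f.
by move=> /mapP[x xG ->]; exists x.
Qed.

Lemma orderE G : order G = size (glist G).
Proof.
rewrite /order Gamma_mxof.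
have := glist_uniq G; move: (glist G) => l lu.
have -> : [set` map mx_of l] = [set` [fset x in map mx_of l]%fset].
  by apply/seteqP; split => g /=; rewrite inE.
rewrite set_fsetK card_fseq undup_id ?size_map //.
by rewrite map_inj_uniq //; exact: mx_of_inj.
Qed.

(** * The distinguished weights *)

Definition reflection_pairing (x : mx2t) (v w : weight) : int :=
  dotz (v - tdual x v) (w - tdual x w).

(* The pairing is linear in w, and (1, 0), (1, 1) span the cone
   0 <= w2 <= w1. *)
Definition in_Pplus (G : group_name) (v : weight) : bool :=
  all (fun x => (tdet x == -1) ==>
    ((0 <= reflection_pairing x v (1, 0)) && (0 <= reflection_pairing x v (1, 1))))
    (glist G).

Definition in_Pplusplus (G : group_name) (v : weight) : bool :=
  in_Pplus G v && all (fun x => (x != tid) ==> (tdual x v != v)) (glist G).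

Lemma in_PplusP G v : Pplus G v <-> in_Pplus G v.
Proof.
split.
- move=> Gv; apply/allP => x xG; apply/implyP => /eqP dx; apply/andP.
  rewrite /reflection_pairing -!dual_act_mx_of.
  by split; apply: Gv; rewrite ?det_mx_of //; exact: mem_Gamma.
- move=> /allP Gv g; rewrite GammaE => -[x xG ->]; rewrite det_mx_of => dx w w2 w12.
  have := Gv _ xG; rewrite dx eqxx /= => /andP[p10 p11].
  rewrite !dual_act_mx_of -/(reflection_pairing x v w).
  have -> : reflection_pairing x v w = (w.1 - w.2) * reflection_pairing x v (1, 0)
      + w.2 * reflection_pairing x v (1, 1).
    case: x w {xG dx p10 p11 w2 w12} => [[[a b] c] d] [w1 w2].
    by rewrite /reflection_pairing /dotz /=; ring.
  by rewrite addr_ge0 // mulr_ge0 // subr_ge0.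
Qed.

Lemma in_PplusplusP G v : Pplusplus G v <-> in_Pplusplus G v.
Proof.
split.
- move=> [/in_PplusP vP vfix]; apply/andP; split => //.
  apply/allP => x xG; apply/implyP => /eqP x1; apply/eqP.
  rewrite -dual_act_mx_of; apply: vfix; first exact: mem_Gamma.
  by rewrite -mx_of1 => /mx_of_inj.
- move=> /andP[/in_PplusP vP /allP vfix]; split => // g.
  rewrite GammaE => -[x xG ->]; rewrite -mx_of1 dual_act_mx_of => x1.
  have := vfix _ xG; case: eqP x1 => [->|_ _ /eqP] //.
Qed.

Definition rho_vec (G : group_name) : weight :=
  match G with
  | Z2_2 => (0, 1) | Z2_3 | D4_2 | D6_1 => (1, 0)
  | D4_1 | D6_2 => (1, 1) | D8 | D12 => (2, 1)
  end.

(** The minimisation runs over an infinite set, but the candidate has squared norm at most 5, so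
    every competitor has its coordinates between -2 and 2 and a finite search shows that the
    minimiser is unique. For [Z2_3] it is not: (1, 0) and (0, -1) tie, whence the separate
    convention. *)
Lemma varrhoE G : varrho G = rho_vec G.
Proof.
pose vals : seq int := [:: -2; -1; 0; 1; 2].
have small (w : weight) : dotz w w <= 5 -> (w.1 \in vals) /\ (w.2 \in vals).
  case: w => a b; rewrite /dotz /= => ab5.
  have in_vals (c : int) : c * c <= 5 -> c \in vals.
    move=> c5; have : -2 <= c <= 2 by nia.
    by rewrite /vals !inE; lia.
  by split; apply: in_vals; nia.
have key : G <> Z2_3 -> xget 0 [set v | Pplusplus G v /\
    forall w, Pplusplus G w -> dotz v v <= dotz w w] = rho_vec G.
  move=> G23.
  have rho_in : Pplusplus G (rho_vec G).
    by apply/in_PplusplusP; case: (G); vm_compute.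
  have rho5 : dotz (rho_vec G) (rho_vec G) <= 5 by case: (G); vm_compute.
  have rho_min w : in_Pplusplus G w -> dotz w w <= dotz (rho_vec G) (rho_vec G) ->
      w = rho_vec G.
    move=> wP wr; apply/eqP.
    have : all (fun a => all (fun b => in_Pplusplus G (a, b) ==>
      (dotz (a, b) (a, b) <= dotz (rho_vec G) (rho_vec G)) ==>
      ((a, b) == rho_vec G)) vals) vals.
      by case: (G) G23; vm_compute.
    have [w1 w2] := small w (le_trans wr rho5).
    by move=> /allP /(_ _ w1) /allP /(_ _ w2); rewrite -surjective_pairing wP wr.
  apply: xget_unique => [|w [/in_PplusplusP wP /(_ _ rho_in)]]; last exact: rho_min.
  split => // w /in_PplusplusP wP; rewrite leNgt; apply/negP => wr.
  by have := rho_min w wP (ltW wr) => we; rewrite we ltxx in wr.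
by case: G key => // key; apply: key.
Qed.

(** * Explicit characters and Jacobians *)

(** Repetition encodes multiplicity. The two lists hold the weights of familiar representations: of
    U(1) x SU(2), U(2) and SU(2) x SU(2) for [Z2_2], [Z2_3] and [D4_1]; for [D4_2], of the product
    of the two standard representations of SU(2) x SU(2) and of the adjoint one of a factor; of
    dimensions 8 and 10 of SU(3) for [D6_1], 3 and its dual for [D6_2], 4 and 5 of Sp(2) for [D8], 7
    and 14 of G2 for [D12]. *)
Definition chi1_weights (G : group_name) : seq weight :=
  match G with
  | Z2_2 => [:: (1, 0)]
  | Z2_3 => [:: (1, 0); (0, 1)]
  | D4_1 => [:: (1, 0); (-1, 0)]
  | D4_2 | D8 => [:: (1, 0); (0, 1); (0, -1); (-1, 0)]
  | D6_1 => [:: (1, 0); (1, -1); (0, 1); (0, 0); (0, 0); (0, -1); (-1, 1); (-1, 0)]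
  | D6_2 => [:: (1, 0); (0, -1); (-1, 1)]
  | D12 => [:: (1, 0); (1, -1); (0, 1); (0, 0); (0, -1); (-1, 1); (-1, 0)]
  end.

Definition chi2_weights (G : group_name) : seq weight :=
  match G with
  | Z2_2 | D4_1 => [:: (0, 1); (0, -1)]
  | Z2_3 => [:: (1, 1)]
  | D4_2 => [:: (1, 1); (0, 0); (-1, -1)]
  | D6_1 => [:: (1, 1); (1, 0); (1, -1); (1, -2); (0, 1); (0, 0); (0, -1);
                (-1, 1); (-1, 0); (-2, 1)]
  | D6_2 => [:: (1, -1); (0, 1); (-1, 0)]
  | D8 => [:: (1, 1); (1, -1); (0, 0); (-1, 1); (-1, -1)]
  | D12 => [:: (2, -1); (1, 1); (1, 0); (1, -1); (1, -2); (0, 1); (0, 0); (0, 0);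
               (0, -1); (-1, 2); (-1, 1); (-1, 0); (-1, -1); (-2, 1)]
  end.

Definition fSsum (G : group_name) (v : weight) : flaurent :=
  [seq (tdet x, tdual x v) | x <- glist G].

(* [fjac] is the Jacobian divided by (2 pi i)^2. *)
Definition fjac (l1 l2 : seq weight) : flaurent :=
  [seq (v.1 * w.2 - v.2 * w.1, v + w) | v <- l1, w <- l2].

(** A system of positive roots: [cert_S] is the Weyl denominator formula for it, with [Smono] as the
    signed monomial in front of the product of the factors 1 - sigma_v. *)
Definition roots (G : group_name) : seq weight :=
  match G with
  | Z2_2 => [:: (0, 2)]
  | Z2_3 => [:: (1, -1)]
  | D4_1 => [:: (0, 2); (2, 0)]
  | D4_2 => [:: (1, -1); (1, 1)]
  | D6_1 => [:: (0, 1); (1, -1); (1, 0)]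
  | D6_2 => [:: (1, -2); (1, 1); (2, -1)]
  | D8 => [:: (0, 2); (1, -1); (2, 0); (1, 1)]
  | D12 => [:: (0, 1); (1, -2); (1, -1); (1, 0); (1, 1); (2, -1)]
  end.

Definition Smono (G : group_name) : int * weight :=
  match G with
  | Z2_2 => (-1, (0, -1)) | Z2_3 => (-1, (0, 1)) | D4_1 => (1, (-1, -1))
  | D4_2 => (1, (-1, 0)) | D6_1 => (-1, (-1, 0)) | D6_2 => (1, (-2, 1))
  | D8 => (1, (-2, -1)) | D12 => (-1, (-3, 1))
  end.

(* The Jacobian is a monomial times the Weyl denominator, except for D4_2, where
   there is another factor (1 + s)^2 with s = sigma (1, 1), turned into
   (1 - s^2)^2 by [jac_mult], and for D6_1, where there is another factor
   (1 + u + w)^3 with u = sigma (0, -1) and w = sigma (-1, 0). *)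
Definition jac_mult (G : group_name) : flaurent :=
  match G with
  | D4_2 => [:: (1, (1, 1)); (-2, (2, 2)); (1, (3, 3))]
  | _ => fone
  end.

Definition jac_roots (G : group_name) : seq weight :=
  match G with D4_2 => [:: (2, 2); (2, 2)] | _ => [::] end ++ roots G.

Definition jac_mono (G : group_name) : int * weight :=
  match G with
  | Z2_2 => (-1, (1, -1)) | Z2_3 => (-1, (1, 2)) | D6_1 => (-1, (0, 1))
  | _ => Smono G
  end.

Definition jac_extra (G : group_name) : flaurent :=
  match G with D6_1 => fsum [:: (0, 0); (0, -1); (-1, 0)] | _ => fone end.

(* With F = 1 + u + w, (1 - u^2) F - (1 - u) u w F^* = 1 - u^3. *)
Definition extra_cofactor (G : group_name) : flaurent * flaurent :=
  match G with
  | D6_1 => ([:: (1, (0, 0)); (-1, (0, -2))], [:: (-1, (-1, -1)); (1, (-1, -2))])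
  | _ => ([:: (1, (0, 0)); (-1, (0, -3))], [::])
  end.

Section SquaredJacobian.
Local Notation "x [+] y" := (PA x y) (at level 50, left associativity).
Local Notation "x [*] y" := (PM x y) (at level 40, left associativity).
Local Notation "# c" := (PC c) (at level 1).

(** The squared modulus of the Jacobian divided by (2 pi)^4. For [D6_2] it is minus the discriminant
    of T^3 - x T^2 + y T - 1, whose roots are the three terms of x. For [D6_1] the cube comes from x
    + 1 = |1 + u + w|^2, and the last factor is the same discriminant for a character z of SU(3)
    with |z|^2 = x + 1 and z^3 = y + 2 x + 1. *)
Definition jac_sq (G : group_name) : pexp :=
  match G with
  | Z2_2 => #4 [+] #(-1) [*] PY [*] PY
  | Z2_3 => #4 [+] #(-1) [*] PX [*] PXc
  | D4_1 => (#4 [+] #(-1) [*] PX [*] PX) [*] (#4 [+] #(-1) [*] PY [*] PY)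
  | D4_2 => (#3 [+] #(-1) [*] PY) [*] (PY [+] #1)
              [*] (#4 [*] PY [+] #4 [+] #(-1) [*] PX [*] PX)
  | D6_1 => (PX [+] #1) [*] (PX [+] #1) [*] (PX [+] #1)
              [*] (#19 [+] #(-2) [*] (PX [+] #1) [+] #4 [*] PY [+] #4 [*] PYc
                  [+] #(-1) [*] (PX [+] #1) [*] (PX [+] #1))
  | D6_2 => #27 [+] #(-18) [*] PX [*] PY [+] #4 [*] PX [*] PX [*] PX
              [+] #4 [*] PY [*] PY [*] PY [+] #(-1) [*] PX [*] PX [*] PY [*] PY
  | D8 => (#16 [+] #(-4) [*] PX [*] PX [+] #8 [*] (PY [+] #(-1))
             [+] (PY [+] #(-1)) [*] (PY [+] #(-1)))
            [*] (PX [*] PX [+] #4 [+] #(-4) [*] PY)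
  | D12 => (#4 [*] PX [*] PX [*] PX [+] #(-1) [*] PX [*] PX [+] #(-2) [*] PX
              [+] #(-10) [*] PX [*] PY [+] #(-1) [*] PY [*] PY
              [+] #(-10) [*] PY [+] #7)
             [*] (#7 [+] #4 [*] PY [+] #(-2) [*] PX [+] #(-1) [*] PX [*] PX)
  end.

End SquaredJacobian.

(** * Laurent polynomial identities verified by computation *)

Lemma cert_chi1 G : fzero (fsub (fmul (fSsum G (rho_vec G)) (fsum (chi1_weights G)))
  (fSsum G (rho1 G + rho_vec G))).
Proof. by case: G; vm_compute. Qed.

Lemma cert_chi2 G : fzero (fsub (fmul (fSsum G (rho_vec G)) (fsum (chi2_weights G)))
  (fSsum G (rho2 G + rho_vec G))).
Proof. by case: G; vm_compute. Qed.

Lemma cert_S G : fzero (fsub (fSsum G (rho_vec G))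
  (fmul [:: Smono G] (fprod1 (roots G)))).
Proof. by case: G; vm_compute. Qed.

Lemma cert_jac G : let F := jac_extra G in
  fzero (fsub (fmul (fjac (chi1_weights G) (chi2_weights G)) (jac_mult G))
  (fmul (fmul [:: jac_mono G] (fprod1 (jac_roots G))) (fmul F (fmul F F)))).
Proof. by case: G; vm_compute. Qed.

(** Except for [D6_1] the extra factor is 1 and 1 - u^3 is its own cofactor, so that [jacK_eq0] can
    treat all groups alike. *)
Lemma cert_extra G : fzero (fsub
  (fadd (fmul (jac_extra G) (extra_cofactor G).1)
        (fmul (fconj (jac_extra G)) (extra_cofactor G).2))
  [:: (1, 0); (-1, (0, -3))]).
Proof. by case: G; vm_compute. Qed.

Lemma cert_jac_sq G : let K := fnorm (fjac (chi1_weights G) (chi2_weights G)) in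
  fzero (fsub (fmul K (fconj K))
    (pformal (fsum (chi1_weights G)) (fsum (chi2_weights G)) (jac_sq G))).
Proof. by case: G; vm_compute. Qed.

Lemma cert_invariant G : all (fun x =>
  perm_eq (map (tdual x) (chi1_weights G)) (chi1_weights G) &&
  perm_eq (map (tdual x) (chi2_weights G)) (chi2_weights G)) (glist G).
Proof. by case: G; vm_compute. Qed.

Section CharacterFormulas.
Variable R : realType.
Implicit Types (t : plane R) (G : group_name).

Definition lsum (l : seq weight) t : R[i] := \sum_(v <- l) sigma v t.

Lemma SsumE G v t : Ssum G v t = feval (fSsum G v) t.
Proof.
rewrite /Ssum Gamma_mxof -fsbig_seq ?map_inj_uniq ?glist_uniq //; last exact: mx_of_inj.
rewrite /feval /fSsum !big_map; apply: eq_bigr => x _.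
by rewrite det_mx_of sigma_act dual_act_mx_of.
Qed.

Lemma laurentE (p : weight -> nat) (l : seq weight) t :
  {subset [pred w | p w != 0%N] <= l} -> uniq l ->
  laurent p t = \sum_(v <- l) (p v)%:R * sigma v t.
Proof.
move=> pl ul; rewrite /laurent (@fsbigE _ _ _ _ _ l) //.
  by apply: eq_bigl => v; rewrite in_setT.
move=> i _ il; have -> : p i = 0%N.
  by apply/eqP; apply: contraNT il => pi0; exact: pl.
by rewrite mul0r.
Qed.

Lemma laurent_count l t : laurent (fun v => count_mem v l) t = lsum l t.
Proof.
rewrite (@laurentE _ (undup l)) ?undup_uniq //.
  rewrite /lsum -[RHS]big_undup_iterop_count /=.
  by apply: eq_bigr => v _; rewrite -[RHS]mulr_natl.
by move=> w /=; rewrite mem_undup inE -lt0n -has_count has_pred1.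
Qed.

Lemma is_chi_count G v l :
  fzero (fsub (fmul (fSsum G (rho_vec G)) (fsum l)) (fSsum G (v + rho_vec G))) ->
  @is_chi R G v (fun w => count_mem w l).
Proof.
move=> cert; split.
  apply: (sub_finite_set _ (finite_seq l)) => w /=.
  by rewrite -lt0n -has_count has_pred1.
move=> t; rewrite laurent_count varrhoE !SsumE /lsum -feval_sum -feval_mul.
by apply/eqP; rewrite -subr_eq0 -feval_sub; apply/eqP; exact: fzeroP.
Qed.

Lemma Ssum_neq0 G t : (forall v, v \in roots G -> sigma v t != 1) ->
  Ssum G (varrho G) t != 0.
Proof.
move=> vt; rewrite varrhoE SsumE.
have := @fzeroP R _ t (cert_S G); rewrite feval_sub feval_mul.
rewrite feval_prod1 => /subr0_eq ->.
rewrite mulf_neq0 //; last first.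
  rewrite prodf_seq_neq0; apply/allP => v vG /=.
  by rewrite subr_eq0 eq_sym vt.
have s0 : sigma (Smono G).2 t != 0.
  apply/eqP => s0; have := normc_sigma (Smono G).2 t.
  by rewrite s0 /normc ComplexField.Normc.normc0 => /esym/eqP; rewrite oner_eq0.
have -> : [:: Smono G] = [:: ((Smono G).1, (Smono G).2)] by case: Smono.
by rewrite feval_mon mulf_neq0 // intr_eq0; case: (G).
Qed.

Definition jacK G t : R[i] := feval (fjac (chi1_weights G) (chi2_weights G)) t.

(** By [cert_jac] one of three factors vanishes. A monomial has modulus 1; a factor 1 - sigma_v
    yields v itself; and where the extra factor vanishes so does its conjugate, hence also 1 -
    sigma_(0, -3) by [cert_extra]. *)
Lemma jacK_eq0 G t : jacK G t = 0 ->
  exists2 v, v \in (0, -3) :: jac_roots G & sigma v t = 1.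
Proof.
move=> K0.
have := @fzeroP R _ t (cert_jac G).
rewrite feval_sub !feval_mul -/(jacK G t) K0 mul0r sub0r => /eqP.
rewrite oppr_eq0 !mulf_eq0 => /orP[/orP[|]|].
- have -> : [:: jac_mono G] = [:: ((jac_mono G).1, (jac_mono G).2)] by case: jac_mono.
  rewrite feval_mon mulf_eq0 intr_eq0 => /orP[|/eqP s0]; first by case: (G).
  have := normc_sigma (jac_mono G).2 t.
  by rewrite s0 /normc ComplexField.Normc.normc0 => /esym/eqP; rewrite oner_eq0.
- rewrite feval_prod1 prodf_seq_eq0 => /hasP[v vG /=].
  by rewrite subr_eq0 => /eqP s1; exists v => //; rewrite inE vG orbT.
- rewrite !orbb => /eqP F0.
  have := @fzeroP R _ t (cert_extra G).
  rewrite feval_sub feval_add !feval_mul feval_conj F0 conjc0 !mul0r addr0 sub0r.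
  move=> /eqP; rewrite oppr_eq0 /feval !big_cons big_nil sigma0 /= addr0 mulr1.
  by rewrite mulN1r subr_eq0 => /eqP s1; exists (0, -3) => //; rewrite inE eqxx.
Qed.

Lemma jacK_roots_neq0 G v : v \in (0, -3) :: jac_roots G -> v != 0.
Proof.
by move: v; apply/allP; case: G.
Qed.

Lemma jacK_sq G t : jacK G t * (jacK G t)^* =
  peval (lsum (chi1_weights G) t) (lsum (chi2_weights G) t) (jac_sq G).
Proof.
have := @fzeroP R _ t (cert_jac_sq G).
rewrite feval_sub feval_mul feval_conj feval_norm feval_pformal !feval_sum.
by move/subr0_eq.
Qed.

Lemma lsum_affine G g n t : Gamma G g ->
  (lsum (chi1_weights G) (affine_act g n t) = lsum (chi1_weights G) t) *
  (lsum (chi2_weights G) (affine_act g n t) = lsum (chi2_weights G) t).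
Proof.
rewrite GammaE => -[x xG ->].
have /andP[p1 p2] := allP (cert_invariant G) _ xG.
split; rewrite /lsum; [rewrite -[RHS](perm_big _ p1)|rewrite -[RHS](perm_big _ p2)];
  by rewrite big_map; apply: eq_bigr => v _; rewrite sigma_affine dual_act_mx_of.
Qed.

End CharacterFormulas.

(** * Invariance of the area under integral affine maps *)

(** All generators are products of one reflection, the swap of coordinates and one shear, for which
    preservation of area is a direct consequence of Fubini's theorem. *)
Lemma glist_shear_ind G (P : 'M[int]_2 -> Prop) :
  P (mx_of (1, 0, 0, -1)) -> P (mx_of (0, 1, 1, 0)) -> P (mx_of (1, 0, 1, 1)) ->
  (forall h k, P h -> P k -> P (h *m k)) ->
  forall x, x \in glist G -> P (mx_of x).
Proof.
move=> LT2 LT2' LU LinM.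
have L1 : P (mx_of tid).
  by rewrite -[tid]/(tmulmx (0, 1, 1, 0) (0, 1, 1, 0)) mx_ofM; exact: LinM.
have LT4 : P (mx_of (0, -1, 1, 0)).
  by rewrite -[(0, -1, 1, 0)]/(tmulmx (0, 1, 1, 0) (1, 0, 0, -1)) mx_ofM; exact: LinM.
have Lm1 : P (mx_of (-1, 0, 0, -1)).
  by rewrite -[(-1, 0, 0, -1)]/(tmulmx (0, -1, 1, 0) (0, -1, 1, 0)) mx_ofM; exact: LinM.
have LT3 : P (mx_of (0, -1, 1, -1)).
  by rewrite -[(0, -1, 1, -1)]/(tmulmx (1, 0, 1, 1) (0, -1, 1, 0)) mx_ofM; exact: LinM.
have LT6 : P (mx_of (0, 1, -1, 1)).
  by rewrite -[(0, 1, -1, 1)]/(tmulmx (-1, 0, 0, -1) (0, -1, 1, -1)) mx_ofM; exact: LinM.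
have LmT2' : P (mx_of (0, -1, -1, 0)).
  by rewrite -[(0, -1, -1, 0)]/(tmulmx (-1, 0, 0, -1) (0, 1, 1, 0)) mx_ofM; exact: LinM.
have gen x : x \in gens G -> P (mx_of x).
  by case: (G); rewrite /= !inE; do ?[move=> /orP[]]; move=> /eqP->.
move=> x; rewrite /glist; elim: (X in iter X) x => [|k IH] x.
  by rewrite inE => /eqP ->.
rewrite iterS mem_undup mem_cat => /orP[/IH //|].
move=> /allpairsP[[y z] [yG zG ->]] /=; rewrite mx_ofM.
by apply: LinM; [exact: IH|exact: gen].
Qed.

Section PlaneMeasure.
Variable R : realType.
Local Notation L := (@lebesgue_measure R).
Local Notation TR := (measurableTypeR R).
Implicit Types (t : plane R) (A : set (plane R)).

Lemma measurable_coord1 : measurable_fun setT (fun t : plane R => t.1 : R).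
Proof. exact: measurable_fst. Qed.

Lemma measurable_coord2 : measurable_fun setT (fun t : plane R => t.2 : R).
Proof. exact: measurable_snd. Qed.

Lemma measurable_translate (c : R) : measurable_fun setT (fun x : TR => (x + c : TR)).
Proof. by apply: measurable_funD. Qed.

Lemma lebesgue_translate (c : R) (A : set TR) : measurable A ->
  L ((fun x : TR => (x + c : TR)) @^-1` A) = L A.
Proof.
move=> mA.
have mf := measurable_translate c.
rewrite -[LHS]/(pushforward L (fun x : TR => (x + c : TR)) A).
apply/esym/lebesgue_measure_unique => //= _ [[a b]] _ <-.
rewrite /pushforward.
have -> : (fun x : TR => (x + c : TR)) @^-1` [set` `]a, b]] = [set` `](a - c), (b - c)]].
  by apply/seteqP; split => x; rewrite /= !in_itv /= ltrBlDr lerBrDr.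
rewrite !lebesgue_measure_itv /= !lte_fin ltrD2r; case: ifP => // _.
by rewrite -!EFinB; congr EFin; ring.
Qed.

Lemma lebesgue_opp (A : set TR) : measurable A ->
  L ((fun x : TR => (- x : TR)) @^-1` A) = L A.
Proof. exact: lebesgue_measureN. Qed.

Definition leb2_preserving (f : plane R -> plane R) : Prop :=
  measurable_fun setT f /\
  forall A, measurable A -> leb2 R (f @^-1` A) = leb2 R A.

Lemma leb2_preserving_comp f g : leb2_preserving f -> leb2_preserving g ->
  leb2_preserving (f \o g).
Proof.
move=> [mf fE] [mg gE]; split; first exact: measurableT_comp.
move=> A mA; rewrite comp_preimage gE ?fE //.
by rewrite -[X in measurable X]setTI; exact: mf.
Qed.

Lemma leb2_swap : leb2_preserving (fun t => (t.2, t.1)).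
Proof.
have ms : measurable_fun setT (fun t : plane R => (t.2, t.1) : plane R).
  apply: measurable_fun_pair; [exact: measurable_snd|exact: measurable_fst].
split=> // A mA.
rewrite -[LHS]/(pushforward (leb2 R) (fun t : plane R => (t.2, t.1) : plane R) A).
apply/esym/product_measure_unique => // X Y mX mY.
rewrite /= /pushforward.
have -> : (fun t : plane R => (t.2, t.1) : plane R) @^-1` (X `*` Y) = Y `*` X.
  by apply/seteqP; split => -[x y] /= [].
by rewrite /leb2 product_measure1E // muleC.
Qed.

(** On each vertical line the map is a translation, composed with y -> -y when [e] holds, and the
    area is the integral of the lengths of the sections. Reflections, shears and vertical
    translations are all of this form. *)
Lemma leb2_shear (a c : R) (e : bool) :
  leb2_preserving (fun t => (t.1, a * t.1 + (-1) ^+ e * t.2 + c)).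
Proof.
have ms : measurable_fun setT
    (fun t : plane R => (t.1, a * (t.1 : R) + (-1) ^+ e * (t.2 : R) + c) : plane R).
  apply: measurable_fun_pair; first exact: measurable_fst.
  have [m1 m2] := (measurable_coord1, measurable_coord2).
  have : measurable_fun setT
      (fun t : plane R => a * (t.1 : R) + (-1) ^+ e * (t.2 : R) + c : R).
    by do 2 ?apply: measurable_funD => //; apply: measurable_funM.
  exact.
split=> // A mA; rewrite /leb2 /product_measure1; apply: eq_integral => x _ /=.
have mx : measurable (xsection A x) by exact: measurable_xsection.
rewrite -[RHS](@lebesgue_translate (a * x + c)) //.
case: e {ms} => /=.
  rewrite -[RHS]lebesgue_opp; last first.
    rewrite -[X in measurable X]setTI.
    exact: (@measurable_translate (a * x + c) measurableT _ mx).
  congr L; apply/seteqP; split => y; rewrite /xsection /= !inE /=;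
    by have -> : a * x + (-1) ^+ 1 * y + c = - y + (a * x + c) by ring.
congr L; apply/seteqP; split => y; rewrite /xsection /= !inE /=;
  by have -> : a * x + (-1) ^+ 0 * y + c = y + (a * x + c) by ring.
Qed.

Lemma leb2_affine G g n : Gamma G g -> leb2_preserving (@affine_act R g n).
Proof.
have trans m : leb2_preserving (@affine_act R 1%:M m).
  (* A translation is a product of two vertical ones, the first coordinate being reached by
     conjugation with the swap. *)
  have -> : @affine_act R 1%:M m = (fun t => (t.2, t.1)) \o
      (fun t => (t.1, 0 * t.1 + (-1) ^+ false * t.2 + m.1%:~R)) \o
      (fun t => (t.2, t.1)) \o
      (fun t => (t.1, 0 * t.1 + (-1) ^+ false * t.2 + m.2%:~R)).
    by apply/funext => -[x y]; rewrite /affine_act /act !mxE /=; congr pair; ring.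
  do 3 (apply: leb2_preserving_comp; last by [exact: leb2_swap|exact: leb2_shear]).
  exact: leb2_swap.
pose Lin (h : 'M[int]_2) := leb2_preserving (@act R h).
have LinM h k : Lin h -> Lin k -> Lin (h *m k).
  move=> Lh Lk; rewrite /Lin; have -> : act (h *m k) = @act R h \o act k; last exact: leb2_preserving_comp.
  apply/funext => t; rewrite /act !mxE !big_ord_recl !big_ord0 /= !addr0 !intrD !intrM.
  have -> : lift ord0 ord0 = 1 :> 'I_2 by apply/val_inj.
  by congr pair; ring.
have LT2 : Lin (mx_of (1, 0, 0, -1)).
  have := leb2_shear 0 0 true; congr leb2_preserving.
  by apply/funext => t; rewrite /act !mxE /=; congr pair; ring.
have LT2' : Lin (mx_of (0, 1, 1, 0)).
  have := leb2_swap; congr leb2_preserving.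
  by apply/funext => t; rewrite /act !mxE /=; congr pair; ring.
have LU : Lin (mx_of (1, 0, 1, 1)).
  have := leb2_shear 1 0 false; congr leb2_preserving.
  by apply/funext => t; rewrite /act !mxE /=; congr pair; ring.
have Ling : forall x, x \in glist G -> Lin (mx_of x) by exact: glist_shear_ind.
rewrite GammaE => -[x xG ->].
have -> : @affine_act R (mx_of x) n = affine_act 1%:M n \o act (mx_of x).
  by apply/funext => t; rewrite /affine_act /act !mxE /=; congr pair; ring.
by apply: leb2_preserving_comp; [exact: trans|exact: Ling].
Qed.

End PlaneMeasure.

(** * Integration over the torus *)

Section TorusIntegral.
Variable R : realType.
Local Notation L := (@lebesgue_measure R).
Local Notation TR := (measurableTypeR R).
Implicit Types (t : plane R) (A : set (plane R)) (v : weight).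

Definition phase v t : R := v.1%:~R * (t.1 : R) + v.2%:~R * (t.2 : R).

Lemma measurable_phase v : measurable_fun setT (phase v).
Proof.
have [m1 m2] := (@measurable_coord1 R, @measurable_coord2 R).
by apply: measurable_funD; apply: measurable_funM.
Qed.

Lemma continuous_phase v : continuous (phase v : R * R -> R).
Proof.
move=> t; apply: cvgD; apply: cvgM; try exact: cvg_cst.
  exact: cvg_fst.
exact: cvg_snd.
Qed.

Lemma sub_range_countable (I : countType) T (f : I -> T) (A : set T) :
  A `<=` range f -> countable A.
Proof.
move=> Af; apply: (sub_countable (subset_card_le Af)).
exact: (sub_countable (card_image_le _ _)).
Qed.

(** The fractional part r of s satisfies cos (2 pi r) = 1 as well; by the double angle formula sin
    (pi r) = 0, which for 0 <= r < 1 leaves only r = 0. *)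
Lemma cos2pi_eq1 (s : R) : cos (2 * pi * s) = 1 -> exists k : int, s = k%:~R.
Proof.
move=> cs; exists (Num.floor s).
apply/eqP; rewrite -subr_eq0; set r := s - _.
have r0 : 0 <= r by rewrite subr_ge0 floor_le_tmp.
have r1 : r < 1 by rewrite ltrBlDl -[X in _ + X]/(1%:~R) -intrD floorD1_gt.
have : cos (2 * pi * r) = 1.
  have -> : r = s + (- Num.floor s)%:~R by rewrite mulrNz.
  have /(congr1 (@complex.Re R)) := expiD s (- Num.floor s)%:~R.
  by rewrite expi_int mulr1 /expi /= => ->.
have -> : 2 * pi * r = (pi * r) *+ 2 by ring.
rewrite cos_mulr2n => h.
rewrite eq_le r0 andbT leNgt; apply/negP => rpos.
have : 0 < sin (pi * r).
  by rewrite sin_gt0_pi // mulr_gt0 ?pi_gt0 //= -[ltRHS]mulr1 ltr_pM2l ?pi_gt0.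
have := cos2Dsin2 (pi * r); rewrite !expr2 => h2 h3.
have : 0 < sin (pi * r) * sin (pi * r) by exact: mulr_gt0.
move: h h2; rewrite expr2; lra.
Qed.

(** The set is the preimage of the integers under a nonzero linear form. If v.2 is nonzero its
    vertical sections are countable; otherwise it is a countable set times a line. *)
Lemma negligible_sigma1 v : v != 0 ->
  (leb2 R).-negligible [set t | sigma v t = 1].
Proof.
move=> v0; pose Z : set R := range (fun k : int => k%:~R).
have mcount (A : set R) : countable A -> measurable A.
  by apply: countable_measurable => r; exact: measurable_set1.
have cZ : countable Z by exact: (@sub_range_countable _ _ (fun k : int => k%:~R : R)).
have mZ : measurable Z by exact: mcount.
exists (phase v @^-1` Z); split.
- by rewrite -[X in measurable X]setTI; exact: (@measurable_phase v measurableT Z mZ).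
- have [v2|v2] := eqVneq v.2 0.
    have v1 : v.1 != 0.
      by apply: contraNneq v0 => v1; rewrite [v]surjective_pairing v1 v2.
    have -> : phase v @^-1` Z = [set x : TR | Z (v.1%:~R * x)] `*` setT.
      apply/seteqP; split => -[x y]; rewrite /phase /= v2 mul0r addr0 //.
      by case.
    have cA : countable [set x : TR | Z (v.1%:~R * x)].
      apply: (@sub_range_countable _ _ (fun k : int => k%:~R / v.1%:~R)) => y /= -[k _ e].
      by exists k => //; rewrite e mulrAC mulfV ?mul1r // intr_eq0.
    rewrite /leb2 product_measure1E //; last exact: mcount.
    by rewrite [X in (X * _)%E]countable_lebesgue_measure0 ?mul0e.
  rewrite /leb2 /product_measure1; apply: integral0_eq => x _ /=.
  apply: countable_lebesgue_measure0.
  apply: (@sub_range_countable _ _ (fun k : int => (k%:~R - v.1%:~R * (x : R)) / v.2%:~R)).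
  move=> y; rewrite /xsection /= inE /= => -[k _ e].
  exists k => //; rewrite e /phase /= addrAC subrr add0r mulrAC mulfV ?mul1r //.
  by rewrite intr_eq0.
- move=> t /= s1.
  have [k e] : exists k : int, phase v t = k%:~R.
    by apply: cos2pi_eq1; have := congr1 (@complex.Re R) s1.
  by exists k.
Qed.

Lemma integral_cos (k : int) (c : R) : k != 0 ->
  (\int[L]_(x in `[0%R, 1%R[) (cos (2 * pi * (k%:~R * x) + c))%:E = 0)%E.
Proof.
move=> k0.
have pik : 2 * pi * k%:~R != 0 :> R.
  by rewrite !mulf_neq0 ?intr_eq0 // gt_eqF ?pi_gt0.
have cc : continuous (fun x : R => cos (2 * pi * (k%:~R * x) + c)).
  move=> x; apply: continuous_comp; last exact: continuous_cos.
  apply: cvgD; last exact: cvg_cst.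
  by apply: cvgM; [exact: cvg_cst|apply: cvgM; [exact: cvg_cst|exact: cvg_id]].
have mc := continuous_measurable_fun cc.
rewrite integral_itv_bndo_bndc; last first.
  by apply/measurable_EFinP; exact: measurable_funTS.
pose F (x : R) := sin (2 * pi * (k%:~R * x) + c) / (2 * pi * k%:~R).
have dF (x : R) : is_derive x 1 F (cos (2 * pi * (k%:~R * x) + c)).
  rewrite /F; apply: is_derive_eq.
  rewrite !scaler0 add0r addr0 /GRing.scale /= mulr1 [X in _^-1 * X]mulrC.
  by rewrite mulKf.
have cF (x : R) : F @ x --> F x.
  by apply: differentiable_continuous; apply/derivable1_diffP; exact: ex_derive.
rewrite (@continuous_FTC2 _ _ F) //.
- rewrite -EFinB; congr EFin; rewrite /F mulr1 !mulr0 add0r sinD.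
  have := expi_int R k; rewrite /expi => -[-> ->].
  by rewrite mul0r mul1r add0r subrr.
- exact: continuous_subspaceT.
- split.
  + by move=> x _; exact: ex_derive.
  + exact: cvg_at_right_filter.
  + exact: cvg_at_left_filter.
- by move=> x _; rewrite derive1E; exact: derive_val.
Qed.

Definition unit_square : set (plane R) := `[0%R, 1%R[ `*` `[0%R, 1%R[.

Lemma measurable_unit_square : measurable unit_square.
Proof. by apply: measurableX. Qed.

Lemma leb2_unit_square : leb2 R unit_square = 1%E.
Proof.
transitivity (L `[0%R, 1%R[%classic * L `[0%R, 1%R[%classic)%E.
  exact: product_measure1E.
by rewrite lebesgue_measure_itv /= lte_fin ltr01 -EFinB subr0 mul1e.
Qed.

Lemma integrable_square (f : plane R -> R) (K : R) : measurable_fun setT f ->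
  (forall t, `|f t| <= K) -> (leb2 R).-integrable unit_square (EFin \o f).
Proof.
move=> mf fK; apply: measurable_bounded_integrable.
- exact: measurable_unit_square.
- by change (leb2 R unit_square < +oo)%E; rewrite leb2_unit_square ltry.
- exact: measurable_funTS.
- exists K; split; first exact: num_real.
  by move=> x Kx t _ /=; apply: le_trans (fK t) (ltW Kx).
Qed.

Lemma measurable_cos : measurable_fun setT (@cos R).
Proof. by apply: continuous_measurable_fun; exact: continuous_cos. Qed.

Lemma measurable_sin : measurable_fun setT (@sin R).
Proof. by apply: continuous_measurable_fun; exact: continuous_sin. Qed.

Lemma integral_cos_phase v (c : R) : v != 0 ->
  Rintegral (leb2 R) unit_square (fun t => cos (2 * pi * phase v t + c)) = 0.
Proof.
move=> v0; rewrite /Rintegral.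
have mg : measurable_fun setT (fun t : plane R => cos (2 * pi * phase v t + c)).
  apply: (measurableT_comp measurable_cos); apply: measurable_funD => //.
  by apply: measurable_funM => //; exact: measurable_phase.
have ig := integrable_square mg (fun t => cos_max _).
rewrite integral_mkcond -(@integral12_prod_meas1 _ _ _ _ _ L L); last first.
  by rewrite -integrable_mkcond //; exact: measurable_unit_square.
rewrite (_ : (\int[L]_x _)%E = 0%E) //.
(* If v.2 is nonzero the inner integral over y already vanishes; otherwise the integrand is constant
   in y and the outer integral over x vanishes. *)
have [v2|v2] := eqVneq v.2 0; last first.
  apply: integral0_eq => x _; rewrite /fubini_F.
  have [xI|xI] := boolP (x \in (`[0%R, 1%R[%classic : set R)); last first.
    apply: integral0_eq => y _; rewrite patchE ifF //.
    by apply: contraNF xI; rewrite !inE /= => -[].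
  rewrite -[RHS](@integral_cos v.2 (2 * pi * (v.1%:~R * x) + c)) // [RHS]integral_mkcond.
  apply: eq_integral => y _; rewrite !patchE.
  have -> : ((x, y) \in unit_square) = (y \in (`[0%R, 1%R[%classic : set R)).
    by apply/idP/idP; rewrite !inE /=; [case|split => //; rewrite inE in xI].
  case: ifP => // _; rewrite /= /phase /=; congr (cos _)%:E; ring.
have v1 : v.1 != 0.
  by apply: contraNneq v0 => v1; rewrite [v]surjective_pairing v1 v2.
rewrite -[RHS](@integral_cos v.1 c) // [RHS]integral_mkcond.
apply: eq_integral => x _; rewrite patchE /fubini_F.
have [xI|xI] := boolP (x \in (`[0%R, 1%R[%classic : set R)); last first.
  apply: integral0_eq => y _; rewrite patchE ifF //.
  by apply: contraNF xI; rewrite !inE /= => -[].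
transitivity (\int[L]_(y in `[0%R, 1%R[) (cos (2 * pi * (v.1%:~R * x) + c))%:E)%E.
  rewrite [RHS]integral_mkcond; apply: eq_integral => y _; rewrite !patchE.
  have -> : ((x, y) \in unit_square) = (y \in (`[0%R, 1%R[%classic : set R)).
    by apply/idP/idP; rewrite !inE /=; [case|split => //; rewrite inE in xI].
  by case: ifP => // _; rewrite /= /phase /= v2 mul0r addr0.
rewrite integral_cst //=.
by rewrite lebesgue_measure_itv /= lte_fin ltr01 -EFinB subr0 mule1.
Qed.

End TorusIntegral.

(** * Integrals of complex-valued functions *)

Section ComplexIntegral.
Variables (R : realType) (d : measure_display) (T : measurableType d).
Variables (mu : {measure set T -> \bar R}) (D : set T).
Hypothesis mD : measurable D.
Implicit Types (f g : T -> R[i]).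

Definition cint f : R[i] :=
  Rintegral mu D (fun z => complex.Re (f z)) +i*
  Rintegral mu D (fun z => complex.Im (f z)).

Definition cintegrable f :=
  mu.-integrable D (fun z => (complex.Re (f z))%:E) /\
  mu.-integrable D (fun z => (complex.Im (f z))%:E).

Lemma cintegrable_lin (c : R[i]) f g : cintegrable f -> cintegrable g ->
  cintegrable (fun z => c * f z + g z).
Proof.
case: c => a b [f1 f2] [g1 g2]; split.
- rewrite (_ : (fun z => _) = (fun z =>
      (a%:E * (complex.Re (f z))%:E - b%:E * (complex.Im (f z))%:E) + (complex.Re (g z))%:E)%E).
    by apply: integrableD => //; apply: integrableB => //; exact: integrableZl.
  by apply/funext => z; case: (f z) (g z) => [x y] [x' y'].
- rewrite (_ : (fun z => _) = (fun z =>
      (a%:E * (complex.Im (f z))%:E + b%:E * (complex.Re (f z))%:E) + (complex.Im (g z))%:E)%E).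
    by apply: integrableD => //; apply: integrableD => //; exact: integrableZl.
  by apply/funext => z; case: (f z) (g z) => [x y] [x' y'].
Qed.

Lemma cint_lin (c : R[i]) f g : cintegrable f -> cintegrable g ->
  cint (fun z => c * f z + g z) = c * cint f + cint g.
Proof.
case: c => a b [f1 f2] [g1 g2]; rewrite /cint; simpc; congr (_ +i* _).
- rewrite -!RintegralZl // -RintegralB //; [|exact: (integrableZl mD a f1)|exact: (integrableZl mD b f2)].
  rewrite -RintegralD //; last exact: (integrableB mD (integrableZl mD a f1) (integrableZl mD b f2)).
  by apply: eq_Rintegral => z _; case: (f z) (g z) => [x y] [x' y'].
- rewrite -!RintegralZl // -RintegralD //; [|exact: (integrableZl mD a f2)|exact: (integrableZl mD b f1)].
  rewrite -RintegralD //; last exact: (integrableD mD (integrableZl mD a f2) (integrableZl mD b f1)).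
  by apply: eq_Rintegral => z _; case: (f z) (g z) => [x y] [x' y'].
Qed.

Lemma cintegrable0 : cintegrable (fun=> 0).
Proof. by split; exact: integrable0. Qed.

Lemma cint0 : cint (fun=> 0) = 0.
Proof. by rewrite /cint /= Rintegral_cst // mul0r. Qed.

Lemma cintegrable_sum I (s : seq I) (c : I -> R[i]) (f : I -> T -> R[i]) :
  (forall i, cintegrable (f i)) -> cintegrable (fun z => \sum_(i <- s) c i * f i z).
Proof.
move=> fi; elim: s => [|i s IH].
  by under eq_fun do rewrite big_nil; exact: cintegrable0.
by under eq_fun do rewrite big_cons; exact: cintegrable_lin.
Qed.

Lemma cint_sum I (s : seq I) (c : I -> R[i]) (f : I -> T -> R[i]) :
  (forall i, cintegrable (f i)) ->
  cint (fun z => \sum_(i <- s) c i * f i z) = \sum_(i <- s) c i * cint (f i).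
Proof.
move=> fi; elim: s => [|i s IH].
  by under eq_fun do rewrite big_nil; rewrite cint0 big_nil.
under eq_fun do rewrite big_cons.
by rewrite cint_lin ?IH ?big_cons //; exact: cintegrable_sum.
Qed.

End ComplexIntegral.

(** * Fourier coefficients and the identification of the characters *)

Section TorusTrig.
Variable R : realType.
Local Notation L := (@lebesgue_measure R).
Local Notation Q := (@unit_square R).
Local Notation tint := (cint (leb2 R) (@unit_square R)).
Implicit Types (t : plane R) (v w : weight) (s r : seq (R[i] * weight)).

Lemma normr_Re_le (z : R[i]) : `|complex.Re z| <= normc z.
Proof.
by rewrite -[leLHS]sqrtr_sqr; case: z => a b /=; rewrite ler_sqrt ?addr_ge0 ?sqr_ge0 // lerDl sqr_ge0.
Qed.

Lemma trig_cons e s t : trig (e :: s) t = e.1 * sigma e.2 t + trig s t.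
Proof. exact: big_cons. Qed.

Lemma measurable_trig s :
  measurable_fun setT (fun t => complex.Re (trig s t)) /\
  measurable_fun setT (fun t => complex.Im (trig s t)).
Proof.
elim: s => [|[[a b] v] s [IHr IHi]].
  by split; under eq_fun do rewrite /trig big_nil /=; exact: measurable_cst.
have mc : measurable_fun setT (fun t : plane R => cos (2 * pi * phase v t)).
  apply: (measurableT_comp (@measurable_cos R)).
  by apply: measurable_funM => //; exact: measurable_phase.
have ms : measurable_fun setT (fun t : plane R => sin (2 * pi * phase v t)).
  apply: (measurableT_comp (@measurable_sin R)).
  by apply: measurable_funM => //; exact: measurable_phase.
split.
- rewrite (_ : (fun t => _) = (fun t => a * cos (2 * pi * phase v t)
      - b * sin (2 * pi * phase v t) + complex.Re (trig s t))); last first.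
    by apply/funext => t; rewrite trig_cons; case: (trig s t).
  by apply: measurable_funD => //; apply: measurable_funB; apply: measurable_funM.
- rewrite (_ : (fun t => _) = (fun t => a * sin (2 * pi * phase v t)
      + b * cos (2 * pi * phase v t) + complex.Im (trig s t))); last first.
    by apply/funext => t; rewrite trig_cons; case: (trig s t).
  by apply: measurable_funD => //; apply: measurable_funD; apply: measurable_funM.
Qed.

Lemma continuous_trig s :
  continuous ((fun t => complex.Re (trig s t)) : R * R -> R) /\
  continuous ((fun t => complex.Im (trig s t)) : R * R -> R).
Proof.
elim: s => [|[[a b] v] s [IHr IHi]].
  by split; under eq_fun do rewrite /trig big_nil /=; exact: cst_continuous.
have mc : continuous ((fun t : plane R => cos (2 * pi * phase v t)) : R * R -> R).
  move=> t; apply: continuous_comp; last exact: continuous_cos.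
  by apply: cvgM; [exact: cvg_cst|exact: continuous_phase].
have ms : continuous ((fun t : plane R => sin (2 * pi * phase v t)) : R * R -> R).
  move=> t; apply: continuous_comp; last exact: continuous_sin.
  by apply: cvgM; [exact: cvg_cst|exact: continuous_phase].
split.
- rewrite (_ : (fun t => _) = (fun t => a * cos (2 * pi * phase v t)
      - b * sin (2 * pi * phase v t) + complex.Re (trig s t))); last first.
    by apply/funext => t; rewrite trig_cons; case: (trig s t).
  move=> t; apply: cvgD; last exact: IHr.
  by apply: cvgB; apply: cvgM; [exact: cvg_cst|exact: mc|exact: cvg_cst|exact: ms].
- rewrite (_ : (fun t => _) = (fun t => a * sin (2 * pi * phase v t)
      + b * cos (2 * pi * phase v t) + complex.Im (trig s t))); last first.
    by apply/funext => t; rewrite trig_cons; case: (trig s t).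
  move=> t; apply: cvgD; last exact: IHi.
  by apply: cvgD; apply: cvgM; [exact: cvg_cst|exact: ms|exact: cvg_cst|exact: mc].
Qed.

Definition tnorm s : R := \sum_(e <- s) normc e.1.

Lemma trig_le s t : normc (trig s t) <= tnorm s.
Proof.
apply: le_trans (normc_sum _ _) _; apply: ler_sum => e _.
by rewrite normcM normc_sigma mulr1.
Qed.

Lemma normr_Im_le (z : R[i]) : `|complex.Im z| <= normc z.
Proof.
by rewrite -[leLHS]sqrtr_sqr; case: z => a b /=; rewrite ler_sqrt ?addr_ge0 ?sqr_ge0 // lerDr sqr_ge0.
Qed.

Lemma cintegrable_trig s : cintegrable (leb2 R) Q (trig s).
Proof.
have [mr mi] := measurable_trig s.
split; [apply: (integrable_square mr (K := tnorm s))|apply: (integrable_square mi (K := tnorm s))] => t.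
  exact: le_trans (normr_Re_le _) (trig_le _ _).
exact: le_trans (normr_Im_le _) (trig_le _ _).
Qed.

Lemma tint_sigma v : tint (sigma v) = (v == 0)%:R.
Proof.
have mQ : measurable Q by exact: measurable_unit_square.
have [->|v0] := eqVneq v 0.
  rewrite /cint; under [X in Rintegral _ _ X]eq_fun do rewrite sigma0.
  under [X in _ +i* Rintegral _ _ X]eq_fun do rewrite sigma0.
  rewrite /= !Rintegral_cst; [|exact: mQ|exact: mQ].
  by rewrite -[X in fine X]/(leb2 R Q) leb2_unit_square mul0r mul1r.
rewrite -[RHS]/((0 : R) +i* (0 : R)); congr (_ +i* _).
  by rewrite -[RHS](@integral_cos_phase R v 0 v0); apply: eq_Rintegral => t _; rewrite addr0.
rewrite -[RHS](@integral_cos_phase R v (- (pi / 2)) v0); apply: eq_Rintegral => t _.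
by rewrite cosB cos_pihalf sin_pihalf mulr0 mulr1 add0r.
Qed.

(** By orthogonality both sides collect the coefficients at exponent 0. This is the bridge between
    integrals over the torus and vector states on l^2(Z^2). *)
Lemma tint_trig s : tint (trig s) = convol s (@basis R 0) 0.
Proof.
rewrite /trig cint_sum; last 2 first.
- exact: measurable_unit_square.
- move=> e; have := cintegrable_trig [:: (1, e.2)].
  by rewrite (_ : trig _ = sigma e.2) //; apply/funext => t; rewrite /trig big_seq1 mul1r.
apply: eq_bigr => e _; rewrite tint_sigma /basis sub0r oppr_eq0 //.
Qed.

Lemma tint_ae0 s (N : set (plane R)) : (leb2 R).-negligible N ->
  (forall t, ~ N t -> trig s t = 0) -> tint (trig s) = 0.
Proof.
move=> N0 s0; have [mr mi] := measurable_trig s.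
have part (f : plane R -> R) : measurable_fun setT f -> (forall t, ~ N t -> f t = 0) ->
    Rintegral (leb2 R) Q f = 0.
  move=> mf f0; rewrite /Rintegral.
  rewrite (@ae_eq_integral _ _ _ (leb2 R) Q (cst 0%E) (EFin \o f)) ?integral0 //.
  - exact: measurable_unit_square.
  - by apply/measurable_EFinP; exact: measurable_funTS.
  - apply: negligibleS N0 => t /= /not_implyP[_ ft]; apply: contrapT => Nt.
    by apply: ft; rewrite /= f0.
by rewrite /cint !part // => t /s0 ->.
Qed.

(** The coefficient of the difference at w is the integral of the difference times sigma_(-w), and
    an integral ignores the null set [N]. *)
Lemma laurent_inj (p q : weight -> nat) (N : set (plane R)) :
  finite_set [set w | p w != 0%N] -> finite_set [set w | q w != 0%N] ->
  (leb2 R).-negligible N ->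
  (forall t, ~ N t -> laurent p t = laurent q t :> R[i]) -> p = q.
Proof.
move=> /finite_seqP[rp rpE] /finite_seqP[rq rqE] N0 pq.
pose r := undup (rp ++ rq).
have ur : uniq r by exact: undup_uniq.
have pr : {subset [pred w | p w != 0%N] <= r}.
  move=> w pw; rewrite mem_undup mem_cat.
  by have /= -> : [set` rp] w by rewrite -rpE.
have qr : {subset [pred w | q w != 0%N] <= r}.
  move=> w pw; rewrite mem_undup mem_cat orbC.
  by have /= -> : [set` rq] w by rewrite -rqE.
pose D := [seq ((p v)%:R - (q v)%:R : R[i], v) | v <- r].
have DE t : trig D t = laurent p t - laurent q t.
  rewrite (laurentE _ pr ur) (laurentE _ qr ur) -sumrB /trig big_map.
  by apply: eq_bigr => v _; rewrite mulrBl.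
apply/funext => w; have [wr|wr] := boolP (w \in r); last first.
  have /negbNE/eqP -> : ~~ (p w != 0%N) by apply: contra wr => /pr.
  by have /negbNE/eqP -> : ~~ (q w != 0%N) by apply: contra wr => /qr.
have : tint (trig (tmul D [:: (1, - w)])) = 0.
  by apply: tint_ae0 N0 _ => t /pq pqt; rewrite trig_mul DE pqt subrr mul0r.
rewrite tint_trig convol_mul /convol big_map (bigD1_seq w) //= [X in _ + X]big1_seq ?addr0; last first.
  move=> v /andP[vw _]; rewrite /convol big_seq1 /basis /= sub0r opprK [- v + w]addrC subr_eq0.
  by rewrite eq_sym (negPf vw) !mulr0.
rewrite /convol big_seq1 /basis /= sub0r opprK addNr eqxx !mulr1.
by move/eqP; rewrite subr_eq0 eqr_nat => /eqP.
Qed.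

Lemma negligible_sigma1_seq (l : seq weight) : all (fun v => v != 0) l ->
  (leb2 R).-negligible [set t | exists2 v, v \in l & sigma v t = 1].
Proof.
elim: l => [_|v l IH /= /andP[v0 /IH l0]].
  by apply: negligibleS (negligible_set0 _) => t [].
apply: negligibleS (negligibleU (negligible_sigma1 R v0) l0) => t [w].
by rewrite inE => /predU1P[->|wl] s1; [left|right; exists w].
Qed.

(** [chi_coef] is only a choice among the solutions of [is_chi]. Two solutions agree wherever
    S_varrho is nonzero, by cancellation, that is, off the null set where some sigma_v with v in
    [roots G] equals 1. *)
Lemma chi_coef_count G v l :
  fzero (fsub (fmul (fSsum G (rho_vec G)) (fsum l)) (fSsum G (v + rho_vec G))) ->
  @chi_coef R G v = (fun w => count_mem w l).
Proof.
move=> cert; have chil := is_chi_count R cert.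
have [fin chiE] : @is_chi R G v (chi_coef R G v) by exact: xgetI chil.
have [finl chilE] := chil.
apply: (laurent_inj fin finl (negligible_sigma1_seq (l := roots G) _)).
  by case: (G).
move=> t Nt; apply: (@mulfI _ (Ssum G (varrho G) t)); last by rewrite chiE chilE.
apply: Ssum_neq0 => w wG; apply/eqP => s1; apply: Nt; by exists w.
Qed.

Lemma chi1_coefE G : @chi_coef R G (rho1 G) = (fun w => count_mem w (chi1_weights G)).
Proof. exact/chi_coef_count/cert_chi1. Qed.

Lemma chi2_coefE G : @chi_coef R G (rho2 G) = (fun w => count_mem w (chi2_weights G)).
Proof. exact/chi_coef_count/cert_chi2. Qed.

Lemma chi1E G t : chi G (rho1 G) t = lsum (chi1_weights G) t :> R[i].
Proof. by rewrite /chi chi1_coefE laurent_count. Qed.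

Lemma chi2E G t : chi G (rho2 G) t = lsum (chi2_weights G) t :> R[i].
Proof. by rewrite /chi chi2_coefE laurent_count. Qed.

Definition tlist (l : seq weight) : seq (R[i] * weight) := [seq (1, v) | v <- l].

Lemma trig_tlist l t : trig (tlist l) t = lsum l t.
Proof. by rewrite /trig big_map; apply: eq_bigr => v _; rewrite mul1r. Qed.

Lemma adjacency_count G v l : @chi_coef R G v = (fun w => count_mem w l) ->
  @adjacency R G v = convol (tlist l).
Proof.
move=> cE; apply/funext => f; apply/funext => n.
rewrite /adjacency /edges cE.
rewrite (@fsbigE _ _ _ _ _ [seq n - w | w <- undup l]) //; first last.
- move=> m _ nm; rewrite (count_memPn _) ?mul0r //.
  apply: contra nm => nm; apply/mapP; exists (n - m); rewrite ?mem_undup //.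
  by rewrite opprB addrC subrK.
- by rewrite map_inj_uniq ?undup_uniq // => a b /addrI /oppr_inj.
rewrite big_map (eq_bigl xpredT); last by move=> m; rewrite in_setT.
rewrite /convol big_map -[RHS]big_undup_iterop_count /=.
by apply: eq_bigr => w _; rewrite opprB addrC subrK -[RHS]mulr_natl mul1r.
Qed.

Lemma adjacency1E G : @adjacency R G (rho1 G) = convol (tlist (chi1_weights G)).
Proof. exact/adjacency_count/chi1_coefE. Qed.

Lemma adjacency2E G : @adjacency R G (rho2 G) = convol (tlist (chi2_weights G)).
Proof. exact/adjacency_count/chi2_coefE. Qed.

End TorusTrig.

(** * Operators on square-summable families *)

Section L2.
Variable R : realType.
Local Notation Q := (@unit_square R).
Local Notation tint := (cint (leb2 R) (@unit_square R)).
Local Notation delta0 := (basis R (0%R : weight)).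
Implicit Types (t : plane R) (v w : weight) (s r : seq (R[i] * weight)) (f g : vec R).

Lemma esum_seq (a : weight -> R) (l : seq weight) : uniq l -> (forall v, 0 <= a v) ->
  (forall v, v \notin l -> a v = 0) ->
  (\esum_(v in [set: weight]) (a v)%:E = (\sum_(v <- l) a v)%:E)%E.
Proof.
move=> ul a0 al; rewrite -sumEFin (fsbig_seq _ _ ul) -esum_fset //; last first.
  by move=> v _; rewrite lee_fin.
rewrite [RHS]esum_mkcond; apply: eq_esum => v _.
case: ifPn => //; rewrite notin_setE /= => /negP vl.
by rewrite al //; apply/negP.
Qed.

Lemma seq_le_esum (a : weight -> R) (l : seq weight) : uniq l ->
  ((\sum_(v <- l) a v)%:E <= \esum_(v in [set: weight]) (a v)%:E)%E.
Proof.
move=> ul; apply: esum_ge; exists [set` l]; first by split => //; exact: finite_seq.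
by rewrite -sumEFin (fsbig_seq _ _ ul).
Qed.

Lemma esum_le_seq (a : weight -> R) (M : \bar R) :
  (forall l, uniq l -> ((\sum_(v <- l) a v)%:E <= M)%E) ->
  (\esum_(v in [set: weight]) (a v)%:E <= M)%E.
Proof.
move=> aM; apply: ge_ereal_sup => _ [X [finX _]] <-.
by rewrite fsbig_finite //= sumEFin; apply: aM; exact: fset_uniq.
Qed.

Lemma sqnorm_seq f (l : seq weight) : uniq l -> (forall v, v \notin l -> f v = 0) ->
  sqnorm f = (\sum_(v <- l) normc (f v) ^+ 2)%:E.
Proof.
move=> ul fl; apply: esum_seq => // [v|v /fl ->]; first exact: sqr_ge0.
by rewrite /normc ComplexField.Normc.normc0 expr0n.
Qed.

Lemma seq_le_sqnorm f (l : seq weight) : uniq l ->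
  ((\sum_(v <- l) normc (f v) ^+ 2)%:E <= sqnorm f)%E.
Proof. exact: seq_le_esum. Qed.

Lemma sqnorm_ge0 f : (0 <= sqnorm f)%E.
Proof. by apply: esum_ge0 => v _; rewrite lee_fin sqr_ge0. Qed.

Lemma normc_le_sqnorm f v : ((normc (f v) ^+ 2)%:E <= sqnorm f)%E.
Proof.
by have := @seq_le_sqnorm f [:: v] isT; rewrite big_seq1.
Qed.

Lemma sqr_normcD (a b : R[i]) :
  normc (a + b) ^+ 2 <= 2 * normc a ^+ 2 + 2 * normc b ^+ 2.
Proof.
rewrite !sqr_normcE; case: a b => [a a'] [b b'] /=.
have := sqr_ge0 (a - b); have := sqr_ge0 (a' - b'); rewrite !expr2; lra.
Qed.

Lemma sqnormD f g :
  (sqnorm (fun v => f v + g v)%R <= 2%:E * sqnorm f + 2%:E * sqnorm g)%E.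
Proof.
apply: esum_le_seq => l ul.
apply: (@le_trans _ _ (2%:E * (\sum_(v <- l) normc (f v) ^+ 2)%:E +
  2%:E * (\sum_(v <- l) normc (g v) ^+ 2)%:E)%E); last first.
  by apply: leeD; apply: lee_pmul => //; rewrite ?lee_fin ?sumr_ge0 //;
    [move=> v _; exact: sqr_ge0|exact: seq_le_sqnorm|move=> v _; exact: sqr_ge0|exact: seq_le_sqnorm].
rewrite -!EFinM -EFinD lee_fin !mulr_sumr -big_split.
by apply: ler_sum => v _; exact: sqr_normcD.
Qed.

Lemma sqnormZ (c : R[i]) f :
  (sqnorm (fun v => c * f v)%R <= (normc c ^+ 2)%:E * sqnorm f)%E.
Proof.
apply: esum_le_seq => l ul.
apply: (@le_trans _ _ ((normc c ^+ 2)%:E * (\sum_(v <- l) normc (f v) ^+ 2)%:E)%E); last first.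
  by apply: lee_pmul => //; rewrite ?lee_fin ?sqr_ge0 ?sumr_ge0 //;
    [move=> v _; exact: sqr_ge0|exact: seq_le_sqnorm].
rewrite -EFinM lee_fin mulr_sumr.
by apply: ler_sum => v _; rewrite normcM exprMn.
Qed.

Lemma rsum_seq (u : weight -> R) (l : seq weight) : uniq l ->
  (forall v, v \notin l -> u v = 0) -> rsum u = \sum_(v <- l) u v.
Proof.
move=> ul u0; rewrite /rsum (esum_seq (a := u^\+) ul); last 2 first.
- by move=> v; exact: funrpos_ge0.
- by move=> v /u0; rewrite /funrpos => ->; rewrite maxxx.
rewrite (esum_seq (a := u^\-) ul); last 2 first.
- by move=> v; exact: funrneg_ge0.
- by move=> v /u0; rewrite /funrneg => ->; rewrite oppr0 maxxx.
rewrite /= -sumrB; apply: eq_bigr => v _.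
by rewrite -[in RHS](funrposBneg u).
Qed.

Lemma csum_seq f (l : seq weight) : uniq l ->
  (forall v, v \notin l -> f v = 0) -> csum f = \sum_(v <- l) f v.
Proof.
move=> ul f0; rewrite /csum !(rsum_seq ul); try by move=> v /f0 ->.
elim: l {ul f0} => [|v l IH]; first by rewrite !big_nil.
by rewrite !big_cons -IH; case: (f v).
Qed.

Lemma convol_basis_off s v w : w \notin [seq v + e.2 | e <- s] -> convol s (basis R v) w = 0.
Proof.
move=> ws; rewrite /convol big_seq; apply: big1 => e es.
rewrite /basis subr_eq; case: eqP => [we|_]; last by rewrite mulr0.
by case/negP: ws; apply/mapP; exists e.
Qed.

Lemma adjoint_convol s : adjoint (convol s) = convol (tconj s).
Proof.
apply/funext => g; apply/funext => v; rewrite /adjoint /inner.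
pose l := undup [seq v + e.2 | e <- s].
have ul : uniq l by exact: undup_uniq.
rewrite (csum_seq ul); last first.
  by move=> w; rewrite mem_undup => /convol_basis_off ->; rewrite rmorph0 mulr0.
rewrite /= /convol big_map; under [LHS]eq_bigr => w _ do rewrite /= rmorph_sum mulr_sumr.
rewrite exchange_big /= big_seq [RHS]big_seq; apply: eq_bigr => e es.
have vl : v + e.2 \in l by rewrite mem_undup; apply/mapP; exists e.
rewrite (bigD1_seq (v + e.2)) //= big1_seq => [|w /andP[wv _]].
  by rewrite /basis addrK eqxx mulr1 addr0 mulrC opprK.
by rewrite /basis subr_eq (negPf wv) mulr0 rmorph0 mulr0.
Qed.

(** Parseval's identity: the squared norm is the vector state at 0 of the convolution by the product
    of the conjugate of r with r, hence the mean of |trig r|^2. *)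
Lemma sqnorm_convol_basis r :
  (sqnorm (convol r delta0))= (complex.Re (tint (trig (tmul (tconj r) r))))%:E.
Proof.
pose u := convol r delta0; pose l := undup [seq (0 : weight) + e.2 | e <- r].
have ul : uniq l by exact: undup_uniq.
have u0 v : v \notin l -> u v = 0 by rewrite mem_undup; exact: convol_basis_off.
rewrite (sqnorm_seq ul u0); congr EFin.
rewrite tint_trig convol_mul -adjoint_convol /adjoint /inner (csum_seq ul); last first.
  by move=> v /u0; rewrite /u => ->; rewrite mul0r.
transitivity (complex.Re ((\sum_(v <- l) normc (u v) ^+ 2)%:C)) => //.
congr complex.Re; rewrite rmorph_sum /=; apply: eq_bigr => v _.
exact: sqr_normc.
Qed.

(** For finitely supported vectors Parseval's identity reduces the bound to the pointwise one under
    the integral. In general a partial sum of the squared norm of the image involves only finitely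
    many values of f, so that f may be cut off. *)
Lemma op_norm_convol s (K : R) : (forall t, normc (trig s t) <= K) -> op_norm_le (convol s) K.
Proof.
move=> sK.
have K0 : 0 <= K by apply: le_trans (normc_ge0 _) (sK (0, 0)).
have fin r : (sqnorm (convol (tmul s r) delta0) <= (K ^+ 2)%:E * sqnorm (convol r delta0))%E.
  rewrite !sqnorm_convol_basis -EFinM lee_fin /=.
  have i1 := cintegrable_trig (tmul (tconj r) r).
  have i2 := cintegrable_trig (tmul (tconj (tmul s r)) (tmul s r)).
  have mQ := @measurable_unit_square R.
  rewrite -RintegralZl //; last exact: i1.1.
  apply: le_Rintegral => //; first exact: i2.1.
    exact: (integrableZl mQ _ i1.1).
  have sq z : complex.Re (z^* * z) = normc z ^+ 2 :> R.
    by rewrite mulrC -sqr_normc.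
  move=> t _; rewrite !(trig_mul, trig_conj) !sq normcM exprMn.
  by rewrite ler_wpM2r ?sqr_ge0 // ler_pXn2r ?nnegrE ?normc_ge0.
move=> f f2; apply: esum_le_seq => l ul.
(* All sites that contribute to the values of [convol s f] on [l]. *)
pose m := undup [seq n - e.2 | n <- l, e <- s].
have um : uniq m by exact: undup_uniq.
pose r := [seq (f w, w) | w <- m].
have rE w : convol r delta0 w = if w \in m then f w else 0.
  rewrite /convol big_map; case: ifPn => wm.
    rewrite (bigD1_seq w) //= big1_seq ?addr0 => [|v /andP[vw _]].
      by rewrite /basis subrr eqxx mulr1.
    by rewrite /basis subr_eq0 eq_sym (negPf vw) mulr0.
  rewrite big1_seq // => v /andP[_ vm]; rewrite /basis subr_eq0.
  case: eqP => [wv|_]; last by rewrite mulr0.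
  by rewrite wv vm in wm.
have fr n : n \in l -> convol s f n = convol (tmul s r) delta0 n.
  move=> nl; rewrite convol_mul [in RHS]/convol [LHS]/convol big_seq [RHS]big_seq.
  apply: eq_bigr => e es.
  by rewrite -/(convol r delta0 (n - e.2)) rE mem_undup (_ : _ \in _) //; apply/allpairsPdep; exists n, e.
have -> : \sum_(n <- l) normc (convol s f n) ^+ 2 =
    \sum_(n <- l) normc (convol (tmul s r) delta0 n) ^+ 2.
  by rewrite big_seq [RHS]big_seq; apply: eq_bigr => n /fr ->.
apply: le_trans (seq_le_sqnorm _ ul) (le_trans (fin r) _).
apply: lee_pmul => //; rewrite ?lee_fin ?sqr_ge0 ?sqnorm_ge0 //.
rewrite (sqnorm_seq um); last by move=> v vm; rewrite rE (negPf vm).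
have -> : \sum_(v <- m) normc (convol r delta0 v) ^+ 2 = \sum_(v <- m) normc (f v) ^+ 2.
  by rewrite big_seq [RHS]big_seq; apply: eq_bigr => n nm; rewrite rE nm.
exact: seq_le_sqnorm.
Qed.

End L2.

(** * Approximate eigenvectors *)

Section ApproximateEigenvectors.
Variables (R : realType) (t : plane R).
Implicit Types (v w m : weight) (s r : seq (R[i] * weight)) (f g : vec R).
Implicit Types (T U : op R) (c : R[i]) (e : R) (n : nat).

Lemma normc0 : normc (0 : R[i]) = 0.
Proof. exact: ComplexField.Normc.normc0. Qed.

Lemma normc1 : normc (1 : R[i]) = 1.
Proof. exact: ComplexField.Normc.normc1. Qed.

Lemma normcN1 : normc (-1 : R[i]) = 1.
Proof. by rewrite /normc /= oppr0 expr0n addr0 sqrrN expr1n sqrtr1. Qed.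

Lemma sqnorm0 f : (forall v, f v = 0) -> sqnorm f = 0%E.
Proof.
by move=> f0; rewrite (@sqnorm_seq _ f [::]) // big_nil.
Qed.

Lemma eq_sqnorm f g : (forall v, f v = g v) -> sqnorm f = sqnorm g.
Proof. by move=> fg; congr sqnorm; apply/funext. Qed.

Lemma is_l2P f : is_l2 f -> exists2 x : R, 0 <= x & sqnorm f = x%:E.
Proof.
rewrite /is_l2 => f2; have := sqnorm_ge0 f.
by case: (sqnorm f) f2 => // x _; rewrite lee_fin; exists x.
Qed.

(* ||f + g||^2 <= 2 ||f||^2 + 2 ||g||^2 replaces the triangle inequality. *)
Lemma sqnorm_lin_le c f g (x y : R) : (sqnorm f <= x%:E)%E -> (sqnorm g <= y%:E)%E ->
  (sqnorm (fun v => c * f v + g v)%R <= (2 * (normc c ^+ 2 * x) + 2 * y)%:E)%E.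
Proof.
move=> fx gy; apply: le_trans (sqnormD _ _) _.
rewrite [leRHS]EFinD !EFinM; apply: leeD; apply: lee_pmul => //; rewrite ?sqnorm_ge0 //.
apply: le_trans (sqnormZ _ _) _; apply: lee_pmul => //; rewrite ?sqnorm_ge0 //.
by rewrite lee_fin sqr_ge0.
Qed.

Lemma is_l2_lin c f g : is_l2 f -> is_l2 g -> is_l2 (fun v => c * f v + g v).
Proof.
move=> /is_l2P[x x0 fx] /is_l2P[y y0 gy].
apply: (le_lt_trans (@sqnorm_lin_le c f g x y _ _)); last exact: ltry.
  by rewrite fx.
by rewrite gy.
Qed.

Definition in_box n m : bool :=
  [&& 0 <= m.1, m.1 < n%:Z, 0 <= m.2 & m.2 < n%:Z].

(* A character of Z^2, an eigenfunction of every convolution operator, cut off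
   to a box; ||box n||^2 = n^2. *)
Definition box n : vec R := fun m => if in_box n m then sigma (- m) t else 0.

Lemma sqnorm_le_size f (l : seq weight) : (forall v, v \notin l -> f v = 0) ->
  (forall v, normc (f v) <= 1) -> (sqnorm f <= ((size l)%:R)%:E)%E.
Proof.
move=> fl f1; rewrite (@sqnorm_seq _ f (undup l)) ?undup_uniq //; last first.
  by move=> v; rewrite mem_undup; exact: fl.
rewrite lee_fin; apply: (@le_trans _ _ (\sum_(v <- undup l) 1)).
  by apply: ler_sum => v _; rewrite expr_le1 // normc_ge0.
by rewrite big_const_seq count_predT iter_addr_0 ler_nat size_undup.
Qed.

Lemma sqnorm_box n : sqnorm (box n) = (n%:R ^+ 2)%:E.
Proof.
pose l : seq weight := [seq (i%:Z, j%:Z) | i <- iota 0 n, j <- iota 0 n].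
have ul : uniq l.
  apply: allpairs_uniq; rewrite ?iota_uniq // => -[i j] [i' j'] _ _ /=.
  by case=> -> ->.
have lE v : (v \in l) = in_box n v.
  apply/idP/idP.
    move=> /allpairsPdep[i [j [+ + ->]]]; rewrite !mem_iota /in_box /=; lia.
  case: v => -[i|i] [j|j]; rewrite /in_box /= ?andbF //.
  move=> /andP[i_n j_n]; apply/allpairsPdep; exists i, j.
  by rewrite !mem_iota; split => //; lia.
rewrite (sqnorm_seq ul); last by move=> v; rewrite lE /box => /negPf ->.
congr EFin; rewrite big_seq (eq_bigr (fun=> 1)); last first.
  by move=> v; rewrite lE /box => ->; rewrite normc_sigma expr1n.
rewrite -big_seq big_const_seq count_predT iter_addr_0.
by rewrite size_allpairs size_iota natrM expr2.
Qed.

Lemma box_l2 n : is_l2 (box n).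
Proof. by rewrite /is_l2 sqnorm_box ltry. Qed.

(** Since n^2 is the squared norm of [box n], the error is a relative one: [c] is an approximate
    eigenvalue along the boxes. *)
Definition approx T c : Prop := forall e, 0 < e -> exists N, forall n, (N <= n)%N ->
  (sqnorm (fun v => T (box n) v - c * box n v)%R <= (e * n%:R ^+ 2)%:E)%E.

Definition bounded_op T : Prop := exists2 K : R, 0 <= K & forall f (x : R),
  is_l2 f -> (sqnorm f <= x%:E)%E -> (sqnorm (T f) <= (K * x)%:E)%E.

Definition linear_op T : Prop := forall c f g, is_l2 f -> is_l2 g ->
  forall v, T (fun v => c * f v + g v) v = c * T f v + T g v.

(** Linearity and boundedness are carried along for the sake of products, where [T] is applied to
    the error term of [U]. *)
Definition eigen T c : Prop := [/\ linear_op T, bounded_op T & approx T c].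

Lemma bounded_op_l2 T f : bounded_op T -> is_l2 f -> is_l2 (T f).
Proof.
move=> [K K0 TK] f2; have [x _ fx] := is_l2P f2.
by apply: le_lt_trans (TK f x f2 _) _; rewrite ?fx // ltry.
Qed.

Lemma op_norm_bounded T (K : R) : op_norm_le T K -> bounded_op T.
Proof.
move=> TK; exists (K ^+ 2); first exact: sqr_ge0.
move=> f x f2 fx; apply: le_trans (TK f f2) _; rewrite [leRHS]EFinM.
by apply: lee_pmul => //; rewrite ?sqnorm_ge0 // lee_fin sqr_ge0.
Qed.

Lemma eigen_id : eigen id 1.
Proof.
split=> //; first by exists 1 => // f x _; rewrite mul1r.
move=> e e0; exists 0%N => n _; rewrite sqnorm0 => [|v]; last by rewrite mul1r subrr.
by rewrite lee_fin mulr_ge0 ?sqr_ge0 // ltW.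
Qed.

Lemma eigen_lin a T U c c' : eigen T c -> eigen U c' ->
  eigen (fun f v => a * T f v + U f v) (a * c + c').
Proof.
move=> [Tl [K K0 TK] Ta] [Ul [K' K'0 UK] Ua]; split.
- by move=> b f g f2 g2 v; rewrite Tl // Ul //; ring.
- exists (2 * (normc a ^+ 2 * K) + 2 * K').
    by apply: addr_ge0; apply: mulr_ge0 => //; apply: mulr_ge0 => //; exact: sqr_ge0.
  move=> f x f2 fx.
  apply: le_trans (sqnorm_lin_le a (TK f x f2 fx) (UK f x f2 fx)) _.
  by rewrite lee_fin !mulrDl !mulrA lexx.
- move=> e e0; pose d := e / (2 * normc a ^+ 2 + 2).
  have p0 : 0 < 2 * normc a ^+ 2 + 2.
    by rewrite ltr_wpDl // mulr_ge0 // sqr_ge0.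
  have d0 : 0 < d by rewrite divr_gt0.
  have [N TN] := Ta _ d0; have [N' UN] := Ua _ d0.
  exists (maxn N N') => n; rewrite geq_max => /andP[Nn N'n].
  rewrite (_ : (fun v => _) = (fun v => a * (T (box n) v - c * box n v) +
     (U (box n) v - c' * box n v))%R); last by apply/funext => v; ring.
  apply: le_trans (sqnorm_lin_le a (TN n Nn) (UN n N'n)) _; rewrite lee_fin.
  rewrite (_ : _ + _ = d * (2 * normc a ^+ 2 + 2) * n%:R ^+ 2); last by ring.
  by rewrite divfK // gt_eqF.
Qed.

(** On a box b, T U b - c c' b = c' (T b - c b) + T (U b - c' b); the last term is small because T
    is linear and bounded. *)
Lemma eigen_comp T U c c' : eigen T c -> eigen U c' -> eigen (T \o U) (c * c').
Proof.
move=> [Tl Tb Ta] [Ul Ub Ua].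
have [K K0 TK] := Tb; have [K' K'0 UK] := Ub; split.
- move=> b f g f2 g2 v; rewrite /comp -Tl; [|exact: bounded_op_l2..].
  by congr (T _ v); apply/funext => w; exact: Ul.
- exists (K * K'); first exact: mulr_ge0.
  move=> f x f2 fx; rewrite -mulrA; apply: TK; last exact: UK.
  exact: bounded_op_l2.
- move=> e e0; pose d := e / (2 * normc c' ^+ 2 + 2 * K + 1).
  have p0 : 0 < 2 * normc c' ^+ 2 + 2 * K + 1.
    by rewrite ltr_wpDl // addr_ge0 // mulr_ge0 // sqr_ge0.
  have d0 : 0 < d by rewrite divr_gt0.
  have [N TN] := Ta _ d0; have [N' UN] := Ua _ d0.
  exists (maxn N N') => n; rewrite geq_max => /andP[Nn N'n].
  pose g := fun v => - c' * box n v + U (box n) v.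
  have g2 : is_l2 g by apply: is_l2_lin; [exact: box_l2|apply: bounded_op_l2 => //; exact: box_l2].
  rewrite (_ : (fun v => _) = (fun v => c' * (T (box n) v - c * box n v) + T g v)%R); last first.
    apply/funext => v /=.
    have -> : U (box n) = (fun v => c' * box n v + g v).
      by apply/funext => w; rewrite /g; ring.
    rewrite Tl //; last exact: box_l2.
    by ring.
  have gd : (sqnorm g <= (d * n%:R ^+ 2)%:E)%E.
    apply: le_trans (UN n N'n); rewrite le_eqVlt; apply/orP; left; apply/eqP.
    by apply: eq_sqnorm => v; rewrite /g; ring.
  apply: le_trans (sqnorm_lin_le c' (TN n Nn) (TK _ _ g2 gd)) _; rewrite lee_fin.
  have -> : e = d * (2 * normc c' ^+ 2 + 2 * K + 1) by rewrite divfK // gt_eqF.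
  rewrite (_ : d * _ * _ = 2 * (normc c' ^+ 2 * (d * n%:R ^+ 2)) + 2 * (K * (d * n%:R ^+ 2)) + d * n%:R ^+ 2); last by ring.
  by rewrite lerDl mulr_ge0 ?sqr_ge0 // ltW.
Qed.

Lemma linear_convol s : linear_op (convol s).
Proof. by move=> c f g _ _ v; exact: convol_lin. Qed.

Lemma bounded_convol s : bounded_op (convol s).
Proof. by apply: (@op_norm_bounded _ (tnorm s)); apply: op_norm_convol => x; exact: trig_le. Qed.

Definition shift v : op R := convol [:: (1, v)].

Lemma shiftE v f m : shift v f m = f (m - v).
Proof. by rewrite /shift /convol big_seq1 mul1r. Qed.

Lemma shift_add v w : shift (v + w) = shift v \o shift w.
Proof. by apply/funext => f; apply/funext => m; rewrite /= !shiftE opprD addrA. Qed.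

(** With S the shift by v, and z its eigenvalue of modulus 1, S^-1 b - z^-1 b = - z^-1 S^-1 (S b - z
    b), so that the error for S controls the one for its inverse. *)
Lemma eigen_shift_opp v : eigen (shift v) (sigma v t) -> eigen (shift (- v)) (sigma (- v) t).
Proof.
move=> [_ _ va]; split; [exact: linear_convol|exact: bounded_convol|].
have [K K0 TK] := bounded_convol [:: (1 : R[i], - v)].
move=> e e0; have [|N vN] := va (e / (2 * K + 1)).
  by rewrite divr_gt0 // ltr_wpDl // mulr_ge0.
exists N => n /vN {}vN.
pose g := fun m => - sigma v t * box n m + shift v (box n) m.
have g2 : is_l2 g by apply: is_l2_lin; [exact: box_l2|apply: bounded_op_l2; [exact: bounded_convol|exact: box_l2]].
have gd : (sqnorm g <= (e / (2 * K + 1) * n%:R ^+ 2)%:E)%E.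
  apply: le_trans vN; rewrite le_eqVlt; apply/orP; left; apply/eqP.
  by apply: eq_sqnorm => m; rewrite /g; ring.
have ss : sigma (- v) t * sigma v t = 1.
  by rewrite -sigmaD addNr sigma0.
rewrite (_ : (fun m => _) = (fun m => - sigma (- v) t * shift (- v) g m + 0)); last first.
  apply/funext => m; rewrite addr0 !shiftE /g shiftE opprK addrK mulrDr mulrA mulrNN ss.
  by rewrite mul1r mulNr.
apply: (@le_trans _ _ (2 * (normc (- sigma (- v) t) ^+ 2 * (K * (e / (2 * K + 1) * n%:R ^+ 2))) + 2 * 0)%:E).
  by apply: sqnorm_lin_le; [exact: TK|rewrite sqnorm0].
have -> : normc (- sigma (- v) t) = 1.
  by rewrite -mulN1r normcM normcN1 normc_sigma mulr1.
have {2}-> : e = e / (2 * K + 1) * (2 * K + 1).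
  by rewrite divfK // gt_eqF // ltr_wpDl // mulr_ge0.
rewrite lee_fin expr1n mul1r mulr0 addr0 -subr_ge0.
rewrite (_ : _ - _ = e / (2 * K + 1) * n%:R ^+ 2); last by ring.
by rewrite mulr_ge0 ?sqr_ge0 // divr_ge0 ?ltW // ltr_wpDl // mulr_ge0.
Qed.

(** The character is an exact eigenfunction, so errors occur only where the box and its translate
    differ: on two sides with n sites each, the error having modulus 1 at most. And 2 n <= e n^2 as
    soon as n >= 2 / e. *)
Lemma eigen_shift_unit v : v = (1, 0) \/ v = (0, 1) -> eigen (shift v) (sigma v t).
Proof.
move=> vE; split; [exact: linear_convol|exact: bounded_convol|].
move=> e e0; exists (Num.bound (2 / e)) => n nN.
pose l : seq weight := if v == (1, 0)
  then [seq (i%:Z, j%:Z) | i <- [:: 0%N; n], j <- iota 0 n]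
  else [seq (i%:Z, j%:Z) | i <- iota 0 n, j <- [:: 0%N; n]].
have sl : size l = (2 * n)%N.
  by rewrite /l; case: ifP => _; rewrite size_allpairs size_iota //= mulnC.
have inl (w : weight) (i j : nat) : w = (i%:Z, j%:Z) ->
    (if v == (1, 0) then ((i == 0%N) || (i == n)) && (j < n)%N
     else ((j == 0%N) || (j == n)) && (i < n)%N) -> w \in l.
  move=> ->; rewrite /l; case: ifP => _ /andP[h1 h2]; apply/allpairsPdep; exists i, j.
    by rewrite !inE mem_iota.
  by rewrite !inE mem_iota.
have fl m : m \notin l -> in_box n (m - v) = in_box n m.
  move=> ml; apply/eqP; apply: contraNT ml => mb.
  have : if v == (1, 0) then (m.1 = 0 \/ m.1 = n%:Z) /\ (0 <= m.2 /\ m.2 < n%:Z)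
         else (m.2 = 0 \/ m.2 = n%:Z) /\ (0 <= m.1 /\ m.1 < n%:Z).
    by case: m mb => x y; case: vE => -> /=; rewrite /in_box /=; lia.
  case: m {mb} => x y /=; case: ifP => v10 [[] -> [y0 yn]].
  - by case: y y0 yn => // j _ jn; apply: (@inl _ 0%N j) => //; rewrite v10.
  - by case: y y0 yn => // j _ jn; apply: (@inl _ n j) => //; rewrite v10 eqxx orbT.
  - by case: x y0 yn => // j _ jn; apply: (@inl _ j 0%N) => //; rewrite v10.
  - by case: x y0 yn => // j _ jn; apply: (@inl _ j n) => //; rewrite v10 eqxx orbT.
pose g m := shift v (box n) m - sigma v t * box n m.
have gE m : g m = sigma (v - m) t * ((in_box n (m - v))%:R - (in_box n m)%:R).
  rewrite /g shiftE /box opprB sigmaD; do 2 case: in_box; rewrite /=; ring.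
apply: (@le_trans _ _ ((size l)%:R)%:E).
  apply: sqnorm_le_size => m; first by move=> /fl ml; rewrite -/(g m) gE ml subrr mulr0.
  rewrite -/(g m) gE normcM normc_sigma mul1r.
  by do 2 case: in_box; rewrite ?mulr0n ?mulr1n ?subrr ?subr0 ?sub0r ?normc0 ?normcN1 ?normc1 ?lexx ?ler01.
rewrite lee_fin sl natrM expr2 mulrA; apply: ler_wpM2r; first exact: ler0n.
rewrite mulrC -ler_pdivrMr //.
have /ltW h : 2 / e < (Num.bound (2 / e))%:R.
  by apply: archi_boundP; rewrite divr_ge0 // ltW.
by apply: le_trans h _; rewrite ler_nat.
Qed.

Lemma eigen_shift v : eigen (shift v) (sigma v t).
Proof.
have add u w : eigen (shift u) (sigma u t) -> eigen (shift w) (sigma w t) ->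
    eigen (shift (u + w)) (sigma (u + w) t).
  by move=> eu ew; rewrite shift_add sigmaD; exact: eigen_comp.
have zero : eigen (shift 0) (sigma 0 t).
  rewrite sigma0 (_ : shift 0 = id); first exact: eigen_id.
  by apply/funext => f; exact: convol_one.
have nat1 k : eigen (shift (k%:Z, 0)) (sigma (k%:Z, 0) t).
  elim: k => [|k IH] //; rewrite (_ : (_, _) = (1, 0) + (k%:Z, 0) :> weight); last by [].
  by apply: add => //; apply: eigen_shift_unit; left.
have nat2 k : eigen (shift (0, k%:Z)) (sigma (0, k%:Z) t).
  elim: k => [|k IH] //; rewrite (_ : (_, _) = (0, 1) + (0, k%:Z) :> weight); last by [].
  by apply: add => //; apply: eigen_shift_unit; right.
have int1 (a : int) : eigen (shift (a, 0)) (sigma (a, 0) t).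
  by case: a => k //; rewrite NegzE; have := eigen_shift_opp (nat1 k.+1).
have int2 (a : int) : eigen (shift (0, a)) (sigma (0, a) t).
  by case: a => k //; rewrite NegzE; have := eigen_shift_opp (nat2 k.+1).
case: v => a b; rewrite (_ : (a, b) = (a, 0) + (0, b) :> weight); first exact: add.
by rewrite /GRing.add /= /Algebra.add /=; congr pair; rewrite ?addr0 ?add0r.
Qed.

Lemma eigen_convol s : eigen (convol s) (trig s t).
Proof.
elim: s => [|[a v] s IH].
  have := eigen_lin (-1) eigen_id eigen_id; rewrite mulr1 addNr /trig big_nil.
  congr eigen; apply/funext => f; apply/funext => v.
  by rewrite /convol big_nil mulN1r addNr.
have := eigen_lin a (eigen_shift v) IH; rewrite trig_cons; congr eigen.
apply/funext => f; apply/funext => m.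
by rewrite shiftE [RHS]big_cons.
Qed.

End ApproximateEigenvectors.

(** * Uniqueness of approximate eigenvalues and stability under norm limits *)

Section GelfandCharacter.
Variables (R : realType) (t : plane R).
Implicit Types (v w : weight) (s r : seq (R[i] * weight)) (f g : vec R).
Implicit Types (T U : op R) (c : R[i]) (e : R) (n m : nat).

Lemma ler_all_eps (a b C : R) : 0 <= C -> (forall e, 0 < e -> a <= C * e + b) -> a <= b.
Proof.
move=> C0 h; rewrite leNgt; apply/negP => ba.
have p0 : 0 < C + 1 by rewrite ltr_wpDl.
have /h : 0 < (a - b) / (C + 1) by rewrite divr_gt0 // subr_gt0.
rewrite leNgt => /negP; apply.
rewrite -ltrBrDr mulrA ltr_pdivrMr // [ltRHS]mulrC ltr_pM2r ?subr_gt0 //.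
by rewrite ltrDl.
Qed.

Lemma sqnormZE c f : sqnorm (fun v => c * f v) = ((normc c ^+ 2)%:E * sqnorm f)%E.
Proof.
have [->|c0] := eqVneq c 0.
  by rewrite normc0 expr0n mul0e sqnorm0 // => v; rewrite mul0r.
apply/eqP; rewrite eq_le sqnormZ /=.
have nc : normc c != 0.
  by apply/eqP => /ComplexField.Normc.eq0_normc /eqP; rewrite (negPf c0).
have n2 : 0 < normc c ^+ 2 by rewrite exprn_gt0 // lt_neqAle eq_sym nc normc_ge0.
rewrite -lee_pdivlMl // -exprVn -ComplexField.Normc.normcV.
apply: le_trans (sqnormZ c^-1 _).
by rewrite (@eq_sqnorm _ _ f) // => v; rewrite mulKf.
Qed.

(** On a large box b, (c - c') b = - (T b - c b) + (U b - c' b) + (T b - U b). Applying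
    [sqnorm_lin_le] twice bounds the squared norm by (8 e + 2 K) n^2. The factor 2 is harmless, as
    estimates up to a constant are enough. *)
Lemma approx_dist T U c c' (K : R) : approx t T c -> approx t U c' ->
  (forall f x, is_l2 f -> (sqnorm f <= x%:E)%E ->
    (sqnorm (fun v => T f v - U f v)%R <= (K * x)%:E)%E) ->
  normc (c - c') ^+ 2 <= 2 * K.
Proof.
move=> Tc Uc' TU; apply: (@ler_all_eps _ _ 8) => // e e0.
have [N TN] := Tc _ e0; have [N' UN] := Uc' _ e0.
pose n := (maxn N N').+1.
have Nn : (N <= n)%N by rewrite leqW // leq_maxl.
have N'n : (N' <= n)%N by rewrite leqW // leq_maxr.
have n0 : 0 < n%:R ^+ 2 :> R by rewrite exprn_gt0.
rewrite -(ler_pM2r n0) -lee_fin EFinM -(sqnorm_box t) -sqnormZE.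
pose b := box t n.
rewrite (@eq_sqnorm _ _ (fun v => 1 * ((-1) * (T b v - c * b v) + (U b v - c' * b v))
    + (T b v - U b v))); last by move=> v; rewrite /b; ring.
have b2 := box_l2 t n.
apply: le_trans (sqnorm_lin_le 1 (sqnorm_lin_le (-1) (TN n Nn) (UN n N'n)) (TU b _ b2 _)) _.
  by rewrite sqnorm_box.
by rewrite normcN1 normc1 lee_fin; lra.
Qed.

Lemma approx_uniq T c c' : approx t T c -> approx t T c' -> c = c'.
Proof.
move=> Tc Tc'; apply/eqP; rewrite -subr_eq0; apply/eqP.
apply: ComplexField.Normc.eq0_normc; apply/eqP.
rewrite -sqrf_eq0 eq_le sqr_ge0 andbT -[leRHS](mulr0 2).
apply: (approx_dist Tc Tc') => f x _ _.
by rewrite sqnorm0 ?mul0r // => v; rewrite subrr.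
Qed.

(** By [approx_dist] the approximate eigenvalues form a Cauchy sequence, whose limit serves for [T].
    As [T] is a bare function tied to the sequence by norm convergence alone, its linearity and
    boundedness must pass to the limit too; linearity is tested at one site, where the modulus is
    dominated by the norm. *)
Lemma eigen_lim (T_ : nat -> op R) T : (forall n, exists c, eigen t (T_ n) c) ->
  (forall e : R, 0 < e -> exists N : nat, forall n, (N <= n)%N ->
       op_norm_le (fun f v => T_ n f v - T f v) e) ->
  exists c, eigen t T c.
Proof.
move=> /choice[c_ Tc] Tlim.
have lim2 e : 0 < e -> exists N, forall n, (N <= n)%N -> forall f x, is_l2 f ->
    (sqnorm f <= x%:E)%E -> (sqnorm (fun v => T_ n f v - T f v)%R <= (e * x)%:E)%E.
  move=> e0; have [|N TN] := Tlim (Num.sqrt e); first by rewrite sqrtr_gt0.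
  exists N => n /TN {}TN f x f2 fx; apply: le_trans (TN f f2) _.
  rewrite (sqr_sqrtr (ltW e0)) [leRHS]EFinM; apply: lee_pmul => //; rewrite ?sqnorm_ge0 //.
  by rewrite lee_fin ltW.
have cd e : 0 < e -> exists N, forall n m, (N <= n)%N -> (N <= m)%N ->
    normc (c_ n - c_ m) <= e.
  move=> e0; have [|N TN] := lim2 (e ^+ 2 / 8); first by rewrite divr_gt0 // exprn_gt0.
  exists N => n m Nn Nm.
  rewrite -(@ler_pXn2r _ 2) ?nnegrE ?normc_ge0 ?(ltW e0) //.
  have [[_ _ an] [_ _ am]] := (Tc n, Tc m).
  apply: le_trans (approx_dist (K := e ^+ 2 / 2) an am _) _; last by rewrite mulrCA divff // mulr1.
  move=> f x f2 fx.
  rewrite (@eq_sqnorm _ _ (fun v => (-1) * (T_ m f v - T f v) + (T_ n f v - T f v))); last first.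
    by move=> v; ring.
  apply: le_trans (sqnorm_lin_le _ (TN m Nm f x f2 fx) (TN n Nn f x f2 fx)) _.
  by rewrite normcN1 lee_fin; lra.
have realcvg (u : nat -> R) : (forall n m, `|u n - u m| <= normc (c_ n - c_ m)) ->
    exists l, forall e, 0 < e -> exists N, forall n, (N <= n)%N -> `|u n - l| <= e.
  move=> uc.
  have /cauchy_cvgP cu : cauchy (u @ \oo).
    apply: cauchy_exP => e e0; have [|N cN] := cd (e / 2); first by rewrite divr_gt0.
    exists (u N); exists N => // n /= Nn; rewrite /ball /=.
    apply: le_lt_trans (le_trans (uc _ _) (cN N n (leqnn _) Nn)) _.
    by rewrite ltr_pdivrMr // ltr_pMr // ltr1n.
  exists (lim (u @ \oo)) => e e0.
  have /cvgr_dist_le /(_ _ e0)[N _ uN] := cu.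
  by exists N => n /uN; rewrite distrC.
have [x xl] : exists l, forall e, 0 < e -> exists N, forall n, (N <= n)%N ->
    `|complex.Re (c_ n) - l| <= e.
  apply: realcvg => n m; apply: le_trans (normr_Re_le _).
  by case: (c_ n) (c_ m) => [? ?] [? ?].
have [y yl] : exists l, forall e, 0 < e -> exists N, forall n, (N <= n)%N ->
    `|complex.Im (c_ n) - l| <= e.
  apply: realcvg => n m; apply: le_trans (normr_Im_le _).
  by case: (c_ n) (c_ m) => [? ?] [? ?].
exists (x +i* y); split.
- move=> a f g f2 g2 v; apply/eqP; rewrite -subr_eq0; apply/eqP.
  apply: ComplexField.Normc.eq0_normc; apply/eqP.
  rewrite -sqrf_eq0 eq_le sqr_ge0 andbT.
  have [X X0 fX] := is_l2P f2; have [Y Y0 gY] := is_l2P g2.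
  pose h v := a * f v + g v.
  have h2 : is_l2 h := is_l2_lin a f2 g2; have [Z Z0 hZ] := is_l2P h2.
  apply: (@ler_all_eps _ _ (2 * (2 * (normc a ^+ 2 * X) + 2 * Y) + 2 * Z)).
    by have := mulr_ge0 (sqr_ge0 (normc a)) X0; lra.
  move=> e e0; have [N TN] := lim2 e e0.
  have [Tl _ _] := Tc N.
  pose E f v := T_ N f v - T f v.
  have Ef : (sqnorm (E f) <= (e * X)%:E)%E by apply: TN; rewrite ?fX.
  have Eg : (sqnorm (E g) <= (e * Y)%:E)%E by apply: TN; rewrite ?gY.
  have Eh : (sqnorm (E h) <= (e * Z)%:E)%E by apply: TN; rewrite ?hZ.
  rewrite -lee_fin.
  pose F w := 1 * (a * E f w + E g w) + (-1) * E h w.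
  rewrite (_ : T _ v - _ = F v); last first.
    by rewrite /F /E /h Tl //; ring.
  apply: le_trans (normc_le_sqnorm F v) _.
  have Eh' : (sqnorm (fun w => (-1) * E h w)%R <= (e * Z)%:E)%E.
    by rewrite sqnormZE normcN1 expr1n mul1e.
  apply: le_trans (sqnorm_lin_le 1 (sqnorm_lin_le a Ef Eg) Eh') _.
  by rewrite normc1 lee_fin; lra.
- have [N /(_ N (leqnn _)) TN] := lim2 1 ltr01; have [_ [K K0 TK] _] := Tc N.
  exists (2 * 1 + 2 * K); first by rewrite addr_ge0 // mulr_ge0.
  move=> f X f2 fX.
  rewrite (@eq_sqnorm _ _ (fun v => (-1) * (T_ N f v - T f v) + T_ N f v)); last first.
    by move=> v; ring.
  apply: le_trans (sqnorm_lin_le _ (TN f X f2 fX) (TK f X f2 fX)) _.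
  by rewrite normcN1 lee_fin; lra.
(* The bound e <= 1 turns a distance at most e into a square at most e; the three errors add up to
   12 e n^2, which is below d n^2. *)
- move=> d d0; pose e := Num.min 1 (d / 32).
  have e0 : 0 < e by rewrite lt_min ltr01 divr_gt0.
  have e1 : e <= 1 by rewrite ge_min lexx.
  have ed : 32 * e <= d.
    by rewrite mulrC -ler_pdivlMr // ge_min lexx orbT.
  have [N TN] := lim2 _ e0; have [N' xN] := xl _ e0; have [N'' yN] := yl _ e0.
  pose k := maxn N (maxn N' N'').
  have {}TN := TN k (leq_maxl _ _).
  have {}xN : `|complex.Re (c_ k) - x| <= e by apply: xN; rewrite /k; lia.
  have {}yN : `|complex.Im (c_ k) - y| <= e by apply: yN; rewrite /k; lia.
  have cN : normc (c_ k - (x +i* y)) ^+ 2 <= 2 * e.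
    rewrite sqr_normcE; case: (c_ k) xN yN => a b /= xN yN.
    have sq z : `|z| <= e -> z ^+ 2 <= e.
      move=> ze; rewrite -real_normK ?num_real // expr2.
      by apply: le_trans (ler_pM (normr_ge0 _) (normr_ge0 _) ze (le_trans ze e1)) _; rewrite mulr1.
    by have := sq _ xN; have := sq _ yN; lra.
  have [_ _ /(_ _ e0)[M TM]] := Tc k.
  exists M => n /TM {}TM.
  have b2 := box_l2 t n.
  have bn : (sqnorm (box t n) <= (n%:R ^+ 2)%:E)%E by rewrite sqnorm_box.
  pose b := box t n.
  rewrite (@eq_sqnorm _ _ (fun v => 1 * ((-1) * (T_ k b v - T b v) + (T_ k b v - c_ k * b v))
    + (c_ k - (x +i* y)) * b v)); last by move=> v; rewrite /b; ring.
  have cb : (sqnorm (fun v => (c_ k - (x +i* y)) * b v)%R <= (2 * e * n%:R ^+ 2)%:E)%E.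
    by rewrite sqnormZE sqnorm_box -EFinM lee_fin ler_wpM2r // sqr_ge0.
  apply: le_trans (sqnorm_lin_le 1 (sqnorm_lin_le (-1) (TN b _ b2 bn) TM) cb) _.
  rewrite normcN1 normc1 lee_fin.
  have := ler_wpM2r (sqr_ge0 (n%:R : R)) ed.
  have := sqr_ge0 (n%:R : R); have := mulr_ge0 (ltW e0) (sqr_ge0 (n%:R : R)); lra.
Qed.

End GelfandCharacter.

(** * The joint spectrum *)

Section JointSpectrum.
Variable R : realType.
Implicit Types (s r a b : seq (R[i] * weight)) (t : plane R).

Lemma Cstar_eigen a b t T : Cstar (convol a) (convol b) T -> exists c, eigen t T c.
Proof.
elim => {T}.
- by exists (trig a t); exact: eigen_convol.
- by rewrite adjoint_convol; exists (trig (tconj a) t); exact: eigen_convol.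
- by exists (trig b t); exact: eigen_convol.
- by rewrite adjoint_convol; exists (trig (tconj b) t); exact: eigen_convol.
- by exists 1; exact: eigen_id.
- by move=> c T U _ [x Tx] _ [y Uy]; exists (c * x + y); exact: eigen_lin.
- by move=> T U _ [x Tx] _ [y Uy]; exists (x * y); exact: eigen_comp.
- by move=> T_ T _ IH Tlim; exact: eigen_lim IH Tlim.
Qed.

(** On the C*-algebra [Cstar_eigen] and [approx_uniq] make this the evaluation at t, also for norm
    limits, which come without a symbol. *)
Definition eval_char t (T : op R) : R[i] := xget 0 [set c | approx t T c].

Lemma eval_charE t T c : eigen t T c -> eval_char t T = c.
Proof.
move=> [_ _ Tc]; apply: xget_unique => // c' Tc'.
exact: approx_uniq Tc' Tc.
Qed.

Lemma eval_char_gelfand a b t :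
  is_gelfand_character (Cstar (convol a) (convol b)) (eval_char t).
Proof.
split.
- exact/eval_charE/eigen_id.
- move=> c T U /(Cstar_eigen t)[x Tx] /(Cstar_eigen t)[y Uy].
  by rewrite (eval_charE Tx) (eval_charE Uy); apply/eval_charE/eigen_lin.
- move=> T U /(Cstar_eigen t)[x Tx] /(Cstar_eigen t)[y Uy].
  by rewrite (eval_charE Tx) (eval_charE Uy); apply/eval_charE/eigen_comp.
(* Comparison with the zero operator in [approx_dist] gives |x|^2 <= 2 K^2 <= (2 K)^2. *)
- exists 2 => T K /(Cstar_eigen t)[x Tx] K0 TK; rewrite (eval_charE Tx).
  rewrite -(@ler_pXn2r _ 2) ?nnegrE ?normc_ge0 ?mulr_ge0 //.
  have zero : approx t (fun _ _ => 0) 0.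
    move=> e e0; exists 0%N => n _; rewrite sqnorm0 => [|v]; last by rewrite mul0r subrr.
    by rewrite lee_fin mulr_ge0 ?sqr_ge0 // ltW.
  have [_ _ Ta] := Tx.
  have := approx_dist (K := K ^+ 2) Ta zero; rewrite subr0 => h.
  apply: le_trans (h _) _.
    move=> f y f2 fy; rewrite (@eq_sqnorm _ _ (T f)) => [|v]; last by rewrite subr0.
    apply: le_trans (TK f f2) _; rewrite [leRHS]EFinM; apply: lee_pmul => //.
      by rewrite lee_fin sqr_ge0.
    exact: sqnorm_ge0.
  by rewrite exprMn; have := sqr_ge0 K; lra.
Qed.

Lemma fracpart_shift t : exists n : weight, (`[0%R, 1%R] `*` `[0%R, 1%R]) (affine_act 1%:M n t).
Proof.
exists (- Num.floor (t.1 : R), - Num.floor (t.2 : R)).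
have fl (x : R) : 0 <= 1%:~R * x + 0%:~R * x + (- Num.floor x)%:~R <= 1.
  rewrite mulrNz.
  have h1 := floor_le_tmp x; have h2 := floorD1_gt x.
  by move: h2; rewrite intrD; lra.
split; rewrite /= in_itv /act /= !mxE /=.
  by have := fl (t.1 : R); rewrite !mul0r.
by have := fl (t.2 : R); rewrite !mul0r addr0 add0r.
Qed.

(** By periodicity, a minimum over the compact unit square is a minimum over the whole plane. *)
Lemma trig_min s : (forall t, 0 < complex.Re (trig s t)) ->
  exists2 d : R, 0 < d & forall t, d <= complex.Re (trig s t).
Proof.
move=> s0.
have K0 : compact (`[0%R, 1%R] `*` `[0%R, 1%R] : set (R * R)).
  by apply: compact_setX; exact: segment_compact.
have [||c _ cmin] := @compact_EVT_min (R * R)%type R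
   (fun t => complex.Re (trig s t)) (`[0%R, 1%R] `*` `[0%R, 1%R]) _ K0 _.
- by exists (0, 0); split; rewrite /= in_itv /= lexx ler01.
- by apply: continuous_subspaceT; exact: (continuous_trig s).1.
exists (complex.Re (trig s c)) => // t; have [n tn] := fracpart_shift t.
by rewrite -(trig_periodic s n t); apply: cmin; rewrite inE.
Qed.

(* The Laurent polynomial with value |trig a t - x|^2 + |trig b t - y|^2. *)
Definition tdist a b (x y : R[i]) : seq (R[i] * weight) :=
  tscale 1 (tmul (tscale (- x^*) (tone R) ++ tconj a) (tscale (- x) (tone R) ++ a))
   ++ tmul (tscale (- y^*) (tone R) ++ tconj b) (tscale (- y) (tone R) ++ b).

Lemma tdistE a b x y t : trig (tdist a b x y) t =
  (normc (trig a t - x) ^+ 2 + normc (trig b t - y) ^+ 2)%:C.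
Proof.
rewrite rmorphD /= !sqr_normc /tdist !(trig_cat, trig_scale, trig_mul, trig_one, trig_conj).
by rewrite !rmorphB /=; ring.
Qed.

Lemma tdist_gt0 a b x y : (forall t, ~ (x = trig a t /\ y = trig b t)) ->
  exists2 d : R, 0 < d & forall t, d <= normc (trig a t - x) ^+ 2 + normc (trig b t - y) ^+ 2.
Proof.
move=> noz; have [t|d d0 dD] := @trig_min (tdist a b x y).
  rewrite tdistE /= lt_neqAle addr_ge0 ?sqr_ge0 // andbT eq_sym paddr_eq0 ?sqr_ge0 //.
  rewrite !sqrf_eq0; apply/negP => /andP[/eqP e1 /eqP e2]; apply: (noz t).
  by rewrite -[trig a t](subrK x) -[trig b t](subrK y)
     (ComplexField.Normc.eq0_normc e1) (ComplexField.Normc.eq0_normc e2) !add0r.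
by exists d => // t; have := dD t; rewrite tdistE.
Qed.

Lemma joint_spectrum_convol a b :
  joint_spectrum (convol a) (convol b) =
  [set z | exists t, xcoord z = trig a t /\ ycoord z = trig b t].
Proof.
apply/seteqP; split => z; last first.
  move=> [t [xE yE]]; exists (eval_char t); split; first exact: eval_char_gelfand.
    by rewrite xE; exact/eval_charE/eigen_convol.
  by rewrite yE; exact/eval_charE/eigen_convol.
move=> [psi [[psi1 psil psim [M psiM]] psia psib]]; apply: contrapT => noz.
set x := xcoord z in psia noz; set y := ycoord z in psib noz.
pose C := Cstar (convol a) (convol b).
pose good s c := C (convol s) /\ psi (convol s) = c.
have good_lin k s r c c' : good s c -> good r c' -> good (tscale k s ++ r) (k * c + c').
  move=> [Cs <-] [Cr <-]; rewrite /good -psil //.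
  have -> : convol (tscale k s ++ r) = (fun f v => k * convol s f v + convol r f v).
    by apply/funext => f; apply/funext => v; rewrite convol_cat convol_scale.
  by split => //; exact: Cstar_lin.
have good_mul s r c c' : good s c -> good r c' -> good (tmul s r) (c * c').
  move=> [Cs <-] [Cr <-]; rewrite /good -psim //.
  have -> : convol (tmul s r) = convol s \o convol r by apply/funext => f; rewrite convol_mul.
  by split => //; exact: Cstar_mul.
have good1 : good (tone R) 1.
  rewrite /good (_ : convol (tone R) = id); first by split => //; exact: Cstar_one.
  by apply/funext => f; exact: convol_one.
have gooda : good a x by split => //; exact: Cstar_A.
have goodb : good b y by split => //; exact: Cstar_B.
(* A Gelfand character is not assumed to respect adjoints, so its values at the adjoints stay
   unknown. In [goodD] they only occur in factors multiplied by - x + x or - y + y. *)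
have [x' gooda'] : exists c, good (tconj a) c.
  by rewrite /good -adjoint_convol; eexists; split => //; exact: Cstar_A'.
have [y' goodb'] : exists c, good (tconj b) c.
  by rewrite /good -adjoint_convol; eexists; split => //; exact: Cstar_B'.
pose D := tdist a b x y.
have goodD : good D 0.
  (* This spelling of 0, like the scaling by 1 in [tdist], follows the shapes of [good_lin] and
     [good_mul]. *)
  rewrite -[0](_ : 1 * ((- x^* * 1 + x') * (- x * 1 + x)) + (- y^* * 1 + y') * (- y * 1 + y) = 0).
    by apply: (good_lin); apply: (good_mul); apply: (good_lin).
  by rewrite !mulr1 !addNr !mulr0 addr0.
have DE t : trig D t = (normc (trig a t - x) ^+ 2 + normc (trig b t - y) ^+ 2)%:C := tdistE a b x y t.
have [d d0 dD] : exists2 d : R, 0 < d & forall t, d <= complex.Re (trig D t).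
  have [t tz|d d0 dE] := @tdist_gt0 a b x y; first by apply: noz; exists t.
  by exists d => // t; rewrite DE; exact: dE.
have Dpos t : 0 < complex.Re (trig D t) := lt_le_trans d0 (dD t).
pose K := tnorm D + 1.
have DK t : complex.Re (trig D t) <= K.
  apply: le_trans (ler_norm _) (le_trans (normr_Re_le _) (le_trans (trig_le _ _) _)).
  by rewrite /K lerDl.
have K0 : 0 < K by apply: lt_le_trans (Dpos (0, 0)) (DK _).
pose E := tscale (- (K^-1)%:C) D ++ tone R.
have goodE : good E 1.
  have := good_lin (- (K^-1)%:C) _ _ _ _ goodD good1; rewrite mulr0 add0r; exact.
pose q := 1 - d / K.
have q0 : 0 <= q.
  by rewrite subr_ge0 ler_pdivrMr // mul1r; apply: le_trans (dD (0, 0)) (DK _).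
have q1 : `|q| < 1 by rewrite ger0_norm // ltrBlDr ltrDl divr_gt0.
have Eq t : normc (trig E t) <= q.
  rewrite /E trig_cat trig_scale trig_one DE.
  rewrite (_ : _ + 1 = (1 - (normc (trig a t - x) ^+ 2 + normc (trig b t - y) ^+ 2) / K)%:C); last first.
    by rewrite rmorphB rmorphM /= rmorph1; ring.
  have h1 := dD t; have h2 := DK t; rewrite DE /= in h1 h2.
  rewrite /normc /= expr0n addr0 sqrtr_sqr ger0_norm; last first.
    by rewrite subr_ge0 ler_pdivrMr // mul1r.
  by rewrite lerD2l lerN2 ler_pM2r ?invr_gt0.
(* The bound [M] of the character may exceed 1, so the norm of E alone gives no contradiction and
   all its powers are needed. *)
pose En n := iter n (tmul E) (tone R).
have goodEn n : good (En n) 1.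
  elim: n => [|n IH] //; rewrite (_ : En n.+1 = tmul E (En n)) //.
  by have := good_mul _ _ _ _ goodE IH; rewrite mulr1.
have Enq n t : normc (trig (En n) t) <= q ^+ n.
  elim: n => [|n IH]; first by rewrite trig_one normc1 expr0.
  rewrite (_ : En n.+1 = tmul E (En n)) // trig_mul normcM exprS.
  by apply: ler_pM => //; exact: normc_ge0.
have Mq n : 1 <= M * q ^+ n.
  have [CE E1] := goodEn n.
  have := psiM _ _ CE (exprn_ge0 n q0) (op_norm_convol (Enq n)).
  by rewrite E1 normc1.
have : M * q ^+ n @[n --> \oo] --> M * 0 by apply: cvgMr; exact: cvg_expr.
rewrite mulr0 => /cvgr_dist_lt /(_ 1 ltr01)[N _ /(_ N (leqnn _))].
rewrite /= sub0r normrN => h.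
by have := Mq N; rewrite leNgt (le_lt_trans (ler_norm _) h).
Qed.

End JointSpectrum.

(** * Measurability of the spectrum *)

Section ComplexMeasurable.
Variables (R : realType) (d : measure_display) (T : measurableType d).
Implicit Types (f g : T -> R[i]).

Definition cmeasurable f :=
  measurable_fun setT (fun z => complex.Re (f z)) /\
  measurable_fun setT (fun z => complex.Im (f z)).

Lemma cmeasurable_cst (c : R[i]) : cmeasurable (fun=> c).
Proof. by split; exact: measurable_cst. Qed.

Lemma cmeasurableM f g : cmeasurable f -> cmeasurable g -> cmeasurable (fun z => f z * g z).
Proof.
move=> [f1 f2] [g1 g2]; split.
- rewrite (_ : (fun z => _) = (fun z => complex.Re (f z) * complex.Re (g z) -
      complex.Im (f z) * complex.Im (g z))); last first.
    by apply/funext => z; case: (f z) (g z) => [? ?] [? ?].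
  by apply: measurable_funB; apply: measurable_funM.
- rewrite (_ : (fun z => _) = (fun z => complex.Re (f z) * complex.Im (g z) +
      complex.Im (f z) * complex.Re (g z))); last first.
    by apply/funext => z; case: (f z) (g z) => [? ?] [? ?].
  by apply: measurable_funD; apply: measurable_funM.
Qed.

Lemma cmeasurableX f n : cmeasurable f -> cmeasurable (fun z => f z ^+ n).
Proof.
move=> mf; elim: n => [|n IH]; first exact: cmeasurable_cst.
by under eq_fun do rewrite exprS; exact: cmeasurableM.
Qed.

Lemma cmeasurable_conj f : cmeasurable f -> cmeasurable (fun z => (f z)^*).
Proof.
move=> [f1 f2]; split.
  by rewrite (_ : (fun z => _) = (fun z => complex.Re (f z))) //; apply/funext => z; case: (f z).
rewrite (_ : (fun z => _) = (fun z => - complex.Im (f z))); first exact: measurable_funN.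
by apply/funext => z; case: (f z).
Qed.

End ComplexMeasurable.

Section Coordinates.
Variable R : realType.
Implicit Types (z : C2 R).

Definition mono (m1 n1 m2 n2 : nat) z : R[i] :=
  xcoord z ^+ m1 * (xcoord z)^* ^+ n1 * ycoord z ^+ m2 * (ycoord z)^* ^+ n2.

Lemma measurable_coord11 : measurable_fun setT (fun z : C2 R => z.1.1 : R).
Proof. exact: (measurableT_comp measurable_fst measurable_fst). Qed.
Lemma measurable_coord12 : measurable_fun setT (fun z : C2 R => z.1.2 : R).
Proof. exact: (measurableT_comp measurable_snd measurable_fst). Qed.
Lemma measurable_coord21 : measurable_fun setT (fun z : C2 R => z.2.1 : R).
Proof. exact: (measurableT_comp measurable_fst measurable_snd). Qed.
Lemma measurable_coord22 : measurable_fun setT (fun z : C2 R => z.2.2 : R).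
Proof. exact: (measurableT_comp measurable_snd measurable_snd). Qed.

Lemma cmeasurable_mono m1 n1 m2 n2 : cmeasurable (mono m1 n1 m2 n2).
Proof.
have mx : cmeasurable (@xcoord R) by split; [exact: measurable_coord11|exact: measurable_coord12].
have my : cmeasurable (@ycoord R) by split; [exact: measurable_coord21|exact: measurable_coord22].
exact: (cmeasurableM (cmeasurableM (cmeasurableM (cmeasurableX m1 mx)
  (cmeasurableX n1 (cmeasurable_conj mx))) (cmeasurableX m2 my))
  (cmeasurableX n2 (cmeasurable_conj my))).
Qed.

End Coordinates.

Section SpectralMeasure.
Variables (R : realType) (a b : seq (R[i] * weight)).
Local Notation Q := (@unit_square R).
Implicit Types (t : plane R) (z : C2 R).

Definition tmap t : C2 R :=
  ((complex.Re (trig a t), complex.Im (trig a t)), (complex.Re (trig b t), complex.Im (trig b t))).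

Lemma xcoord_tmap t : xcoord (tmap t) = trig a t.
Proof. by rewrite /xcoord /tmap /=; case: (trig a t). Qed.

Lemma ycoord_tmap t : ycoord (tmap t) = trig b t.
Proof. by rewrite /ycoord /tmap /=; case: (trig b t). Qed.

Lemma joint_spectrum_range : joint_spectrum (convol a) (convol b) = range tmap.
Proof.
rewrite joint_spectrum_convol; apply/seteqP; split => z /=.
  case: z => [[x x'] [y y']] [t [ex ey]]; exists t => //.
  by rewrite /tmap -ex -ey.
by move=> [t _ <-]; exists t; rewrite xcoord_tmap ycoord_tmap.
Qed.

Lemma measurable_tmap : measurable_fun setT tmap.
Proof.
have [a1 a2] := measurable_trig a; have [b1 b2] := measurable_trig b.
by apply: measurable_fun_pair; apply: measurable_fun_pair.
Qed.

Definition tdist2 t z : R :=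
  normc (trig a t - xcoord z) ^+ 2 + normc (trig b t - ycoord z) ^+ 2.

Lemma measurable_tdist2 t : measurable_fun setT (tdist2 t).
Proof.
rewrite (_ : tdist2 t = (fun z => (complex.Re (trig a t) - z.1.1) ^+ 2 +
   (complex.Im (trig a t) - z.1.2) ^+ 2 + ((complex.Re (trig b t) - z.2.1) ^+ 2 +
   (complex.Im (trig b t) - z.2.2) ^+ 2))); last first.
  by apply/funext => z; rewrite /tdist2 !sqr_normcE; case: (trig a t) (trig b t) => [? ?] [? ?].
apply: measurable_funD; apply: measurable_funD; apply: measurable_funX; apply: measurable_funB => //.
- exact: measurable_coord11.
- exact: measurable_coord12.
- exact: measurable_coord21.
- exact: measurable_coord22.
Qed.

Definition ratpt (q : rat * rat) : plane R := (ratr q.1, ratr q.2).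

Lemma rat_near t0 (e : R) : 0 < e -> exists q, tdist2 (ratpt q) (tmap t0) < e.
Proof.
move=> e0; pose h := tdist a b (trig a t0) (trig b t0).
have hE t : complex.Re (trig h t) = tdist2 t (tmap t0).
  by rewrite tdistE /tdist2 xcoord_tmap ycoord_tmap.
have h0 : complex.Re (trig h t0) = 0.
  by rewrite tdistE /= !subrr normc0 expr0n addr0.
have [ch _] := continuous_trig h.
have /cvgr_dist_lt /(_ e e0) := ch t0.
rewrite h0 => -[[A B] /= [/nbhs_ballP[d1 d10 A1] /nbhs_ballP[d2 d20 B2]] AB].
have [q1 q1E] := rat_in_itvoo (ltr_pwDl d10 (lexx (t0.1 : R))).
have [q2 q2E] := rat_in_itvoo (ltr_pwDl d20 (lexx (t0.2 : R))).
exists (q1, q2); have := AB (ratpt (q1, q2)).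
rewrite /= sub0r normrN -hE => /(_ _)/(le_lt_trans (ler_norm _)); apply; split => /=.
  apply: A1; rewrite /ball /= distrC ltr_norml.
  by move: q1E; rewrite in_itv /=; lra.
apply: B2; rewrite /ball /= distrC ltr_norml.
by move: q2E; rewrite in_itv /=; lra.
Qed.

(** A point off the range keeps a positive distance from it by compactness, and by continuity
    rational parameters suffice to detect a smaller distance. The countable description makes the
    spectrum a Borel set. *)
Lemma range_tmapC : ~` range tmap =
  \bigcup_k \bigcap_(q in [set: rat * rat]) [set z | k.+1%:R^-1 <= tdist2 (ratpt q) z].
Proof.
apply/seteqP; split => z.
  move=> zr; have [t|d d0 dE] := @tdist_gt0 R a b (xcoord z) (ycoord z).
    move=> [ex ey]; apply: zr; exists t => //.
    by rewrite /tmap -ex -ey; case: z {ex ey} => [[? ?] [? ?]].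
  exists (Num.bound d^-1) => // q _ /=; apply: le_trans (dE _).
  rewrite -[leRHS]invrK lef_pV2 ?posrE ?invr_gt0 //.
  apply: le_trans (ltW (archi_boundP _)) _; first by rewrite invr_ge0 ltW.
  by rewrite ler_nat.
move=> [k _ kz] [t _ tz]; have [|q] := @rat_near t k.+1%:R^-1.
  by rewrite invr_gt0 ltr0n.
by rewrite tz ltNge (kz q).
Qed.

Lemma measurable_range_tmap : measurable (range tmap).
Proof.
rewrite -[range _]setCK range_tmapC; apply: measurableC; apply: bigcupT_measurable => k.
rewrite bigcap_mkcond; under eq_bigcapr do rewrite in_setT.
rewrite -[X in measurable X]setCK setC_bigcap; apply: measurableC.
apply: countable_bigcupT_measurable => // q; apply: measurableC.
rewrite (_ : [set z | _] = setT `&` tdist2 (ratpt q) @^-1` `[k.+1%:R^-1, +oo[%classic).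
  by apply: measurable_tdist2 => //; exact: measurable_itv.
by rewrite setTI; apply/seteqP; split => z /=; rewrite in_itv /= andbT.
Qed.

End SpectralMeasure.

(** * The image of the Haar measure *)

Section TorusProbability.
Variable R : realType.

Definition torus_measure : set (plane R) -> \bar R :=
  mrestr (leb2 R) (@measurable_unit_square R).
HB.instance Definition _ := Measure.on torus_measure.

Lemma torus_measure_setT : torus_measure setT = 1%E.
Proof. by rewrite /torus_measure /mrestr setTI; exact: leb2_unit_square. Qed.

HB.instance Definition _ := Measure_isProbability.Build _ _ _ torus_measure torus_measure_setT.

Lemma integral_torus (f : plane R -> R) (K : R) : measurable_fun setT f ->
  (forall t, `|f t| <= K) ->
  Rintegral torus_measure setT f = Rintegral (leb2 R) (@unit_square R) f.
Proof.
move=> mf fK; have mQ := @measurable_unit_square R.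
have mQC : measurable (~` @unit_square R) by exact: measurableC.
have mfT : (torus_measure).-integrable setT (EFin \o f).
  apply: measurable_bounded_integrable => //.
    by rewrite [X in (X < _)%E]torus_measure_setT ltry.
  exists K; split; first exact: num_real.
  by move=> x Kx t _ /=; apply: le_trans (fK t) (ltW Kx).
have QC0 : torus_measure (~` @unit_square R) = 0%E.
  by rewrite /torus_measure /mrestr setICl measure0.
have restr : (\int[torus_measure]_(x in @unit_square R) (f x)%:E =
    \int[leb2 R]_(x in @unit_square R) (f x)%:E)%E.
  apply: eq_measure_integral => A mA AQ.
  have AE : torus_measure A = leb2 R A by rewrite /torus_measure /mrestr setIidl.
  exact: AE.
have h := @negligible_integral _ _ _ torus_measure setT _ _ mQC measurableT mfT QC0.
rewrite setDE setCK setTI in h.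
by rewrite /Rintegral -restr -h.
Qed.

End TorusProbability.

Section SpectralMeasure.
Variables (R : realType) (a b : seq (R[i] * weight)).
Local Notation Q := (@unit_square R).
Implicit Types (t : plane R) (z : C2 R).

HB.instance Definition _ := isMeasurableFun.Build _ _ _ _ (tmap a b) (measurable_tmap a b).

Definition spectral_measure : probability (C2 R) R :=
  distribution (@torus_measure R) (tmap a b).

Lemma spectral_measureE B : spectral_measure B = leb2 R (tmap a b @^-1` B `&` Q).
Proof. by []. Qed.

Lemma Rintegral_spectral (f : C2 R -> R) (g : plane R -> R) (K : R) :
  measurable_fun setT f -> (forall t, f (tmap a b t) = g t) -> (forall t, `|g t| <= K) ->
  Rintegral spectral_measure (range (tmap a b)) f = Rintegral (leb2 R) Q g.
Proof.
move=> mf fg gK.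
have mg : measurable_fun setT g.
  rewrite (_ : g = f \o tmap a b); last by apply/funext => t; rewrite /= fg.
  exact: measurableT_comp mf (measurable_tmap a b).
have mR := measurable_range_tmap a b.
have mf' : measurable_fun setT (EFin \o f) by exact/measurable_EFinP.
have gE : (EFin \o f) \o tmap a b = EFin \o g by apply/funext => t /=; rewrite fg.
have ig : (@torus_measure R).-integrable (tmap a b @^-1` range (tmap a b)) ((EFin \o f) \o tmap a b).
  rewrite preimage_range gE; apply: measurable_bounded_integrable => //.
    by rewrite [X in (X < _)%E]torus_measure_setT ltry.
  exists K; split; first exact: num_real.
  by move=> x Kx t _ /=; apply: le_trans (gK t) (ltW Kx).
have h := integral_pushforward (measurable_tmap a b) mf' ig mR.
rewrite preimage_range gE in h.
by rewrite -(integral_torus mg gK) /Rintegral -h.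
Qed.

Definition tpow s n : seq (R[i] * weight) := iter n (tmul s) (tone R).

Lemma trig_pow s n t : trig (tpow s n) t = trig s t ^+ n.
Proof.
elim: n => [|n IH]; first by rewrite trig_one expr0.
by rewrite (_ : tpow s n.+1 = tmul s (tpow s n)) // trig_mul IH exprS.
Qed.

Lemma iter_convol s n f : iter n (convol s) f = convol (tpow s n) f.
Proof.
elim: n => [|n IH]; first by rewrite convol_one.
by rewrite (_ : tpow s n.+1 = tmul s (tpow s n)) // convol_mul -IH.
Qed.

Definition tmono m1 n1 m2 n2 : seq (R[i] * weight) :=
  tmul (tpow a m1) (tmul (tpow (tconj a) n1) (tmul (tpow b m2) (tpow (tconj b) n2))).

Lemma trig_mono m1 n1 m2 n2 t :
  trig (tmono m1 n1 m2 n2) t = mono m1 n1 m2 n2 (tmap a b t).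
Proof.
by rewrite /tmono !trig_mul !trig_pow !trig_conj /mono xcoord_tmap ycoord_tmap !mulrA.
Qed.

Lemma momentE m1 n1 m2 n2 :
  moment (convol a) (convol b) m1 n1 m2 n2 = cint (leb2 R) Q (trig (tmono m1 n1 m2 n2)).
Proof.
rewrite /moment !adjoint_convol !iter_convol -!convol_mul tint_trig /inner.
rewrite (@csum_seq _ _ [:: 0]) //.
  have b00 : basis R (0 : weight) 0 = 1 by rewrite /basis eqxx.
  by rewrite big_seq1 b00 rmorph1 mulr1 /tmono !convol_mul.
by move=> v; rewrite inE /basis => /negPf ->; rewrite rmorph0 mulr0.
Qed.

Lemma spectral_measure_joint :
  is_joint_spectral_measure (convol a) (convol b) spectral_measure.
Proof.
split.
  rewrite joint_spectrum_range; exists (~` range (tmap a b)); split => //.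
    by apply: measurableC; exact: measurable_range_tmap.
  rewrite spectral_measureE.
  have -> : tmap a b @^-1` (~` range (tmap a b)) = set0.
    by apply/seteqP; split => t //=; apply; exists t.
  by rewrite set0I measure0.
move=> m1 n1 m2 n2; rewrite momentE joint_spectrum_range /cint /cintegral.
have [mr mi] := cmeasurable_mono R m1 n1 m2 n2.
pose s := tmono m1 n1 m2 n2.
congr (_ +i* _); apply/esym.
  apply: (Rintegral_spectral (K := tnorm s) mr) => t; first by rewrite trig_mono.
  exact: le_trans (normr_Re_le _) (trig_le _ _).
apply: (Rintegral_spectral (K := tnorm s) mi) => t; first by rewrite trig_mono.
exact: le_trans (normr_Im_le _) (trig_le _ _).
Qed.

End SpectralMeasure.

(** * A polynomial approximation of the indicator of a half-line *)

Section StepPolynomials.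
Variable R : realType.
Implicit Types (u x : R) (n N : nat).

(* The first factor tends to 1 for u < 1/2 and to 0 for u > 1/2, as in the proof
   of the Stone-Weierstrass theorem by Brosowski and Deutsch; the second one
   forces the limit 0 at u = 1/2. *)
Definition step_poly n u : R :=
  (1 - u ^+ n) ^+ (2 ^ n) * (1 - (1 - (u - 2^-1) ^+ 2) ^+ n).

Lemma bernoulli x N : 0 <= x -> x <= 1 -> 1 - N%:R * x <= (1 - x) ^+ N.
Proof.
move=> x0 x1; elim: N => [|N IH]; first by rewrite mul0r subr0 expr0.
rewrite exprS; have h : 0 <= 1 - x by rewrite subr_ge0.
apply: le_trans (ler_wpM2l h IH).
have : 0 <= N%:R * (x * x) by rewrite !mulr_ge0.
by rewrite mulrSr; lra.
Qed.

(** Bernoulli's inequality gives N x <= (1 + x)^N, and (1 - x) (1 + x) <= 1. *)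
Lemma bernoulli_inv x N : 0 <= x -> x <= 1 -> (1 - x) ^+ N * (N%:R * x) <= 1.
Proof.
move=> x0 x1.
have bern : N%:R * x <= (1 + x) ^+ N.
  suff : 1 + N%:R * x <= (1 + x) ^+ N by lra.
  elim: N => [|N IH]; first by rewrite mul0r addr0 expr0.
  rewrite exprS; have h : 0 <= 1 + x by rewrite addr_ge0.
  apply: le_trans (ler_wpM2l h IH).
  have : 0 <= N%:R * (x * x) by rewrite !mulr_ge0.
  by rewrite mulrSr; lra.
apply: le_trans (ler_wpM2l _ bern) _; first by rewrite exprn_ge0 // subr_ge0.
have xx := mulr_ge0 x0 x0.
have xx1 : x * x <= 1 by rewrite mulr_ile1.
by rewrite -exprMn exprn_ile1 //; lra.
Qed.

Lemma half_dist_sqr u : 0 <= u -> u <= 1 -> 0 <= 1 - (u - 2^-1) ^+ 2.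
Proof.
move=> u0 u1; have : 0 <= u * (1 - u) by rewrite mulr_ge0 // subr_ge0.
by rewrite expr2; lra.
Qed.

Lemma step_poly01 n u : 0 <= u -> u <= 1 -> 0 <= step_poly n u <= 1.
Proof.
move=> u0 u1.
have un : 0 <= u ^+ n <= 1 by rewrite exprn_ge0 // exprn_ile1.
have v : 0 <= 1 - (u - 2^-1) ^+ 2 <= 1.
  by rewrite half_dist_sqr // gerBl sqr_ge0.
move: v; set w := 1 - (u - _) ^+ 2; move=> /andP[w0 w1].
have wn : 0 <= w ^+ n <= 1 by rewrite exprn_ge0 // exprn_ile1.
case/andP: un => un0 un1; case/andP: wn => wn0 wn1.
have p0 : 0 <= 1 - u ^+ n by rewrite subr_ge0.
have p1 : 1 - u ^+ n <= 1 by rewrite gerBl.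
rewrite /step_poly mulr_ge0 ?exprn_ge0 ?subr_ge0 //=.
by rewrite mulr_ile1 ?exprn_ge0 ?exprn_ile1 ?subr_ge0 // gerBl.
Qed.

(** With x = u^n and N = 2^n one has N x = (2 u)^n. For u < 1/2 this tends to 0 and [bernoulli]
    pushes the first factor to 1; for u > 1/2 it tends to infinity and [bernoulli_inv] pushes the
    first factor to 0. *)
Lemma step_poly_cvg u : 0 <= u -> u <= 1 ->
  step_poly n u @[n --> \oo] --> ((u < 2^-1)%R%:R : R).
Proof.
move=> u0 u1.
have pow0 x : 0 <= x -> x < 1 -> (fun n => x ^+ n) @ \oo --> (0 : R).
  by move=> x0 x1; apply: cvg_expr; rewrite ger0_norm.
have un n : 0 <= u ^+ n <= 1 by rewrite exprn_ge0 // exprn_ile1.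
have p01 n : 0 <= (1 - u ^+ n) ^+ (2 ^ n) <= 1.
  case/andP: (un n) => un0 un1.
  by rewrite exprn_ge0 ?subr_ge0 // exprn_ile1 ?subr_ge0 ?gerBl.
have [eu|nu] := eqVneq u 2^-1.
  rewrite eu ltxx; apply: (@cvg_trans _ ((fun=> 0 : R) @ \oo)); last exact: cvg_cst.
  apply: near_eq_cvg; apply: nearW => n.
  by rewrite /step_poly subrr expr0n subr0 expr1n subrr mulr0.
have w0 := half_dist_sqr u0 u1.
have w1 : 1 - (u - 2^-1) ^+ 2 < 1.
  by rewrite gtrBl lt_neqAle sqr_ge0 andbT eq_sym sqrf_eq0 subr_eq0.
have second : (fun n => 1 - (1 - (u - 2^-1) ^+ 2) ^+ n) @ \oo --> (1 : R).
  rewrite -[X in _ --> X]subr0; apply: cvgB; first exact: cvg_cst.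
  exact: pow0.
have first : (fun n => (1 - u ^+ n) ^+ (2 ^ n)) @ \oo --> ((u < 2^-1)%R%:R : R).
  case: ltgtP nu => // ul _.
    apply: (@squeeze_cvgr _ _ _ _ (fun n => 1 - (2 * u) ^+ n) (fun=> 1)).
    - apply: nearW => n; have /andP[un0 un1] := un n; have /andP[_ ->] := p01 n.
      rewrite andbT; apply: le_trans (bernoulli (2 ^ n) un0 un1).
      by rewrite natrX exprMn.
    - rewrite -[X in _ --> X]subr0; apply: cvgB; first exact: cvg_cst.
      by apply: pow0; lra.
    - exact: cvg_cst.
  apply: (@squeeze_cvgr _ _ _ _ (fun=> 0) (fun n => (2 * u)^-1 ^+ n)).
  - apply: nearW => n; have /andP[un0 un1] := un n; have /andP[-> _] := p01 n.
    have := bernoulli_inv (2 ^ n) un0 un1; rewrite natrX -exprMn => h.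
    have pp : 0 < (2 * u) ^+ n by rewrite exprn_gt0 //; lra.
    by rewrite exprVn -[leRHS]mul1r ler_pdivlMr.
  - exact: cvg_cst.
  - apply: pow0; first by rewrite invr_ge0; lra.
    by rewrite invf_lt1; lra.
have := cvgM first second; rewrite mulr1; exact.
Qed.

End StepPolynomials.

(** * Generators of a product sigma-algebra *)

Section BoxGenerators.

(** The sequences [g1] and [g2] exhaust the factors, so a strip over a generator is a countable
    union of generating rectangles; strips over all measurable sets follow, and a rectangle is the
    intersection of two strips. *)
Lemma measurable_prod_gen (d1 d2 : measure_display) (T1 : measurableType d1)
    (T2 : measurableType d2) (G1 : set (set T1)) (G2 : set (set T2))
    (g1 : nat -> set T1) (g2 : nat -> set T2) :
  @measurable d1 T1 = <<s G1 >> -> @measurable d2 T2 = <<s G2 >> ->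
  (forall k, G1 (g1 k)) -> (forall k, G2 (g2 k)) ->
  \bigcup_k g1 k = setT -> \bigcup_k g2 k = setT ->
  @measurable _ (T1 * T2)%type = <<s [set A `*` B | A in G1 & B in G2] >>.
Proof.
move=> m1 m2 Gg1 Gg2 c1 c2; set G := [set _ `*` _ | _ in _ & _ in _].
have [sG0 sGC sGU] := smallest_sigma_algebra [set: T1 * T2] G.
apply/seteqP; split; last first.
  apply: smallest_sub; first exact: sigma_algebra_measurable.
  move=> _ [A GA [B GB <-]]; apply: measurableX.
    by rewrite m1; exact: sub_sigma_algebra.
  by rewrite m2; exact: sub_sigma_algebra.
have left (A : set T1) : measurable A -> <<s G >> (A `*` setT).
  rewrite m1; apply: (@smallest_sub _ (sigma_algebra setT) G1 [set A | <<s G >> (A `*` setT)]).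
    split => /=; first by rewrite set0X.
      move=> B sB; rewrite (_ : _ `*` _ = setT `\` (B `*` setT)); first exact: sGC.
      by apply/seteqP; split => -[x y] /=; tauto.
    move=> F sF; rewrite (_ : _ `*` _ = \bigcup_k (F k `*` setT)); first exact: sGU.
    apply/seteqP; split => -[x y] /=.
      by move=> [[k _ Fx] _]; exists k.
    by move=> [k _ [Fx _]]; split => //; exists k.
  move=> B GB /=; rewrite (_ : B `*` setT = \bigcup_k (B `*` g2 k)).
    by apply: sGU => k; apply: sub_sigma_algebra; exists B => //; exists (g2 k).
  by rewrite -setX_bigcupr c2.
have right (B : set T2) : measurable B -> <<s G >> (setT `*` B).
  rewrite m2; apply: (@smallest_sub _ (sigma_algebra setT) G2 [set B | <<s G >> (setT `*` B)]).
    split => /=; first by rewrite setX0.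
      move=> A sA; rewrite (_ : _ `*` _ = setT `\` (setT `*` A)); first exact: sGC.
      by apply/seteqP; split => -[x y] /=; tauto.
    move=> F sF; rewrite (_ : _ `*` _ = \bigcup_k (setT `*` F k)); first exact: sGU.
    apply/seteqP; split => -[x y] /=.
      by move=> [_ [k _ Fx]]; exists k.
    by move=> [k _ [_ Fx]]; split => //; exists k.
  move=> A GA /=; rewrite (_ : setT `*` A = \bigcup_k (g1 k `*` A)).
    by apply: sGU => k; apply: sub_sigma_algebra; exists (g1 k) => //; exists A.
  by rewrite -setX_bigcupl c1.
rewrite measurable_prod_measurableType; apply: smallest_sub.
  exact: smallest_sigma_algebra.
move=> _ [A mA [B mB <-]].
have -> : A `*` B = setT `\` ((setT `\` (A `*` setT)) `|` (setT `\` (setT `*` B))).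
  apply/seteqP; split => -[x y] /=.
    by move=> [Ax By]; split => // -[] [_]; apply.
  by move=> [_ /not_orP[/not_andP[//|/contrapT[Ax _]] /not_andP[//|/contrapT[_ By]]]].
apply: (sGC); rewrite -bigcup2E; apply: (sGU) => -[|[|k]] //=.
- by apply: (sGC); exact: left.
- by apply: sGC; exact: right.
Qed.

End BoxGenerators.

(** * Determinacy of the moment problem *)

Section MonomialSpan.
Variable R : realType.
Implicit Types (z : C2 R) (f g : C2 R -> R[i]) (p q : C2 R -> R).

Definition exponents : Type := (nat * nat * nat * nat)%type.
Definition monoq (e : exponents) z : R[i] := mono e.1.1.1 e.1.1.2 e.1.2 e.2 z.

Definition in_span f : Prop := exists s : seq (R[i] * exponents),
  forall z, f z = \sum_(e <- s) e.1 * monoq e.2 z.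

Lemma monoqM (e e' : exponents) z : monoq e z * monoq e' z =
  monoq (e.1.1.1 + e'.1.1.1, e.1.1.2 + e'.1.1.2, e.1.2 + e'.1.2, e.2 + e'.2)%N z.
Proof. by rewrite /monoq /mono /= !exprD; ring. Qed.

Lemma in_spanD f g : in_span f -> in_span g -> in_span (fun z => f z + g z).
Proof. by move=> [s sf] [r rg]; exists (s ++ r) => z; rewrite big_cat /= sf rg. Qed.

Lemma in_spanM f g : in_span f -> in_span g -> in_span (fun z => f z * g z).
Proof.
move=> [s sf] [r rg].
exists [seq (e.1 * d.1, (e.2.1.1.1 + d.2.1.1.1, e.2.1.1.2 + d.2.1.1.2,
   e.2.1.2 + d.2.1.2, e.2.2 + d.2.2)%N) | e <- s, d <- r] => z.
rewrite sf rg big_allpairs_dep mulr_suml; apply: eq_bigr => e _.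
rewrite mulr_sumr; apply: eq_bigr => d _ /=.
by rewrite -monoqM; ring.
Qed.

Lemma in_span_cst (c : R[i]) : in_span (fun=> c).
Proof.
exists [:: (c, (0, 0, 0, 0)%N)] => z.
by rewrite big_seq1 /monoq /mono !expr0 !mulr1.
Qed.

Definition in_rspan p : Prop := in_span (fun z => (p z)%:C).

Lemma in_rspanD p q : in_rspan p -> in_rspan q -> in_rspan (fun z => p z + q z).
Proof. by move=> sp sq; rewrite /in_rspan; under eq_fun do rewrite rmorphD; exact: in_spanD. Qed.

Lemma in_rspanM p q : in_rspan p -> in_rspan q -> in_rspan (fun z => p z * q z).
Proof. by move=> sp sq; rewrite /in_rspan; under eq_fun do rewrite rmorphM; exact: in_spanM. Qed.

Lemma in_rspan_cst (c : R) : in_rspan (fun=> c).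
Proof. exact: in_span_cst. Qed.

Lemma in_rspanB p q : in_rspan p -> in_rspan q -> in_rspan (fun z => p z - q z).
Proof.
move=> sp sq; rewrite (_ : (fun z => _) = (fun z => p z + (-1) * q z)); last first.
  by apply/funext => z; rewrite mulN1r.
by apply: in_rspanD => //; apply: in_rspanM => //; exact: in_rspan_cst.
Qed.

Lemma in_rspanX p n : in_rspan p -> in_rspan (fun z => p z ^+ n).
Proof.
move=> sp; elim: n => [|n IH]; first exact: in_rspan_cst.
by under eq_fun do rewrite exprS; exact: in_rspanM.
Qed.

Lemma in_span_monoq e : in_span (monoq e).
Proof. by exists [:: (1, e)] => z; rewrite big_seq1 mul1r. Qed.

Lemma Re_half (c : R[i]) : (complex.Re c)%:C = 2^-1 * (c + c^*).
Proof. by rewrite addcJ mulrA mulVf ?mul1r // pnatr_eq0. Qed.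

Lemma Im_half (c : R[i]) : (complex.Im c)%:C = ((0 : R) +i* (- 2^-1 : R)) * c + ((0 : R) +i* (2^-1 : R)) * c^*.
Proof.
by case: c => x y; simpc; congr (_ +i* _) => /=; lra.
Qed.

Lemma in_rspan_coord : [/\ in_rspan (fun z => z.1.1 : R), in_rspan (fun z => z.1.2 : R),
  in_rspan (fun z => z.2.1 : R) & in_rspan (fun z => z.2.2 : R)].
Proof.
have sx := in_span_monoq (1, 0, 0, 0)%N; have sx' := in_span_monoq (0, 1, 0, 0)%N.
have sy := in_span_monoq (0, 0, 1, 0)%N; have sy' := in_span_monoq (0, 0, 0, 1)%N.
have mx z : monoq (1, 0, 0, 0)%N z = xcoord z.
  by rewrite /monoq /mono /= expr1 !expr0 !mulr1.
have mx' z : monoq (0, 1, 0, 0)%N z = (xcoord z)^*.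
  by rewrite /monoq /mono /= expr1 !expr0 !mulr1 mul1r.
have my z : monoq (0, 0, 1, 0)%N z = ycoord z.
  by rewrite /monoq /mono /= expr1 !expr0 !mulr1 mul1r.
have my' z : monoq (0, 0, 0, 1)%N z = (ycoord z)^*.
  by rewrite /monoq /mono /= expr1 !expr0 !mul1r.
split; rewrite /in_rspan.
- rewrite (_ : (fun z => _) = (fun z => 2^-1 * (monoq (1, 0, 0, 0)%N z + monoq (0, 1, 0, 0)%N z))).
    by apply: in_spanM; [exact: in_span_cst|exact: in_spanD].
  by apply/funext => z; rewrite mx mx' -Re_half.
- rewrite (_ : (fun z => _) = (fun z => ((0 : R) +i* (- 2^-1 : R)) * monoq (1, 0, 0, 0)%N z + ((0 : R) +i* (2^-1 : R)) * monoq (0, 1, 0, 0)%N z)).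
    by apply: in_spanD; apply: in_spanM => //; exact: in_span_cst.
  by apply/funext => z; rewrite mx mx' -Im_half.
- rewrite (_ : (fun z => _) = (fun z => 2^-1 * (monoq (0, 0, 1, 0)%N z + monoq (0, 0, 0, 1)%N z))).
    by apply: in_spanM; [exact: in_span_cst|exact: in_spanD].
  by apply/funext => z; rewrite my my' -Re_half.
- rewrite (_ : (fun z => _) = (fun z => ((0 : R) +i* (- 2^-1 : R)) * monoq (0, 0, 1, 0)%N z + ((0 : R) +i* (2^-1 : R)) * monoq (0, 0, 0, 1)%N z)).
    by apply: in_spanD; apply: in_spanM => //; exact: in_span_cst.
  by apply/funext => z; rewrite my my' -Im_half.
Qed.

End MonomialSpan.

(** * Measures with equal moments on a bounded set *)

Section Determinacy.
Variables (R : realType) (D : set (C2 R)) (K : R).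
Hypothesis mD : measurable D.
Hypothesis DK : forall z, D z -> [/\ `|z.1.1| <= K, `|z.1.2| <= K, `|z.2.1| <= K & `|z.2.2| <= K].
Implicit Types (z : C2 R).

Definition coord (i : 'I_4) z : R :=
  if i == 0 then z.1.1 else if i == 1 then z.1.2 else if i == 2%R then z.2.1 else z.2.2.

Lemma coord_le i z : D z -> `|coord i z| <= K.
Proof.
move=> Dz; have [h1 h2 h3 h4] := DK Dz; rewrite /coord.
by case: ifP => // _; case: ifP => // _; case: ifP.
Qed.

Lemma measurable_coord i : measurable_fun setT (coord i).
Proof.
rewrite /coord; case: (i == 0); first exact: measurable_coord11.
case: (i == 1); first exact: measurable_coord12.
by case: (i == 2%R); [exact: measurable_coord21|exact: measurable_coord22].
Qed.

Lemma in_rspan_coordi i : in_rspan (coord i).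
Proof.
have [s1 s2 s3 s4] := in_rspan_coord R.
by rewrite /coord; case: (i == 0) => //; case: (i == 1) => //; case: (i == 2%R).
Qed.

Definition box_above (x : 'I_4 -> R) : set (C2 R) := [set z | forall i, x i < coord i z].

Lemma integrable_bounded (nu : probability (C2 R) R) (f : C2 R -> R) (M : R) :
  measurable_fun setT f -> (forall z, D z -> `|f z| <= M) ->
  nu.-integrable D (EFin \o f).
Proof.
move=> mf fM; apply: measurable_bounded_integrable => //.
- by apply: le_lt_trans (probability_le1 nu mD) (ltry 1).
- exact: measurable_funTS.
- exists M; split; first exact: num_real.
  by move=> x Mx z Dz /=; apply: le_trans (fM z Dz) (ltW Mx).
Qed.

Lemma normc_xcoord z : D z -> normc (xcoord z) <= 2 * K /\ normc (ycoord z) <= 2 * K.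
Proof.
have le2 (x y : R) : `|x| <= K -> `|y| <= K -> normc (x +i* y) <= 2 * K.
  move=> xK yK; have K0 : 0 <= K by apply: le_trans xK.
  rewrite -(@ler_pXn2r _ 2) ?nnegrE ?normc_ge0 ?mulr_ge0 // sqr_normcE /= exprMn.
  have h (w : R) : `|w| <= K -> w ^+ 2 <= K ^+ 2.
    by move=> wK; rewrite -[w ^+ 2]real_normK ?num_real // ler_pXn2r ?nnegrE.
  by have := h _ xK; have := h _ yK; have := sqr_ge0 K; lra.
by move=> Dz; have [h1 h2 h3 h4] := DK Dz; split; apply: le2.
Qed.

Lemma cintegrable_mono (nu : probability (C2 R) R) e : cintegrable nu D (monoq e).
Proof.
case: e => [[[m1 n1] m2] n2].
have [mr mi] := cmeasurable_mono R m1 n1 m2 n2.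
have b z : D z -> normc (monoq (m1, n1, m2, n2) z) <= (2 * K) ^+ m1 * (2 * K) ^+ n1 * (2 * K) ^+ m2 * (2 * K) ^+ n2.
  have nX (c : R[i]) n : normc (c ^+ n) = normc c ^+ n.
    by elim: n => [|n IH]; rewrite ?normc1 // !exprS normcM IH.
  move=> Dz; have [x y] := normc_xcoord Dz.
  have pw (c : R[i]) n : normc c <= 2 * K -> 0 <= normc c ^+ n <= (2 * K) ^+ n.
    move=> cK; rewrite exprn_ge0 ?normc_ge0 //=; apply: lerXn2r => //; rewrite nnegrE.
      exact: normc_ge0.
    exact: le_trans (normc_ge0 c) cK.
  rewrite /monoq /mono /= !normcM !nX !normcC.
  have /andP[? ?] := pw _ m1 x; have /andP[? ?] := pw _ n1 x.
  have /andP[? ?] := pw _ m2 y; have /andP[? ?] := pw _ n2 y.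
  by do 3 (apply: ler_pM => //; try by rewrite !mulr_ge0).
split.
  exact: (integrable_bounded nu mr (fun z Dz => le_trans (normr_Re_le _) (b z Dz))).
exact: (integrable_bounded nu mi (fun z Dz => le_trans (normr_Im_le _) (b z Dz))).
Qed.

(** On [D] the affine argument lies in [0, 1], because |coord i z - x i| <= K + |x i|, and it is
    below 1/2 exactly when coord i z > x i; the summand 1 keeps the denominator positive. *)
Definition step (n : nat) (x : 'I_4 -> R) i z : R :=
  step_poly n (2^-1 - (coord i z - x i) / (2 * (K + `|x i| + 1))).

Lemma step_arg x i z : D z -> let u := 2^-1 - (coord i z - x i) / (2 * (K + `|x i| + 1)) in
  [/\ 0 <= u, u <= 1 & (u < 2^-1) = (x i < coord i z)].
Proof.
move=> Dz /=; have cK := coord_le i Dz.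
set M := K + `|x i| + 1.
have K0 : 0 <= K by apply: le_trans cK.
have M0 : 0 < 2 * M by rewrite mulr_gt0 // /M ltr_wpDl // addr_ge0.
have cM : `|coord i z - x i| <= M.
  apply: le_trans (ler_normB _ _) _; rewrite /M -addrA; apply: lerD => //.
  by rewrite lerDl.
have : `|(coord i z - x i) / (2 * M)| <= 2^-1.
  by rewrite normrM normfV (gtr0_norm M0) ler_pdivrMr // mulrA mulVf ?mul1r.
rewrite ler_norml => /andP[h1 h2]; split; [lra|lra|].
by rewrite gtrBl pmulr_lgt0 ?invr_gt0 // subr_gt0.
Qed.

Lemma in_rspan_step n x i : in_rspan (step n x i).
Proof.
have s1 : in_rspan (fun z => 2^-1 - (coord i z - x i) / (2 * (K + `|x i| + 1))).
  apply: in_rspanB; first exact: in_rspan_cst.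
  apply: in_rspanM; last exact: in_rspan_cst.
  by apply: in_rspanB; [exact: in_rspan_coordi|exact: in_rspan_cst].
rewrite /step /step_poly; apply: in_rspanM.
  by apply: in_rspanX; apply: in_rspanB; [exact: in_rspan_cst|exact: in_rspanX].
apply: in_rspanB; first exact: in_rspan_cst.
apply: in_rspanX; apply: in_rspanB; first exact: in_rspan_cst.
by apply: in_rspanX; apply: in_rspanB => //; exact: in_rspan_cst.
Qed.

Definition box_step n x z : R := step n x 0 z * step n x 1 z * step n x 2%R z * step n x 3%R z.

Lemma in_rspan_box n x : in_rspan (box_step n x).
Proof. by do 3 (apply: in_rspanM; last exact: in_rspan_step); exact: in_rspan_step. Qed.

Lemma box_step_cvg x z : D z ->
  box_step n x z @[n --> \oo] --> (\1_(box_above x) z : R).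
Proof.
move=> Dz.
have st i : step n x i z @[n --> \oo] --> ((x i < coord i z)%R%:R : R).
  have [u0 u1 <-] := step_arg x i Dz; exact: step_poly_cvg.
have -> : \1_(box_above x) z = ((x 0 < coord 0 z)%R%:R * (x 1 < coord 1 z)%R%:R *
   (x 2%R < coord 2%R z)%R%:R * (x 3%R < coord 3%R z)%R%:R : R).
  rewrite indicE -!natrM !mulnb; congr (_%:R); congr nat_of_bool.
  apply/idP/idP.
    by rewrite inE /= => h; rewrite !h.
  move=> /andP[/andP[/andP[h0 h1] h2] h3]; rewrite inE /= => i.
  have [->|[->|[->|->]]] : i = 0 \/ i = 1 \/ i = 2%R \/ i = 3%R => //.
  by case: i => [[|[|[|[|//]]]] ?]; [left|right;left|right;right;left|right;right;right]; exact/val_inj.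
by do 3 (apply: cvgM; last exact: st); exact: st.
Qed.

Lemma box_step01 n x z : D z -> `|box_step n x z| <= 1.
Proof.
move=> Dz.
have st i : `|step n x i z| <= 1.
  have [u0 u1 _] := step_arg x i Dz.
  have /andP[h0 h1] := step_poly01 n u0 u1.
  by rewrite ger0_norm.
have mul1 (u v : R) : `|u| <= 1 -> `|v| <= 1 -> `|u * v| <= 1.
  by move=> u1 v1; rewrite normrM mulr_ile1.
by rewrite /box_step; do 3 (apply: (mul1); last exact: st); exact: st.
Qed.

Lemma measurable_box_above x : measurable (box_above x).
Proof.
rewrite (_ : box_above x = \bigcap_(i in [set: 'I_4]) (coord i @^-1` `]x i, +oo[%classic)).
  apply: fin_bigcap_measurable => // i _.
  by rewrite -[X in measurable X]setTI; apply: measurable_coord => //; exact: measurable_itv.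
apply/seteqP; split => z /=.
  by move=> h i _ /=; rewrite in_itv /= h.
by move=> h i; have := h i I; rewrite /= in_itv /= andbT.
Qed.

Lemma measurable_box_step n x : measurable_fun setT (box_step n x).
Proof.
have ms i : measurable_fun setT (step n x i).
  have mu : measurable_fun setT (fun z => 2^-1 - (coord i z - x i) / (2 * (K + `|x i| + 1))).
    apply: measurable_funB => //; apply: measurable_funM => //.
    by apply: measurable_funB => //; exact: measurable_coord.
  apply: measurable_funM.
    by apply: measurable_funX; apply: measurable_funB => //; exact: measurable_funX.
  apply: measurable_funB => //; apply: measurable_funX; apply: measurable_funB => //.
  by apply: measurable_funX; exact: measurable_funB.
by do 3 (apply: measurable_funM => //).
Qed.

Lemma integral_box_step_cvg (nu : probability (C2 R) R) x :
  (\int[nu]_(z in D) (box_step n x z)%:E)%E @[n --> \oo] --> nu (box_above x `&` D).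
Proof.
have := @dominated_cvg _ _ _ nu D mD (fun n z => (box_step n x z)%:E)
  (fun z => (\1_(box_above x) z)%:E) (cst 1%E).
rewrite integral_indic //; last exact: measurable_box_above.
apply => //.
- move=> n; apply/measurable_EFinP; apply: measurable_funTS.
  exact: measurable_box_step.
- move=> z Dz; apply: cvg_EFin; first exact: nearW.
  exact: box_step_cvg.
- by apply: (@integrable_bounded nu (cst 1) 1) => // z _; rewrite normr1.
- by move=> n z Dz; rewrite /= lee_fin box_step01.
Qed.

Definition rays : set (set (measurableTypeR R)) := [set A | exists x, A = `]x, +oo[%classic].
Definition quadrants : set (set (plane R)) := [set A `*` B | A in rays & B in rays].
Definition orthants : set (set (C2 R)) := [set A `*` B | A in quadrants & B in quadrants].

Let ray (k : nat) : set (measurableTypeR R) := `](- k%:R), +oo[%classic.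

Let ray_cover : \bigcup_k ray k = setT.
Proof.
apply/seteqP; split => // y _; exists (Num.bound (- y)) => //.
rewrite /ray /= in_itv /= andbT ltrNl.
have [y0|y0] := leP 0 (- y); first exact: archi_boundP.
exact: lt_le_trans y0 _.
Qed.

Let quadrant_cover : \bigcup_k (ray k `*` ray k) = setT.
Proof.
apply/seteqP; split => // -[y1 y2] _.
have [k1 _ r1] : (\bigcup_k ray k) y1 by rewrite ray_cover.
have [k2 _ r2] : (\bigcup_k ray k) y2 by rewrite ray_cover.
have mono j k (y : R) : (j <= k)%N -> ray j y -> ray k y.
  move=> jk; rewrite /ray /= !in_itv /= !andbT; apply: le_lt_trans.
  by rewrite lerN2 ler_nat.
exists (maxn k1 k2) => //; split.
  exact: mono (leq_maxl _ _) r1.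
exact: mono (leq_maxr _ _) r2.
Qed.

Let orthant_cover : \bigcup_k ((ray k `*` ray k) `*` (ray k `*` ray k)) = setT.
Proof.
apply/seteqP; split => // -[y1 y2] _.
have [k1 _ [a1 a2]] : (\bigcup_k (ray k `*` ray k)) y1 by rewrite quadrant_cover.
have [k2 _ [b1 b2]] : (\bigcup_k (ray k `*` ray k)) y2 by rewrite quadrant_cover.
have mono j k (y : R) : (j <= k)%N -> ray j y -> ray k y.
  move=> jk; rewrite /ray /= !in_itv /= !andbT; apply: le_lt_trans.
  by rewrite lerN2 ler_nat.
exists (maxn k1 k2) => //; split; split.
- exact: mono (leq_maxl _ _) a1.
- exact: mono (leq_maxl _ _) a2.
- exact: mono (leq_maxr _ _) b1.
- exact: mono (leq_maxr _ _) b2.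
Qed.

Lemma measurable_orthants : @measurable _ (C2 R) = <<s orthants >>.
Proof.
have m1 : @measurable _ (measurableTypeR R) = <<s rays >> := RGenOInfty.measurableE R.
have m2 : @measurable _ (plane R) = <<s quadrants >>.
  apply: (@measurable_prod_gen _ _ _ _ rays rays ray ray m1 m1) => //.
    by move=> k; eexists.
  by move=> k; eexists.
have q k : quadrants (ray k `*` ray k).
  by exists (ray k); [eexists|exists (ray k) => //; eexists].
exact: (@measurable_prod_gen _ _ _ _ quadrants quadrants
  (fun k => ray k `*` ray k) (fun k => ray k `*` ray k) m2 m2).
Qed.

Lemma orthant_box (A : set (C2 R)) : orthants A -> exists x, A = box_above x.
Proof.
move=> [_ [_ [x0 ->] [_ [x1 ->] <-]] [_ [_ [x2 ->] [_ [x3 ->] <-]] <-]].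
exists (fun i => if i == 0 then x0 else if i == 1 then x1 else if i == 2%R then x2 else x3).
apply/seteqP; split => -[[z0 z1] [z2 z3]]; rewrite /box_above /coord /= !in_itv /= !andbT.
  by move=> [[h0 h1] [h2 h3]] i; do 3 (case: ifP => // _).
by move=> h; split; split; [have := h 0|have := h 1|have := h 2%R|have := h 3%R].
Qed.

Lemma orthantsI : setI_closed orthants.
Proof.
have raysI : setI_closed rays.
  move=> _ _ [x ->] [y ->]; exists (Num.max x y).
  by apply/seteqP; split => z; rewrite /= !in_itv /= !andbT gt_max => /andP.
have quadI : setI_closed quadrants.
  move=> _ _ [A rA [B rB <-]] [A' rA' [B' rB' <-]]; rewrite -setXI.
  by exists (A `&` A'); [exact: raysI|exists (B `&` B') => //; exact: raysI].
move=> _ _ [A rA [B rB <-]] [A' rA' [B' rB' <-]]; rewrite -setXI.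
by exists (A `&` A'); [exact: quadI|exists (B `&` B') => //; exact: quadI].
Qed.

(** Equal moments give equal integrals of [box_step], a polynomial bounded by 1 on [D] that tends to
    the indicator of an orthant. Dominated convergence yields equality on orthants, which are stable
    under intersection, generate the sigma-algebra and cover the space by a sequence. *)
Lemma moments_determine (nu nu' : probability (C2 R) R) :
  nu.-negligible (~` D) -> nu'.-negligible (~` D) ->
  (forall e, cint nu D (monoq e) = cint nu' D (monoq e)) ->
  forall B, measurable B -> nu B = nu' B.
Proof.
move=> nuD nuD' numono.
have span f : in_span f -> cint nu D f = cint nu' D f.
  move=> [s fs]; rewrite (_ : f = fun z => \sum_(e <- s) e.1 * monoq e.2 z); last exact/funext.
  rewrite !cint_sum //; try by move=> e; exact: cintegrable_mono.
  by apply: eq_bigr => e _; rewrite numono.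
have rspan p : in_rspan p -> Rintegral nu D p = Rintegral nu' D p.
  by move=> /span/(congr1 (@complex.Re R)).
have boxD x : nu (box_above x `&` D) = nu' (box_above x `&` D).
  have h := @integral_box_step_cvg nu x; have h' := @integral_box_step_cvg nu' x.
  rewrite -(cvg_lim _ h) // -(cvg_lim _ h') //; congr (limn _); apply/funext => n.
  have fin (m : probability (C2 R) R) : (\int[m]_(z in D) (box_step n x z)%:E \is a fin_num)%E.
    apply: integrable_fin_num => //.
    by apply: (@integrable_bounded m _ 1 (measurable_box_step n x)) => z; exact: box_step01.
  by rewrite -[LHS]fineK // -[RHS]fineK //; congr EFin; apply: rspan; exact: in_rspan_box.
have boxE x : nu (box_above x) = nu' (box_above x).
  have restr (m : probability (C2 R) R) : m.-negligible (~` D) ->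
      m (box_above x) = m (box_above x `&` D).
    move=> mD0; have mB := measurable_box_above x.
    have z : m (box_above x `\` D) = 0%E.
      apply: measure_negligible; first exact: measurableD.
      by apply: negligibleS mD0; rewrite setDE; exact: subIsetr.
    have e : (m (box_above x) = m (box_above x `\` D) + m (box_above x `&` D))%E :=
      measureDI m mB mD.
    by rewrite e z add0e.
  by rewrite !restr.
apply: (measure_unique orthants (fun k => (ray k `*` ray k) `*` (ray k `*` ray k))).
- exact: measurable_orthants.
- exact: orthantsI.
- move=> k; have q : quadrants (ray k `*` ray k).
    by exists (ray k); [eexists|exists (ray k) => //; eexists].
  by exists (ray k `*` ray k) => //; exists (ray k `*` ray k).
- exact: orthant_cover.
- by move=> A /orthant_box[x ->]; exact: boxE.
- move=> k; apply: le_lt_trans (ltry 1); apply: probability_le1.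
  by apply: measurableX; apply: measurableX; exact: measurable_itv.
Qed.

End Determinacy.

(** * The modulus of the Jacobian *)

Section Jacobian.
Variable R : realType.
Implicit Types (t : plane R) (G : group_name).

Definition is_cderive (f : R -> R[i]) (s : R) (d : R[i]) : Prop :=
  is_derive s 1 (fun r => complex.Re (f r)) (complex.Re d) /\
  is_derive s 1 (fun r => complex.Im (f r)) (complex.Im d).

Lemma is_cderiveE f s d : is_cderive f s d -> cderive f s = d.
Proof.
move=> [dr di]; rewrite /cderive !derive1E !derive_val.
by case: d {dr di}.
Qed.

Lemma is_cderive_expi (a b s : R) :
  is_cderive (fun r => expi (a * r + b)) s ((0 +i* (2 * pi * a)) * expi (a * s + b)).
Proof.
have dlin : is_derive s 1 (fun r : R => 2 * pi * (a * r + b)) (2 * pi * a).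
  apply: is_derive_eq.
  by rewrite addr0 /GRing.scale /= mulr1.
split; rewrite /expi /=.
- apply: (is_derive_eq (is_derive1_comp (is_derive_cos _) dlin)); ring.
- apply: (is_derive_eq (is_derive1_comp (is_derive_sin _) dlin)); ring.
Qed.

Lemma is_cderive_sum (I : Type) (l : seq I) (a b : I -> R) (s : R) :
  is_cderive (fun r => \sum_(v <- l) expi (a v * r + b v)) s
    (\sum_(v <- l) (0 +i* (2 * pi * a v)) * expi (a v * s + b v)).
Proof.
elim: l => [|v l [IHr IHi]].
  by split; under eq_fun do rewrite big_nil; rewrite big_nil /=; exact: is_derive_cst.
have [dr di] := is_cderive_expi (a v) (b v) s.
have ReD (x y : R[i]) : complex.Re (x + y) = complex.Re x + complex.Re y by case: x y => ? ? [].
have ImD (x y : R[i]) : complex.Im (x + y) = complex.Im x + complex.Im y by case: x y => ? ? [].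
split; under eq_fun do rewrite big_cons ?ReD ?ImD; rewrite big_cons ?ReD ?ImD.
  exact: (is_deriveD dr IHr).
exact: (is_deriveD di IHi).
Qed.

Lemma partial1_lsum l t : partial1 (@lsum R l) t =
  \sum_(v <- l) (0 +i* (2 * pi * v.1%:~R)) * sigma v t.
Proof.
apply: (is_cderiveE (@is_cderive_sum _ l (fun v => v.1%:~R) (fun v => v.2%:~R * t.2) t.1)).
Qed.

Lemma partial2_lsum l t : partial2 (@lsum R l) t =
  \sum_(v <- l) (0 +i* (2 * pi * v.2%:~R)) * sigma v t.
Proof.
have := is_cderiveE (@is_cderive_sum _ l (fun v => v.2%:~R) (fun v => v.1%:~R * t.1) t.2).
rewrite /partial2 (_ : (fun r : R => lsum l (t.1, r)) =
  (fun r => \sum_(v <- l) expi (v.2%:~R * r + v.1%:~R * t.1))); last first.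
  by apply/funext => r; apply: eq_bigr => v _; rewrite /sigma addrC.
by move=> ->; apply: eq_bigr => v _; rewrite /sigma [_ * t.1 + _]addrC.
Qed.

(** The constant is (2 pi i)^2, one factor for each derivative of an exponential. *)
Lemma jacobianE G t : jacobian G t = - ((2 * pi) ^+ 2)%:C * jacK G t.
Proof.
rewrite /jacobian (_ : chi G (rho1 G) = @lsum R (chi1_weights G)); last exact/funext/chi1E.
rewrite (_ : chi G (rho2 G) = @lsum R (chi2_weights G)); last exact/funext/chi2E.
rewrite !partial1_lsum !partial2_lsum /jacK /feval /fjac big_allpairs_dep /=.
rewrite !mulr_suml -sumrB mulr_sumr; apply: eq_bigr => v _.
rewrite !mulr_sumr -sumrB; apply: eq_bigr => w _.
rewrite sigmaD.
have E : (0 +i* (2 * pi * v.1%:~R)) * (0 +i* (2 * pi * w.2%:~R)) -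
  (0 +i* (2 * pi * v.2%:~R)) * (0 +i* (2 * pi * w.1%:~R)) =
  - ((2 * pi) ^+ 2)%:C * (v.1 * w.2 - v.2 * w.1)%:~R :> R[i].
  rewrite -[(_ - _)%:~R](rmorph_int (@real_complex R)) intrB !intrM.
  by apply/eqP; rewrite eq_complex /=; apply/andP; split; apply/eqP; ring.
rewrite [RHS]mulrA -E; ring.
Qed.

Lemma normc_jacobian G t : normc (jacobian G t) = (2 * pi) ^+ 2 * normc (jacK G t).
Proof.
rewrite jacobianE normcM; congr (_ * _).
rewrite /normc /= oppr0 sqrrN expr0n addr0 sqrtr_sqr ger0_norm //.
exact: sqr_ge0.
Qed.

Lemma normc_jacobian_Psi G t t' : Psi G t = Psi G t' ->
  normc (jacobian G t) = normc (jacobian G t').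
Proof.
move=> PE; rewrite !normc_jacobian; congr (_ * _).
have [x y] : chi G (rho1 G) t = chi G (rho1 G) t' /\ chi G (rho2 G) t = chi G (rho2 G) t'.
  move: PE; rewrite /Psi; case: (chi G (rho1 G) t) => a b; case: (chi G (rho1 G) t') => a' b'.
  by case: (chi G (rho2 G) t) => c d; case: (chi G (rho2 G) t') => c' d' /= -[-> -> -> ->].
have K2 : normc (jacK G t) ^+ 2 = normc (jacK G t') ^+ 2.
  have := jacK_sq G t; rewrite -chi1E -chi2E x y chi1E chi2E -jacK_sq -!sqr_normc.
  by move=> /(congr1 (@complex.Re R)).
by apply: (pexpIrn (n := 2)); rewrite ?nnegrE ?normc_ge0.
Qed.

Lemma negligible_jacobian0 G :
  (leb2 R).-negligible [set t | normc (jacobian G t) = 0].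
Proof.
have h : all (fun v => v != 0) ((0, -3) :: jac_roots G).
  by apply/allP => v; exact: jacK_roots_neq0.
apply: negligibleS (negligible_sigma1_seq R h) => t.
rewrite [X in X -> _]/mkset normc_jacobian => /eqP.
rewrite mulf_eq0 expf_eq0 mulf_eq0 pnatr_eq0 (gt_eqF (pi_gt0 R)) => /eqP K0.
exact: (jacK_eq0 (ComplexField.Normc.eq0_normc K0)).
Qed.

Lemma measurable_jacobian G :
  measurable_fun setT (fun t : plane R => normc (jacobian G t)).
Proof.
pose s := [seq (e.1%:~R : R[i], e.2) | e <- fjac (chi1_weights G) (chi2_weights G)].
have [mr mi] := measurable_trig s.
have sE t : jacK G t = trig s t by rewrite /trig big_map.
under eq_fun do rewrite normc_jacobian sE.
apply: measurable_funM => //.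
rewrite (_ : (fun t => _) = (fun t => Num.sqrt (complex.Re (trig s t) ^+ 2 + complex.Im (trig s t) ^+ 2))).
  apply: (measurableT_comp (continuous_measurable_fun (@sqrt_continuous R))).
  by apply: measurable_funD; apply: measurable_funX.
by apply/funext => t; rewrite /normc; case: (trig s t).
Qed.

End Jacobian.

Local Close Scope complex_scope.

(** * Tiling by a fundamental domain *)

Section CountableIndex.
Variables (I : countType) (T : Type).

(** Turns a family over a countable type into a sequence, with the empty set at the numbers that
    code no index, so that unions and disjointness are kept. *)
Definition nat_family (F : I -> set T) (k : nat) : set T :=
  if pickle_inv k is Some i then F i else set0.

Lemma bigcup_nat_family (F : I -> set T) : \bigcup_k nat_family F k = \bigcup_i F i.
Proof.
apply/seteqP; split => t.
  by move=> [k _]; rewrite /nat_family; case: pickle_inv => // i; exists i.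
by move=> [i _ Fi]; exists (choice.pickle i) => //; rewrite /nat_family pickleK_inv.
Qed.

Lemma trivIset_nat_family (F : I -> set T) : trivIset setT F ->
  trivIset setT (nat_family F).
Proof.
move=> tF k k' _ _; rewrite /nat_family.
case ek : (pickle_inv k) => [i|]; last by move=> [t []].
case ek' : (pickle_inv k') => [j|]; last by move=> [t []].
move=> /(tF i j Logic.I Logic.I) ij.
have := @pickle_invK I k; have := @pickle_invK I k'; rewrite ek ek' /= ij.
by move=> <- <-.
Qed.

End CountableIndex.

Section CountableMeasure.
Variables (R : realType) (d : measure_display) (T : measurableType d) (I : countType).
Variable mu : {measure set T -> \bar R}.

Lemma measure_countable_eq (F F' : I -> set T) :
  (forall i, measurable (F i)) -> (forall i, measurable (F' i)) ->
  trivIset setT F -> trivIset setT F' -> (forall i, mu (F i) = mu (F' i)) ->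
  mu (\bigcup_i F i) = mu (\bigcup_i F' i).
Proof.
move=> mF mF' tF tF' FF'.
have mfam (H : I -> set T) k : (forall i, measurable (H i)) -> measurable (nat_family H k).
  by move=> mH; rewrite /nat_family; case: pickle_inv.
have h := measure_semi_bigcup mu (mfam F ^~ mF) (trivIset_nat_family tF).
have h' := measure_semi_bigcup mu (mfam F' ^~ mF') (trivIset_nat_family tF').
rewrite -(bigcup_nat_family F) -(bigcup_nat_family F') h ?h'.
- by apply: eq_eseriesr => k _; rewrite /nat_family; case: pickle_inv.
- by apply: bigcupT_measurable => k; exact: mfam.
- by apply: bigcupT_measurable => k; exact: mfam.
Qed.

Lemma negligible_countable (F : I -> set T) : (forall i, mu.-negligible (F i)) ->
  mu.-negligible (\bigcup_i F i).
Proof.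
move=> F0; rewrite -(bigcup_nat_family F); apply: negligible_bigcup => k.
by rewrite /nat_family; case: pickle_inv => //; exact: negligible_set0.
Qed.

Lemma measurable_countable (F : I -> set T) : (forall i, measurable (F i)) ->
  measurable (\bigcup_i F i).
Proof.
move=> mF; rewrite -(bigcup_nat_family F); apply: bigcupT_measurable => k.
by rewrite /nat_family; case: pickle_inv.
Qed.

Lemma measure_eq_null (A B N : set T) : measurable A -> measurable B -> measurable N ->
  mu N = 0%E -> B `<=` A -> A `<=` B `|` N -> mu A = mu B.
Proof.
move=> mA mB mN N0 BA ABN; apply/eqP; rewrite eq_le; apply/andP; split.
  have h1 : (mu A <= mu (B `|` N))%E.
    by apply: le_measure; rewrite ?inE //; exact: measurableU.
  have h2 : (mu (B `|` N) <= mu B + mu N)%E by exact: measureU2.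
  by apply: le_trans h1 (le_trans h2 _); rewrite N0 adde0.
by apply: le_measure; rewrite ?inE.
Qed.

End CountableMeasure.

Lemma sume_const_seq (R : realType) (T : Type) (l : seq T) (c : \bar R) :
  (\sum_(i <- l) c = (size l)%:R%:E * c)%E.
Proof.
elim: l => [|i l IH]; first by rewrite big_nil mul0e.
by rewrite big_cons IH -nat1r EFinD ge0_muleDl ?lee_fin// mul1e.
Qed.

Section Tiling.
Variable R : realType.
Implicit Types (t : plane R) (n m : weight) (x y : mx2t).

Definition actz x n : weight :=
  let: (a, b, c, d) := x in (a * n.1 + b * n.2, c * n.1 + d * n.2).

Definition affine x n t : plane R :=
  let: (a, b, c, d) := x in
  (a%:~R * (t.1 : R) + b%:~R * (t.2 : R) + n.1%:~R,
   c%:~R * (t.1 : R) + d%:~R * (t.2 : R) + n.2%:~R).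

Lemma affine_act_mx_of x n : @affine_act R (mx_of x) n = affine x n.
Proof. by case: x => [[[a b] c] d]; apply/funext => t; rewrite /affine_act /act !mxE. Qed.

Lemma affine_comp y m x n t : affine y m (affine x n t) = affine (tmulmx y x) (actz y n + m) t.
Proof.
case: x y => [[[a b] c] d] [[[a' b'] c'] d'] /=.
by congr pair; rewrite !intrD !intrM; ring.
Qed.

Lemma affine_id t : affine tid 0 t = t.
Proof. by case: t => u v; rewrite /affine /= !mul1r !mul0r !addr0 add0r. Qed.

Lemma actz_comp y x n : actz y (actz x n) = actz (tmulmx y x) n.
Proof.
case: x y => [[[a b] c] d] [[[a' b'] c'] d'] /=; congr pair; ring.
Qed.

Lemma actz_id n : actz tid n = n.
Proof. by case: n => u v; rewrite /actz /= !mul1r !mul0r addr0 add0r. Qed.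

Lemma subr_actz_id x n m : x = tid -> m - actz x n = 0 -> n = m.
Proof. by move=> ->; rewrite actz_id => /subr0_eq ->. Qed.

Lemma glist_inv G x : x \in glist G ->
  exists y, [/\ y \in glist G, tmulmx y x = tid & tmulmx x y = tid].
Proof.
have : let l := glist G in all (fun x => has (fun y => (tmulmx y x == tid) && (tmulmx x y == tid)) l) l.
  by case: G; vm_compute.
by move=> /allP h /h /hasP[y yG /andP[/eqP yx /eqP xy]]; exists y.
Qed.

Lemma glistM G x y : x \in glist G -> y \in glist G -> tmulmx x y \in glist G.
Proof.
have : let l := glist G in all (fun x => all (fun y => tmulmx x y \in l) l) l.
  by case: G; vm_compute.
by move=> /allP h /h /allP h' /h'.
Qed.

Lemma affine_preserving G x n : x \in glist G -> leb2_preserving (affine x n).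
Proof. by move=> xG; rewrite -affine_act_mx_of; apply: leb2_affine; exact: mem_Gamma xG. Qed.

Lemma measurable_affine G x n (A : set (plane R)) : x \in glist G -> measurable A ->
  measurable (affine x n @^-1` A).
Proof.
move=> /(affine_preserving n)[mf _] mA.
by rewrite -[X in measurable X]setTI; exact: mf.
Qed.

Lemma negligible_affine G x n (A : set (plane R)) : x \in glist G ->
  (leb2 R).-negligible A -> (leb2 R).-negligible (affine x n @^-1` A).
Proof.
move=> xG [B [mB B0 AB]]; exists (affine x n @^-1` B); split.
- exact: measurable_affine xG mB.
- by have [_ pE] := affine_preserving n xG; rewrite pE.
- by move=> t /AB.
Qed.

Definition torus_floor t : weight := (Num.floor (t.1 : R), Num.floor (t.2 : R)).

Lemma unit_squareP t : unit_square t <-> torus_floor t = 0.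
Proof.
have fl (u : R) : (u \in `[0, 1[) <-> (Num.floor u = 0).
  rewrite in_itv /=; split.
    by move=> u01; apply: floor_def; rewrite add0r.
  by move=> u0; have := floor_le_tmp u; have := floorD1_gt u; rewrite u0 add0r => -> ->.
rewrite /unit_square /torus_floor; split.
  by move=> [/= /fl -> /fl ->].
by move=> [/fl h1 /fl h2]; split.
Qed.

Lemma torus_floorD t n : torus_floor (affine tid n t) = torus_floor t + n.
Proof.
rewrite /torus_floor /affine /=; congr pair.
  by rewrite mul1r mul0r addr0 floorDrz ?intr_int // intrKfloor.
by rewrite mul1r mul0r add0r floorDrz ?intr_int // intrKfloor.
Qed.

(* Conversion would otherwise evaluate membership in the enumeration. *)
Local Opaque glist.

(** Off a null set N the plane is the disjoint union of the tiles V (x, n). Cut the unit square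
    along them; for fixed x the maps [affine x n] carry the pieces into C, where they reassemble the
    part of C in E up to a null set, since each point of C comes from the square for exactly one n.
    So every x in the group contributes the area of that part once. *)
Lemma tiling G (C E : set (plane R)) : is_fundamental_domain G C -> measurable E ->
  (forall x n t, x \in glist G -> E (affine x n t) <-> E t) ->
  leb2 R (@unit_square R `&` E) = ((order G)%:R%:E * leb2 R (C `&` E))%E.
Proof.
move=> [mC Ccov Cdis] mE Einv.
have mQ := @measurable_unit_square R.
pose V (i : mx2t * weight) := if i.1 \in glist G then affine i.1 i.2 @^-1` C else set0.
have mV i : measurable (V i).
  by rewrite /V; case: ifP => // xG; exact: measurable_affine xG mC.
have Vx x n : x \in glist G -> V (x, n) = affine x n @^-1` C.
  by move=> xG; rewrite /V (_ : (x, n).1 = x) // xG.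
have Vx0 x n : x \notin glist G -> V (x, n) = set0.
  by move=> /negbTE xG; rewrite /V (_ : (x, n).1 = x) // xG.
pose Z := ~` (\bigcup_i V i) `|` \bigcup_(ij : (mx2t * weight) * (mx2t * weight))
  (if ij.1 == ij.2 then set0 else V ij.1 `&` V ij.2).
have [N [mN N0 ZN]] : (leb2 R).-negligible Z.
  apply: negligibleU.
    apply: negligibleS Ccov; apply: subsetC => t [g [n [gG Ct]]].
    move: gG; rewrite GammaE => -[x xG gx]; exists (x, n); first exact: Logic.I.
    by rewrite Vx // -affine_act_mx_of -gx.
  apply: negligible_countable => -[[x n] [y m]] /=.
  case: ifPn => [_|nij]; first exact: negligible_set0.
  have [xG|xG] := boolP (x \in glist G); last by rewrite Vx0// set0I; exact: negligible_set0.
  have [yG|yG] := boolP (y \in glist G); last by rewrite (Vx0 y)// setI0; exact: negligible_set0.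
  rewrite !Vx //.
  have [x' [x'G x'x xx']] := glist_inv xG.
  (* Chosen so that [affine y m] is [affine h k] after [affine x n]: an overlap of two tiles is the
     preimage of an overlap of C under a nontrivial element. *)
  pose h := tmulmx y x'; pose k := m - actz h n.
  have hG : h \in glist G by exact: glistM.
  have hx : tmulmx h x = y.
    apply: mx_of_inj; rewrite !mx_ofM -mulmxA -mx_ofM x'x mx_of1; exact: mulmx1.
  have ne : (mx_of h, k) <> (1%:M, 0).
    rewrite -mx_of1 => -[/mx_of_inj h1 k1 k2].
    case/eqP: nij; congr pair; first by rewrite -hx h1; apply: mx_of_inj; rewrite mx_ofM mx_of1 mul1mx.
    by apply: (subr_actz_id h1); apply: injective_projections; [exact: k1|exact: k2].
  have := negligible_affine n xG (Cdis _ _ (mem_Gamma hG) ne).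
  apply: negligibleS => t /= [Cx Cy]; split => //.
  by rewrite affine_act_mx_of affine_comp hx /k addrC subrK.
have Vdisj x n y m t : V (x, n) t -> V (y, m) t -> ~ N t -> (x, n) = (y, m).
  move=> Vx1 Vy1 Nt; apply: contrapT => /eqP/negbTE nij; apply: Nt; apply: ZN; right.
  by exists ((x, n), (y, m)); [exact: Logic.I|rewrite /= nij].
pose F x n := (@unit_square R `&` E) `&` (V (x, n) `\` N).
have mF x n : measurable (F x n).
  by apply: measurableI; [exact: measurableI|exact: measurableD].
have mFx x : measurable (\bigcup_n F x n) by exact: measurable_countable.
have QE_N : leb2 R (@unit_square R `&` E) =
    leb2 R (\bigcup_(x in [set` glist G]) \bigcup_n F x n).
  apply: (measure_eq_null _ _ mN) => //.
  - exact: measurableI.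
  - by apply: fin_bigcup_measurable => // x _; exact: mFx.
  - by move=> t [x _ [n _ []]].
  - move=> t QEt; have [Nt|Nt] := pselect (N t); [by right|left].
    have [[x n] _ Vt] : (\bigcup_i V i) t.
      by apply: contrapT => nV; apply: Nt; apply: ZN; left.
    exists x; last by exists n.
    by apply: contrapT => xG; move: Vt; rewrite Vx0 //; exact/negP.
have Fx x : x \in glist G -> leb2 R (\bigcup_n F x n) = leb2 R (C `&` E).
  move=> xG; have [y [yG yx xy]] := glist_inv xG.
  (* The map used here is the inverse of [affine x n]. By [F'fl] a floor determines n, so these sets
     partition the part of C in E exactly, with no null set removed. *)
  pose F' n := (C `&` E) `&` (affine y (- actz y n) @^-1` @unit_square R).
  have mF' n : measurable (F' n).
    by apply: measurableI; [exact: measurableI|exact: measurable_affine yG mQ].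
  have F'fl n t : unit_square (affine y (- actz y n) t) <-> n = actz x (torus_floor (affine y 0 t)).
    have -> : affine y (- actz y n) t = affine tid (- actz y n) (affine y 0 t).
      rewrite affine_comp actz_id add0r; congr (affine _ _ _).
      by apply: mx_of_inj; rewrite mx_ofM mx_of1 mul1mx.
    rewrite unit_squareP torus_floorD; split.
      by move=> /subr0_eq ->; rewrite actz_comp xy actz_id.
    by move=> ->; rewrite actz_comp yx actz_id subrr.
  have -> : C `&` E = \bigcup_n F' n.
    apply/seteqP; split => t; last by move=> [n _ []].
    by move=> CEt; exists (actz x (torus_floor (affine y 0 t))); [exact: Logic.I|split; [exact: CEt|exact/F'fl]].
  apply: measure_countable_eq; [exact: mF|exact: mF'|..].
  - move=> n m _ _ [t [[_ [Vn Nt]] [_ [Vm _]]]].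
    by have [] := Vdisj _ _ _ _ _ Vn Vm Nt.
  - by move=> n m _ _ [t [[_ /F'fl ->] [_ /F'fl ->]]].
  move=> n; have [_ pE] := affine_preserving n xG.
  apply: (eq_trans _ (pE _ (mF' n))); apply/esym; apply: (measure_eq_null _ _ mN) => //.
  - exact: (measurable_affine n xG (mF' n)).
  - move=> t [[Qt Et] [Vt Nt]]; move: Vt; rewrite Vx // => Ct.
    split; first by split => //; exact/Einv.
    by rewrite /preimage /= affine_comp yx subrr affine_id.
  - move=> t [[Ct /(Einv _ _ _ xG) Et]]; rewrite /preimage /= affine_comp yx subrr affine_id => Qt.
    have [Nt|Nt] := pselect (N t); [by right|left].
    by split => //; split => //; rewrite Vx.
have tF : trivIset [set` glist G] (fun x => \bigcup_n F x n).
  move=> x y _ _ [t [[n _ [_ [Vn Nt]]] [m _ [_ [Vm _]]]]].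
  by have [] := Vdisj _ _ _ _ _ Vn Vm Nt.
have := measure_fin_bigcup (leb2 R) (finite_seq (glist G)) tF (fun x _ => mFx x).
rewrite -(fsbig_seq _ _ (glist_uniq G)) (eq_big_seq (fun=> leb2 R (C `&` E))) // => sumE.
rewrite QE_N; apply: (eq_trans sumE).
by rewrite orderE sume_const_seq.
Qed.

End Tiling.

(** * The density of the spectral measure *)

Section JointMeasure.
Variables (R : realType) (G : group_name).
Implicit Types t : plane R.

Local Notation a := (tlist R (chi1_weights G)).
Local Notation b := (tlist R (chi2_weights G)).

Lemma PsiE : @Psi R G = tmap a b.
Proof. by apply/funext => t; rewrite /Psi chi1E chi2E /tmap !trig_tlist. Qed.

(** A preimage of z is chosen; by [normc_jacobian_Psi] the value on the range does not depend on the
    choice. Off the range the default point (0, 0) is taken. *)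
Definition abs_jacobian (z : C2 R) : R :=
  normc (jacobian G (xget (0, 0) [set t : plane R | Psi G t = z])).

Lemma abs_jacobian_Psi t : abs_jacobian (Psi G t) = normc (jacobian G t).
Proof.
apply: normc_jacobian_Psi.
by apply: (@xgetPex _ (0, 0) [set s | Psi G s = Psi G t]); exists t.
Qed.

Lemma spectral_measure_unique (nu : probability (C2 R) R) :
  is_joint_spectral_measure (convol a) (convol b) nu ->
  forall B, measurable B -> nu B = spectral_measure a b B.
Proof.
move=> [nu0 numom]; have [sp0 spmom] := spectral_measure_joint a b.
rewrite joint_spectrum_range in nu0 numom sp0 spmom.
apply: (@moments_determine R (range (tmap a b)) (tnorm a + tnorm b)) => //.
- exact: measurable_range_tmap.
- have t0 s : 0 <= @tnorm R s by apply: sumr_ge0 => e _; exact: normc_ge0.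
  move=> _ [t _ <-]; split; rewrite /tmap /=.
  + by apply: le_trans (normr_Re_le _) (le_trans (trig_le _ _) _); rewrite lerDl.
  + by apply: le_trans (normr_Im_le _) (le_trans (trig_le _ _) _); rewrite lerDl.
  + by apply: le_trans (normr_Re_le _) (le_trans (trig_le _ _) _); rewrite lerDr.
  + by apply: le_trans (normr_Im_le _) (le_trans (trig_le _ _) _); rewrite lerDr.
- move=> [[[m1 n1] m2] n2]; exact: (etrans (esym (numom m1 n1 m2 n2)) (spmom m1 n1 m2 n2)).
Qed.

Lemma Psi_affine x n t : x \in glist G -> Psi G (affine x n t) = Psi G t.
Proof.
move=> xG; rewrite -affine_act_mx_of /Psi !chi1E !chi2E.
by have [-> ->] := lsum_affine n t (mem_Gamma xG).
Qed.

(** The modulus of the Jacobian cancels against the density, except on its zero set, where the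
    integrand is 0. That set is null, so the integral is |Gamma| times the area of the part of C
    over B, and [tiling] applies to the invariant set of all points over B. *)
Lemma spectral_measure_area (C : set (plane R)) (B : set (C2 R)) :
  is_fundamental_domain G C -> measurable B ->
  spectral_measure a b B =
    area_integral G C (fun z => \1_B z * ((order G)%:R / abs_jacobian z)).
Proof.
move=> CG mB; have [mC _ _] := CG.
pose E := @Psi R G @^-1` B.
have mE : measurable E.
  by rewrite /E PsiE -[X in measurable X]setTI; exact: (@measurable_tmap R a b).
pose J0 := [set t : plane R | normc (jacobian G t) = 0].
have mJ0 : measurable J0.
  rewrite (_ : J0 = setT `&` (fun t => normc (jacobian G t)) @^-1` [set 0]).
    exact: (@measurable_jacobian R G).
  by rewrite setTI.
have J00 : leb2 R J0 = 0%E by exact: (measure_negligible mJ0 (@negligible_jacobian0 R G)).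
have mEJ : measurable (E `\` J0) by exact: measurableD.
have integrandE t : (\1_B (Psi G t) * ((order G)%:R / abs_jacobian (Psi G t)) *
    normc (jacobian G t))%:E = ((order G)%:R%:E * (\1_(E `\` J0) t)%:E)%E.
  rewrite -EFinM abs_jacobian_Psi; congr EFin.
  have [Jt|/eqP Jt] := eqVneq (normc (jacobian G t)) 0.
    rewrite Jt mulr0 indicE (_ : (t \in _) = false) ?mulr0 //.
    by apply/negbTE; rewrite notin_setE => -[_]; exact.
  rewrite -mulrA divfK; last exact/eqP.
  rewrite mulrC !indicE; congr (_ * _%:R); congr (nat_of_bool _).
  apply/idP/idP; rewrite !inE; first by move=> BPt; split.
  by case.
rewrite /area_integral (eq_integral (fun t => ((order G)%:R%:E * (\1_(E `\` J0) t)%:E)%E)); last first.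
  by move=> t _; exact: integrandE.
rewrite ge0_integralZl_EFin //; last first.
  by apply/measurable_EFinP; exact: measurable_indic.
rewrite integral_indic //.
have CEJ : leb2 R (C `&` E) = leb2 R ((E `\` J0) `&` C).
  apply: (measure_eq_null _ _ mJ0) => //.
  - exact: measurableI.
  - exact: measurableI.
  - by move=> t [[Et _] Ct].
  - move=> t [Ct Et]; have [Jt|Jt] := pselect (J0 t); [by right|left].
    by split.
rewrite spectral_measureE -PsiE setIC.
apply: (eq_trans _ (congr1 (mule _) CEJ)); apply: (tiling CG mE) => x n t xG.
by rewrite /E /preimage /= Psi_affine.
Qed.

End JointMeasure.

Theorem theorem3p2 (R : realType) (G : group_name) :
  let A1 := @adjacency R G (rho1 G) in
  let A2 := @adjacency R G (rho2 G) in
  joint_spectrum A1 A2 = range (@Psi R G) /\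
  exists (nu : probability (C2 R) R) (absJ : C2 R -> R),
    [/\ is_joint_spectral_measure A1 A2 nu,
        forall nu' : probability (C2 R) R,
          is_joint_spectral_measure A1 A2 nu' ->
          forall B : set (C2 R), measurable B -> nu' B = nu B,
        forall t : plane R, absJ (Psi G t) = normc (jacobian G t) &
        forall (C : set (plane R)), is_fundamental_domain G C ->
        forall B : set (C2 R), measurable B ->
          nu B = area_integral G C
                   (fun z => \1_B z * ((order G)%:R / absJ z))].
Proof.
rewrite adjacency1E adjacency2E => A1 A2; split.
  by rewrite joint_spectrum_range PsiE.
exists (spectral_measure (tlist R (chi1_weights G)) (tlist R (chi2_weights G))).
exists (@abs_jacobian R G); split.
- exact: spectral_measure_joint.
- exact: spectral_measure_unique.
- exact: abs_jacobian_Psi.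
- by move=> C CG B mB; exact: spectral_measure_area.
Qed.
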